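(* Let $M$ be a formal Levi-nondegenerate hypersurface in $\mathbb{C}^{n+1}$ of signature $\ell\le n/2$ at a point $p$. Suppose that there are two formal, CR transversal embeddings $$H_q\colon(M,p)\to\big(\mathbb{H}^{2(n+k_q)+1}_{\ell_q},0\big),\qquad q=1,2,$$ with $k_2\ge k_1\ge0$ and $\ell\le\ell_q<n-\ell$, where the coordinates $(z',w')\in\mathbb{C}^{n+k_q}\times\mathbb{C}$ are numbered so that $\mathbb{H}^{2(n+k_q)+1}_{\ell_q}$ is given by $$\operatorname{Im}w'=-\sum_{j=1}^{\ell}|z'_j|^2+\sum_{j=\ell+1}^{n}|z'_j|^2-\sum_{j=n+1}^{n+\ell_q-\ell}|z'_j|^2+\sum_{j=n+\ell_q-\ell+1}^{n+k_q}|z'_j|^2.$$ If $k_1+k_2<n$, then there exist automorphisms $T_q\in\operatorname{Aut}(\mathbb{H}^{2(n+k_q)+1}_{\ell_q},0)$, $q=1,2$, and formal holomorphic coordinates $(z,w)\in\mathbb{C}^n\times\mathbb{C}$, vanishing at $p\in M$, such that, in these coordinates, $$(T_q\circ H_q)(z,w)=(z,\phi_q(z,w),w)\in\mathbb{C}^n\times\mathbb{C}^{k_q}\times\mathbb{C},\quad q=1,2,\qquad\langle\phi_1,\overline{\phi_1}\rangle_{\ell_1-\ell}\equiv\langle\phi_2,\overline{\phi_2}\rangle_{\ell_2-\ell},$$ where the $\phi_q$'s have no constant or linear terms.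
   Context: Notation: for $0\le s\le m$, $\langle a,b\rangle_s:=-\sum_{j=1}^{s}a_jb_j+\sum_{j=s+1}^m a_jb_j$ for $a,b\in\mathbb{C}^m$. $\mathbb{H}^{2m+1}_{s}$ denotes the hyperquadric $\{(z,w)\in\mathbb{C}^m\times\mathbb{C}:\operatorname{Im}w=\langle z,\bar z\rangle_s\}$ (up to the renumbering of coordinates specified in the claim), and $\operatorname{Aut}(\mathbb{H}^{2m+1}_s,0)$ is the group of germs of local biholomorphisms $(\mathbb{C}^{m+1},0)\to(\mathbb{C}^{m+1},0)$ preserving it. Formal objects: a formal hypersurface $M\subset\mathbb{C}^{n+1}$ at $p$ is given by $\rho(Z,\bar Z)=0$, where $\rho$ is a real-valued formal power series in $(Z-p,\overline{Z-p})$ without constant term and with nonzero differential at $p$. It is Levi-nondegenerate of signature $\ell$ ($\ell\le n/2$) at $p$ if in some formal holomorphic coordinates $(z,w)$ vanishing at $p$ it is given by $\operatorname{Im}w=\langle z,\bar z\rangle_\ell+A(z,\bar z,\operatorname{Re}w)$ with $A$ vanishing to third order at $0$. A formal embedding of $(M,p)$ into $(M',0)$, $M'=\{\rho'=0\}\subset\mathbb{C}^{N+1}$, is a vector $H=(H_1,\dots,H_{N+1})$ of formal power series in $Z-p$ without constant terms, with injective differential at $p$, such that $\rho'(H,\overline H)$ is a multiple of $\rho$ in the ring of formal power series. It is CR transversal if $dH(T_pM)\not\subset T^c_0M':=T_0M'\cap iT_0M'$; for $M'$ a hyperquadric $\{(z',w')\in\mathbb{C}^N\times\mathbb{C}:\operatorname{Im}w'=\langle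 z',\bar z'\rangle_s\}$, $0\le s\le N$ (possibly with the coordinates $z'_1,\dots,z'_N$ renumbered), this is equivalent to $\partial H_{N+1}(p)\ne0$. *)

(* Defs.v *)
From HB Require Import structures.
From mathcomp Require Import all_boot all_order all_algebra.
From mathcomp Require Import complex freeg mpoly.
From mathcomp Require Import boolp reals.

Set Implicit Arguments.
Unset Strict Implicit.
Unset Printing Implicit Defensive.

Import Order.TTheory GRing.Theory Num.Theory.
Local Open Scope ring_scope.

(* Formal power series in n variables over K, as coefficient families indexed *)
(* by the multi-indices 'X_{1..n}.  A series "in Z - p" is represented by its *)
(* coefficients, so the base point p itself does not occur.                   *)
Definition fps (K : Type) (n : nat) : Type := 'X_{1..n} -> K.

HB.instance Definition _ (K : Type) n := gen_eqMixin (fps K n).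
HB.instance Definition _ (K : Type) n := gen_choiceMixin (fps K n).

Section FpsRing.
Variables (K : comNzRingType) (n : nat).
Implicit Types f g h : fps K n.

Definition fps_trunc (d : nat) f : {mpoly K[n]} :=
  \sum_(m : 'X_{1..n < d}) f m *: 'X_[m].

Definition fps_C (c : K) : fps K n := fun m => if m == 0%MM then c else 0.
Definition fps_X (i : 'I_n) : fps K n := fun m => (m == U_(i)%MM)%:R.

Definition fps_opp f : fps K n := fun m => - f m.
Definition fps_add f g : fps K n := fun m => f m + g m.
Definition fps_mul f g : fps K n := fun m =>
  \sum_(k : 'X_{1..n < (mdeg m).+1, (mdeg m).+1} | m == (k.1 + k.2)%MM)
    f k.1 * g k.2.

Lemma fps_truncE d f m : (mdeg m < d)%N -> (fps_trunc d f)@_m = f m.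
Proof. by move=> ltmd; rewrite /fps_trunc mcoeff_mpoly. Qed.

Lemma fps_mulE f g (p q : {mpoly K[n]}) m :
    (forall k, (mdeg k <= mdeg m)%N -> f k = p@_k) ->
    (forall k, (mdeg k <= mdeg m)%N -> g k = q@_k) ->
  fps_mul f g m = (p * q)@_m.
Proof.
move=> fp gq; rewrite mcoeffM /fps_mul; apply: eq_bigr => -[k1 k2] /= _.
by congr (_ * _); [apply: fp | apply: gq]; rewrite -ltnS bmdeg.
Qed.

Lemma fps_mul_trunc f g d m : (mdeg m < d)%N ->
  fps_mul f g m = (fps_trunc d f * fps_trunc d g)@_m.
Proof.
by move=> md; apply: fps_mulE => k km; rewrite fps_truncE // (leq_ltn_trans km).
Qed.

Fact fps_addA : associative fps_add.
Proof. by move=> f g h; apply/funext => m; rewrite /fps_add addrA. Qed.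
Fact fps_addC : commutative fps_add.
Proof. by move=> f g; apply/funext => m; rewrite /fps_add addrC. Qed.
Fact fps_add0 : left_id (fps_C 0) fps_add.
Proof. by move=> f; apply/funext => m; rewrite /fps_add /fps_C if_same add0r. Qed.
Fact fps_addN : left_inverse (fps_C 0) fps_opp fps_add.
Proof.
by move=> f; apply/funext => m; rewrite /fps_add /fps_opp /fps_C if_same addNr.
Qed.

HB.instance Definition _ :=
  GRing.isZmodule.Build (fps K n) fps_addA fps_addC fps_add0 fps_addN.

Fact fps_mulA : associative fps_mul.
Proof.
move=> f g h; apply/funext => m; pose d := (mdeg m).+1.
rewrite (@fps_mulE _ _ (fps_trunc d f) (fps_trunc d g * fps_trunc d h)).
- rewrite mulrA; apply/esym/fps_mulE => k km; rewrite ?fps_truncE //.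
  exact: fps_mul_trunc.
- by move=> k km; rewrite fps_truncE.
- by move=> k km; apply: fps_mul_trunc.
Qed.

Fact fps_mulC : commutative fps_mul.
Proof.
move=> f g; apply/funext => m.
by rewrite !(@fps_mul_trunc _ _ (mdeg m).+1) // mulrC.
Qed.

Fact fps_mul1 : left_id (fps_C 1) fps_mul.
Proof.
move=> f; apply/funext => m.
rewrite (@fps_mulE _ _ 1 (fps_trunc (mdeg m).+1 f)) ?mul1r ?fps_truncE //.
  by move=> k _; rewrite mcoeff1 /fps_C; case: eqP.
by move=> k km; rewrite fps_truncE.
Qed.

Fact fps_mulDl : left_distributive fps_mul fps_add.
Proof.
move=> f g h; apply/funext => m; rewrite /fps_mul /fps_add -big_split /=.
by apply: eq_bigr => k _; rewrite mulrDl.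
Qed.

Fact fps_1neq0 : fps_C 1 != 0 :> fps K n.
Proof.
apply/eqP => /(congr1 (fun f : fps K n => f 0%MM)) /eqP.
by rewrite /GRing.zero /= /fps_C eqxx oner_eq0.
Qed.

HB.instance Definition _ := GRing.Zmodule_isComNzRing.Build (fps K n)
  fps_mulA fps_mulC fps_mul1 fps_mulDl fps_1neq0.

End FpsRing.

Arguments fps_X K {n} i.

Section FpsOps.
Variable K : comNzRingType.

Definition fps_map n (s : K -> K) (f : fps K n) : fps K n := fun m => s (f m).

(* Substitution f(G); it is the usual one when the components of G have no    *)
(* constant term, the coefficient at m then depending only on the terms of f  *)
(* and G of degree at most mdeg m.                                            *)
Definition fps_comp n p (f : fps K n) (G : 'rV[fps K p]_n) : fps K p := fun m =>
  (fps_trunc (mdeg m).+1 f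
     \mPo [tuple fps_trunc (mdeg m).+1 (G 0 i) | i < n])@_m.

(* G o H *)
Definition fps_mcomp n p q (G : 'rV[fps K n]_q) (H : 'rV[fps K p]_n) :
  'rV[fps K p]_q := \row_j fps_comp (G 0 j) H.

Definition fps_vars n : 'rV[fps K n]_n := \row_i fps_X K i.

Definition vanishing_at0 n N (H : 'rV[fps K n]_N) : Prop :=
  forall j, H 0 j 0%MM = 0.

(* Row i, column j holds the derivative of H_j in the direction i at 0, so    *)
(* that the differential of H at 0 is v |-> v *m jacobian0 H on row vectors.  *)
Definition jacobian0 n N (H : 'rV[fps K n]_N) : 'M[K]_(n, N) :=
  \matrix_(i, j) H 0 j U_(i)%MM.

End FpsOps.

(* In C^(m+1) = C^m x C a point is the row vector (z, w); in C^(n+k+1), z is   *)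
(* itself the row vector (z_1, z_2) in C^n x C^k.                             *)
Section Forms.
Variable A : pzRingType.

(* < a, b >_s *)
Definition herm m (s : nat) (a b : 'rV[A]_m) : A :=
  - (\sum_(j < m | (j < s)%N) a 0 j * b 0 j)
  + \sum_(j < m | (s <= j)%N) a 0 j * b 0 j.

(* The form < a, b >_(l') on C^(n+k), with the coordinates renumbered so that *)
(* the first n of them carry < , >_l.                                         *)
Definition herm_renum n k (l l' : nat) (a b : 'rV[A]_(n + k)) : A :=
  - (\sum_(j < n + k | (j < l)%N) a 0 j * b 0 j)
  + (\sum_(j < n + k | (l <= j < n)%N) a 0 j * b 0 j)
  - (\sum_(j < n + k | (n <= j < n + l' - l)%N) a 0 j * b 0 j)
  + \sum_(j < n + k | (n + l' - l <= j)%N) a 0 j * b 0 j.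

End Forms.

Section Hypersurfaces.
Variable R : realType.
Local Notation C := R[i].

(* Z = F(Z'), expressing the given coordinates Z through the new ones Z'.     *)
Definition formal_coordinates n (F : 'rV[fps C n]_n) : Prop :=
  vanishing_at0 F /\ jacobian0 F \in unitmx.

(* Series in (Z, conj Z), Z in C^n, are series in n + n independent variables.*)
Definition vZ n : 'rV[fps C (n + n)]_n := lsubmx (fps_vars C (n + n)).
Definition vZbar n : 'rV[fps C (n + n)]_n := rsubmx (fps_vars C (n + n)).

(* H(Z) and conj (H(Z)), as series in (Z, conj Z) *)
Definition hol n N (H : 'rV[fps C n]_N) : 'rV[fps C (n + n)]_N :=
  fps_mcomp H (vZ n).
Definition antihol n N (H : 'rV[fps C n]_N) : 'rV[fps C (n + n)]_N :=
  fps_mcomp (map_mx (fps_map Num.conj) H) (vZbar n).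

(* rho(F, conj F) *)
Definition pullback n N (rho : fps C (N + N)) (F : 'rV[fps C n]_N) :
  fps C (n + n) := fps_comp rho (row_mx (hol F) (antihol F)).

Definition real_valued n (rho : fps C (n + n)) : Prop :=
  fps_comp (fps_map Num.conj rho) (row_mx (vZbar n) (vZ n)) = rho.

Definition formal_hypersurface n (rho : fps C (n + n)) : Prop :=
  [/\ real_valued rho, rho 0%MM = 0 & exists i, rho U_(i)%MM != 0].

Section Coordinates.
Variable m : nat.

Definition vz : 'rV[fps C ((m + 1) + (m + 1))]_m := lsubmx (vZ (m + 1)).
Definition vzbar : 'rV[fps C ((m + 1) + (m + 1))]_m := lsubmx (vZbar (m + 1)).
Definition vw : fps C ((m + 1) + (m + 1)) := rsubmx (vZ (m + 1)) 0 0.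
Definition vwbar : fps C ((m + 1) + (m + 1)) := rsubmx (vZbar (m + 1)) 0 0.

Definition vRew : fps C ((m + 1) + (m + 1)) := fps_C 2^-1 * (vw + vwbar).
Definition vImw : fps C ((m + 1) + (m + 1)) := fps_C (2 * 'i)^-1 * (vw - vwbar).

End Coordinates.

Arguments vw m : clear implicits.
Arguments vwbar m : clear implicits.
Arguments vRew m : clear implicits.
Arguments vImw m : clear implicits.

(* Real-valuedness of a series A(z, conj z, s) with s a real variable *)
Definition real_valued_s m (A : fps C (m + m + 1)) : Prop :=
  let x := fps_vars C (m + m + 1) in
  fps_comp (fps_map Num.conj A)
    (row_mx (row_mx (rsubmx (lsubmx x)) (lsubmx (lsubmx x))) (rsubmx x)) = A.

Definition levi_nondegenerate n (l : nat) (rho : fps C ((n + 1) + (n + 1))) :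
    Prop :=
  exists (F : 'rV[fps C (n + 1)]_(n + 1)) (A : fps C (n + n + 1))
         (u : fps C ((n + 1) + (n + 1))),
    [/\ formal_coordinates F,
        real_valued_s A,
        forall mu, (mdeg mu < 3)%N -> A mu = 0,
        u 0%MM != 0 &
        pullback rho F =
          u * (vImw n - herm l (vz n) (vzbar n)
               - fps_comp A (row_mx (row_mx (vz n) (vzbar n)) (vRew n)%:M))].

Definition formal_embedding n N (rho : fps C (n + n)) (rho' : fps C (N + N))
    (H : 'rV[fps C n]_N) : Prop :=
  [/\ vanishing_at0 H, row_free (jacobian0 H) &
      exists a : fps C (n + n), pullback rho' H = a * rho].

(* T_p M, as a real hyperplane of C^n *)
Definition tangent n (rho : fps C (n + n)) (v : 'rV[C]_n) : Prop :=
  \sum_(i < n) (rho U_(lshift n i)%MM * v 0 i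
                + rho U_(rshift n i)%MM * (v 0 i)^*) = 0.

Definition complex_tangent n (rho : fps C (n + n)) (v : 'rV[C]_n) : Prop :=
  tangent rho v /\ exists2 v', tangent rho v' & v = 'i *: v'.

Definition CR_transversal n N (rho : fps C (n + n)) (rho' : fps C (N + N))
    (H : 'rV[fps C n]_N) : Prop :=
  ~ (forall v, tangent rho v -> complex_tangent rho' (v *m jacobian0 H)).

(* The hyperquadric Im w' = < z', conj z' >_(l'), in the numbering of         *)
(* herm_renum: its defining series, and the set of its points.                *)
Definition hyperquadric_series n k (l l' : nat) :
    fps C ((n + k + 1) + (n + k + 1)) :=
  vImw (n + k) - herm_renum l l' (vz (n + k)) (vzbar (n + k)).

Definition hyperquadric n k (l l' : nat) (Z : 'rV[C]_(n + k + 1)) : Prop :=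
  'Im (rsubmx Z 0 0) = herm_renum l l' (lsubmx Z) (map_mx Num.conj (lsubmx Z)).

Definition convergent n (f : fps C n) : Prop :=
  exists2 r : C, 0 < r & exists B : C, forall d,
    \sum_(m : 'X_{1..n < d}) `|f m| * r ^+ mdeg m <= B.

(* f converges to y at Z; for Z in a polydisc of absolute convergence, the    *)
(* order of summation (here by total degree) is immaterial.                   *)
Definition has_value n (f : fps C n) (Z : 'rV[C]_n) (y : C) : Prop :=
  forall e : C, 0 < e -> exists d0 : nat, forall d, (d0 <= d)%N ->
    `|(fps_trunc d f).@[fun i => Z 0 i] - y| < e.

Definition holomorphic_germ n (T : 'rV[fps C n]_n) : Prop :=
  vanishing_at0 T /\ forall j, convergent (T 0 j).

Definition inverse_germs n (T S : 'rV[fps C n]_n) : Prop :=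
  fps_mcomp T S = fps_vars C n /\ fps_mcomp S T = fps_vars C n.

Definition preserves_germ n (S : 'rV[C]_n -> Prop) (T : 'rV[fps C n]_n) : Prop :=
  exists2 r : C, 0 < r & forall Z W : 'rV[C]_n,
    (forall i, `|Z 0 i| < r) -> S Z ->
    (forall j, has_value (T 0 j) Z (W 0 j)) -> S W.

(* Aut(S, 0), a germ of a local biholomorphism being given by its power       *)
(* series                                                                     *)
Definition Aut0 n (S : 'rV[C]_n -> Prop) (T : 'rV[fps C n]_n) : Prop :=
  exists T' : 'rV[fps C n]_n,
    [/\ holomorphic_germ T, holomorphic_germ T', inverse_germs T T',
        preserves_germ S T & preserves_germ S T'].

End Hypersurfaces.

Arguments hyperquadric_series R n k l l' : clear implicits.
Arguments hyperquadric R n k l l' Z : clear implicits.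

(* Main.v *)
Require Import Defs.
From HB Require Import structures.
From mathcomp Require Import all_boot all_order all_algebra.
From mathcomp Require Import complex freeg mpoly.
From mathcomp Require Import boolp reals.
From mathcomp Require Import ring lra zify.

(** The hypersurface M is compared with its Levi form through the rank of matrices of
    coefficients.  A series F(Z, conj Z) is a matrix indexed by pairs of exponents, and
    a sum of k products p(Z) q(conj Z) has rank at most k.  The basic fact is a form of
    Huang's lemma ([rank_lemma]): if rho = w - conj w - 2i <z, conj z> + higher terms
    and A <> 0, then A rho has rank at least n.  Indeed, for a suitable order the leading
    part of A times z_1 conj(z_1) +- ... +- z_n conj(z_n) contributes n entries, one
    for each j, that form a triangular minor ([rank_minors]).

    Linear fractional automorphisms of the hyperquadrics normalize the embeddings to
    first order ([normalize_jet]): transversality makes the multiplier of the defining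
    equations a unit, inertia and l + l_q < n make it positive at 0, Witt's theorem
    straightens the tangential derivatives, and an isotropy map removes the derivatives
    in w.  Choosing coordinates by the formal inverse function theorem, the first
    embedding becomes (z, phi1, w), and the second is (f, phi, g), equal to (z, 0, w) up to
    terms of order two, with

      g - conj g - 2i <f, conj f> - 2i <phi, conj phi>
        = a (w - conj w - 2i <z, conj z> - 2i <phi1, conj phi1>).

    The rank lemma is used twice in this identity, and k1 + k2 < n enters there
    ([core_rigidity]).  On conj w = 0 the low-order terms give f(z, 0) = z; subtracting
    the value h(Z) of a at conj Z = 0, the remainder is a multiple of the defining
    series that has rank at most k1 + k2 on the columns of degree at least two in
    conj z.  Hence the multiplier vanishes there, f = h z and g = h w.  After
    division by h conj(h) the difference of the two defining series is a multiple
    of one of them and has rank at most k1 + k2 outside one row and one column; so it is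
    zero, and the excluded row shows 1 / h = 1 + r w with r real.  One more isotropy
    map divides the second embedding by h, which gives (z, phi / h, w), and
    <phi / h, conj (phi / h)> = <phi1, conj phi1>. *)

Set Implicit Arguments.
Unset Strict Implicit.
Unset Printing Implicit Defensive.

Import Order.TTheory GRing.Theory Num.Theory.
Local Open Scope ring_scope.

(** * Coefficients of formal power series *)
Section FpsCoef.
Variables (K : comNzRingType) (n : nat).
Implicit Types (f g : fps K n) (m : 'X_{1..n}).

Lemma fpsDE f g m : (f + g) m = f m + g m. Proof. by []. Qed.
Lemma fpsNE f m : (- f) m = - f m. Proof. by []. Qed.
Lemma fpsBE f g m : (f - g) m = f m - g m. Proof. by []. Qed.
Lemma fps0E m : (0 : fps K n) m = 0.
Proof. by rewrite /GRing.zero /= /fps_C if_same. Qed.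
Lemma fps1E m : (1 : fps K n) m = (m == 0%MM)%:R.
Proof. by rewrite /GRing.one /= /fps_C; case: eqP. Qed.
Lemma fps_CE c m : fps_C c m = c *+ (m == 0%MM) :> K.
Proof. by rewrite /fps_C; case: eqP. Qed.
Lemma fps_sumE I r (P : pred I) (F : I -> fps K n) m :
  (\sum_(i <- r | P i) F i) m = \sum_(i <- r | P i) F i m.
Proof.
by elim/big_rec2: _ => [|i x y _ <-]; rewrite ?fps0E ?fpsDE.
Qed.
Lemma fpsME f g m : (f * g) m =
  \sum_(k : 'X_{1..n < (mdeg m).+1, (mdeg m).+1} | m == (k.1 + k.2)%MM)
    f k.1 * g k.2.
Proof. by []. Qed.

Lemma fpsM_coef0 f g m :
  (forall k1 k2, m = (k1 + k2)%MM -> f k1 * g k2 = 0) -> (f * g) m = 0.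
Proof. by move=> h; rewrite fpsME big1 // => k /eqP; apply: h. Qed.

(** Most coefficients computed below come from a single splitting of the exponent
    that contributes. *)
Lemma fpsM_coef1 f g m k1 k2 : m = (k1 + k2)%MM ->
  (forall k1' k2', m = (k1' + k2')%MM -> k1' <> k1 -> f k1' * g k2' = 0) ->
  (f * g) m = f k1 * g k2.
Proof.
move=> mE h.
have b1 : (mdeg k1 < (mdeg m).+1)%N by rewrite mE mdegD ltnS leq_addr.
have b2 : (mdeg k2 < (mdeg m).+1)%N by rewrite mE mdegD ltnS leq_addl.
rewrite fpsME (bigD1 (BMultinom b1, BMultinom b2)) /=; last exact/eqP.
rewrite big1 ?addr0 // => -[l1 l2] /= /andP[/eqP lE neq].
have [e|/eqP ne] := eqVneq (bmnm l1) k1; last exact: h.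
have e2 : bmnm l2 = k2 by apply: (@addmI n k1); rewrite -e -lE e mE.
case/negP: neq; rewrite xpair_eqE.
by apply/andP; split; apply/eqP/val_inj.
Qed.

Lemma fpsM_coef0E f g : (f * g) 0%MM = f 0%MM * g 0%MM.
Proof.
apply: fpsM_coef1; first by rewrite addm0.
move=> k1 k2 /esym /eqP; rewrite mnmD_eq0 => /andP[/eqP -> _] []; exact/eqP.
Qed.

Lemma fps_ext f g : (forall m, f m = g m) -> f = g.
Proof. by move=> h; apply/funext. Qed.

Lemma fps_CD (a b : K) : fps_C (a + b) = fps_C a + fps_C b :> fps K n.
Proof. by apply/fps_ext => m; rewrite fpsDE !fps_CE mulrnDl. Qed.

Lemma fps_CME (a : K) f m : (fps_C a * f) m = a * f m.
Proof.
rewrite (@fpsM_coef1 _ _ _ 0%MM m) ?add0m ?fps_CE ?eqxx ?mulr1n //.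
by move=> k1 k2 _ /eqP/negPf h; rewrite fps_CE h mul0r.
Qed.

Lemma fps_CM (a b : K) : fps_C (a * b) = fps_C a * fps_C b :> fps K n.
Proof. by apply/fps_ext => m; rewrite fps_CME !fps_CE mulrnAr. Qed.

Lemma fps_CN (a : K) : fps_C (- a) = - fps_C a :> fps K n.
Proof. by apply/fps_ext => m; rewrite fpsNE !fps_CE mulNrn. Qed.

End FpsCoef.

(** * Agreement of series below a degree *)

Section Agree.
Variables (K : comNzRingType) (n : nat).
Implicit Types (f g : fps K n) (m : 'X_{1..n}).

Definition agree d f g := forall m, (mdeg m < d)%N -> f m = g m.
Definition ordge d f := agree d f 0.

Lemma agree_refl d f : agree d f f. Proof. by []. Qed.
Lemma agree_trans d f g h : agree d f g -> agree d g h -> agree d f h.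
Proof. by move=> a b m md; rewrite a ?b. Qed.
Lemma agree_sym d f g : agree d f g -> agree d g f.
Proof. by move=> a m md; rewrite a. Qed.
Lemma agreeM d f g f' g' : agree d f f' -> agree d g g' -> agree d (f * g) (f' * g').
Proof.
move=> a b m md; rewrite !fpsME; apply: eq_bigr => -[[k1 b1] [k2 b2]] /= _.
by rewrite a ?b // (leq_trans _ md).
Qed.
Lemma agree_sub d f g : agree d f g <-> ordge d (f - g).
Proof.
split=> h m md.
  by rewrite fpsBE h // subrr fps0E.
by apply/eqP; rewrite -subr_eq0 -fpsBE h // fps0E.
Qed.
Lemma agree_le d e f g : (e <= d)%N -> agree d f g -> agree e f g.
Proof. by move=> le h m me; apply: h; apply: leq_trans le. Qed.
Lemma ordgeE d f : ordge d f <-> forall m, (mdeg m < d)%N -> f m = 0.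
Proof. by split=> h m md; rewrite h // fps0E. Qed.
Lemma ordge1 f : f 0%MM = 0 -> ordge 1 f.
Proof. by move=> h m; rewrite ltnS leqn0 mdeg_eq0 => /eqP ->; rewrite fps0E. Qed.
Lemma ordgeM a b f g : ordge a f -> ordge b g -> ordge (a + b) (f * g).
Proof.
move=> /ordgeE hf /ordgeE hg; apply/ordgeE => m md; apply: fpsM_coef0 => k1 k2 mE.
have [l|l] := ltnP (mdeg k1) a; first by rewrite hf // mul0r.
rewrite hg ?mulr0 //; move: md; rewrite mE mdegD; lia.
Qed.
Lemma ordgeD d f g : ordge d f -> ordge d g -> ordge d (f + g).
Proof. by move=> /ordgeE a /ordgeE b; apply/ordgeE => m md; rewrite fpsDE a ?b ?addr0. Qed.
Lemma agree_prod d I r (P : pred I) (F G : I -> fps K n) :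
  (forall i, P i -> agree d (F i) (G i)) ->
  agree d (\prod_(i <- r | P i) F i) (\prod_(i <- r | P i) G i).
Proof.
move=> h; elim/big_rec2: _ => [//|i x y Pi]; apply: agreeM; exact: h.
Qed.
Lemma agree_exp d f g k : agree d f g -> agree d (f ^+ k) (g ^+ k).
Proof.
move=> h; elim: k => [//|k IH]; rewrite !exprS; exact: agreeM.
Qed.
Lemma ordge_exp d f k : ordge d f -> ordge (d * k) (f ^+ k).
Proof.
move=> h; elim: k => [|k IH]; first by rewrite muln0.
by rewrite exprS mulnS; apply: ordgeM.
Qed.
Lemma agree_all f g : (forall d, agree d f g) -> f = g.
Proof. by move=> h; apply/fps_ext => m; apply: (h (mdeg m).+1). Qed.

(** One degree is gained because each error is multiplied by a factor without
    constant term. *)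
Lemma agreeM_S d f g f' g' : f 0%MM = 0 -> g' 0%MM = 0 ->
  agree d f f' -> agree d g g' -> agree d.+1 (f * g) (f' * g').
Proof.
move=> f0 g0 /agree_sub a /agree_sub b; apply/agree_sub.
have -> : f * g - f' * g' = f * (g - g') + (f - f') * g'.
  by rewrite mulrBr mulrBl addrA subrK.
apply: ordgeD; first by rewrite -add1n; apply: ordgeM => //; apply: ordge1.
by rewrite -addn1; apply: ordgeM => //; apply: ordge1.
Qed.

Definition fps_of (p : {mpoly K[n]}) : fps K n := fun m => p@_m.
Lemma fps_ofM p q : fps_of (p * q) = fps_of p * fps_of q.
Proof.
apply/fps_ext => m; apply/esym/fps_mulE => //.
Qed.
Lemma fps_of1 : fps_of 1 = 1.
Proof. by apply/fps_ext => m; rewrite fps1E /fps_of mcoeff1. Qed.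
Lemma fps_ofX p k : fps_of (p ^+ k) = fps_of p ^+ k.
Proof. by elim: k => [|k IH]; rewrite ?expr0 ?fps_of1 // !exprS fps_ofM IH. Qed.
Lemma fps_of_prod I r (P : pred I) (F : I -> {mpoly K[n]}) :
  fps_of (\prod_(i <- r | P i) F i) = \prod_(i <- r | P i) fps_of (F i).
Proof. exact: (big_morph fps_of fps_ofM fps_of1). Qed.
Lemma fps_of_trunc d f : agree d (fps_of (fps_trunc d f)) f.
Proof. by move=> m md; rewrite /fps_of fps_truncE. Qed.
End Agree.

(** * Substitution *)

Section Comp.
Variables (K : comNzRingType).

Definition mon_comp n p (G : 'rV[fps K p]_n) (k : 'X_{1..n}) : fps K p :=
  \prod_(i < n) G 0 i ^+ k i.

Lemma mon_comp_ord n p (G : 'rV[fps K p]_n) k : vanishing_at0 G ->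
  ordge (mdeg k) (mon_comp G k).
Proof.
move=> G0; rewrite mdegE /mon_comp.
elim/big_rec2: _ => [//|i x y _ h]; apply: ordgeM => //.
by have := ordge_exp (k := k i) (ordge1 (G0 i)); rewrite mul1n.
Qed.

Lemma mon_compD n p (G : 'rV[fps K p]_n) k1 k2 :
  mon_comp G (k1 + k2)%MM = mon_comp G k1 * mon_comp G k2.
Proof. by rewrite -big_split /=; apply: eq_bigr => i _; rewrite mnmDE exprD. Qed.
Lemma mon_comp0 n p (G : 'rV[fps K p]_n) : mon_comp G 0%MM = 1.
Proof. by rewrite /mon_comp big1 // => i _; rewrite mnm0E expr0. Qed.
Lemma mon_compU n p (G : 'rV[fps K p]_n) i : mon_comp G U_(i)%MM = G 0 i.
Proof.
rewrite /mon_comp (bigD1 i) //= mnm1E eqxx expr1 big1 ?mulr1 // => j /negPf ji.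
by rewrite mnm1E eq_sym ji expr0.
Qed.

(** Substitution as a sum of monomials in G, with any truncation order beyond the
    degree of the coefficient: this frees the definition of [fps_comp] from the
    degree it depends on. *)
Lemma fps_comp_sum n p (f : fps K n) (G : 'rV[fps K p]_n) m d :
  vanishing_at0 G -> (mdeg m < d)%N ->
  fps_comp f G m = \sum_(k : 'X_{1..n < d}) f k * mon_comp G k m.
Proof.
move=> G0 md; rewrite /fps_comp.
set D := (mdeg m).+1; set t := [tuple _ | i < n].
have step (k : 'X_{1..n}) : ('X_[k] \mPo t)@_m = mon_comp G k m.
  rewrite comp_mpolyX -[LHS]/(fps_of _ m) fps_of_prod.
  apply: (@agree_prod _ _ D) => // i _; rewrite fps_ofX; apply: agree_exp.
  by rewrite tnth_mktuple; apply: fps_of_trunc.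
have sz : (msize (fps_trunc D f) <= d)%N.
  rewrite msizeE; apply/bigmax_leqP_seq => k; rewrite mcoeff_msupp => kP _.
  apply: leq_trans md; rewrite ltnNge; apply: contra kP => Dk.
  rewrite /fps_trunc raddf_sum big1 // => -[i iD] _ /=.
  rewrite mcoeffZ mcoeffX; case: eqP => [e|_]; rewrite ?mulr0 //.
  by move: iD; rewrite e ltnNge Dk.
rewrite (comp_mpolywE _ sz) raddf_sum; apply: eq_bigr => k _ /=.
rewrite mcoeffZ -comp_mpolyX step.
have [kD|Dk] := ltnP (mdeg k) D; first by rewrite fps_truncE.
by rewrite ((ordgeE _ _).1 (@mon_comp_ord _ _ G k G0)) ?mulr0.
Qed.

(** Homomorphisms continuous for the order filtration; substitutions and
    conjugation are the examples.  They are determined on polynomials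
    ([chom_ext]), which is how identities between composites are proved. *)
Definition chom n p (Phi : fps K n -> fps K p) :=
  [/\ {morph Phi : f g / f + g}, {morph Phi : f g / f * g}, Phi 1 = 1 &
      forall d f, ordge d f -> ordge d (Phi f)].

Lemma fps_comp_ord n p (f : fps K n) (G : 'rV[fps K p]_n) d :
  vanishing_at0 G -> ordge d f -> ordge d (fps_comp f G).
Proof.
move=> G0 /ordgeE hf; apply/ordgeE => m md.
rewrite (fps_comp_sum _ G0 md) big1 // => -[k kd] _ /=.
by rewrite hf // mul0r.
Qed.

Lemma fps_compD n p (f g : fps K n) (G : 'rV[fps K p]_n) :
  vanishing_at0 G -> fps_comp (f + g) G = fps_comp f G + fps_comp g G.
Proof.
move=> G0; apply/fps_ext => m; rewrite fpsDE.
rewrite !(fps_comp_sum _ G0 (leqnn _)) -big_split /=.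
by apply: eq_bigr => k _; rewrite fpsDE mulrDl.
Qed.

Lemma fps_comp_agree n p (f g : fps K n) (G : 'rV[fps K p]_n) d :
  vanishing_at0 G -> agree d f g -> agree d (fps_comp f G) (fps_comp g G).
Proof.
move=> G0 h m md; rewrite !(fps_comp_sum _ G0 md).
by apply: eq_bigr => -[k kd] _ /=; rewrite h.
Qed.

Lemma mon_comp_tuple n p (k : 'X_{1..n}) (t : n.-tuple {mpoly K[p]}) :
  fps_of ('X_[k] \mPo t) = mon_comp (\row_i fps_of (tnth t i)) k.
Proof.
rewrite comp_mpolyX fps_of_prod; apply: eq_bigr => i _.
by rewrite fps_ofX mxE.
Qed.

Lemma fps_comp_poly n p (q : {mpoly K[n]}) (t : n.-tuple {mpoly K[p]}) :
  vanishing_at0 (\row_i fps_of (tnth t i)) ->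
  fps_comp (fps_of q) (\row_i fps_of (tnth t i)) = fps_of (q \mPo t).
Proof.
move=> t0; apply/fps_ext => m.
pose d := maxn (msize q) (mdeg m).+1.
have md : (mdeg m < d)%N by rewrite leq_max leqnn orbT.
rewrite (fps_comp_sum _ t0 md) {2}(mpolywE (leq_maxl (msize q) (mdeg m).+1)).
rewrite linear_sum /fps_of raddf_sum /=; apply: eq_bigr => k _.
by rewrite comp_mpolyZ mcoeffZ -mon_comp_tuple.
Qed.

(** Below each degree the series may be replaced by polynomials, and composition of
    polynomials is multiplicative. *)
Lemma fps_compM n p (f g : fps K n) (G : 'rV[fps K p]_n) :
  vanishing_at0 G -> fps_comp (f * g) G = fps_comp f G * fps_comp g G.
Proof.
move=> G0; apply: agree_all => d.
case: d => [//|d].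
pose tf := fps_trunc d.+1 f; pose tg := fps_trunc d.+1 g.
pose t := [tuple fps_trunc d.+1 (G 0 i) | i < n].
pose G' : 'rV[fps K p]_n := \row_i fps_of (tnth t i).
have aG i : agree d.+1 (G 0 i) (G' 0 i).
  by rewrite mxE tnth_mktuple; apply/agree_sym/fps_of_trunc.
have G'0 : vanishing_at0 G' by move=> i; rewrite -aG // mdeg0.
have cG (h : fps K n) : agree d.+1 (fps_comp h G) (fps_comp h G').
  move=> m md; rewrite (fps_comp_sum _ G0 md) (fps_comp_sum _ G'0 md).
  apply: eq_bigr => k _; congr (_ * _); apply: (@agree_prod _ _ d.+1) => // i _.
  exact: agree_exp.
have cf h : agree d.+1 (fps_comp h G) (fps_of (fps_trunc d.+1 h \mPo t)).
  apply: agree_trans (cG h) _; rewrite -fps_comp_poly //.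
  by apply: fps_comp_agree => //; apply/agree_sym/fps_of_trunc.
apply: agree_trans (agree_sym (agreeM (cf f) (cf g))).
rewrite -fps_ofM -rmorphM /= -fps_comp_poly //.
apply: agree_trans (cG _) _; apply: fps_comp_agree => //.
rewrite fps_ofM; apply: agreeM; apply/agree_sym/fps_of_trunc.
Qed.

Lemma fps_compC n p c (G : 'rV[fps K p]_n) : vanishing_at0 G ->
  fps_comp (fps_C c) G = fps_C c.
Proof.
move=> G0; apply/fps_ext => m; rewrite (fps_comp_sum _ G0 (leqnn _)).
have b0 : (mdeg (0%MM : 'X_{1..n}) < (mdeg m).+1)%N by rewrite mdeg0.
rewrite (bigD1 (BMultinom b0)) //= big1 => [|k /eqP kN].
  by rewrite mon_comp0 fps_CE eqxx fps1E addr0 fps_CE mulr1n mulr_natr.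
rewrite fps_CE; case: eqP => [e|_]; rewrite ?mul0r //.
by case: kN; apply/val_inj.
Qed.
Lemma fps_comp1 n p (G : 'rV[fps K p]_n) : vanishing_at0 G -> fps_comp 1 G = 1.
Proof. exact: fps_compC. Qed.

Lemma fps_compX n p i (G : 'rV[fps K p]_n) : vanishing_at0 G ->
  fps_comp (fps_X K i) G = G 0 i.
Proof.
move=> G0; apply/fps_ext => m; rewrite (@fps_comp_sum _ _ _ _ _ (mdeg m).+2) //.
have b0 : (mdeg (U_(i)%MM : 'X_{1..n}) < (mdeg m).+2)%N by rewrite mdeg1.
rewrite (bigD1 (BMultinom b0)) //= big1 => [|k /eqP kN].
  by rewrite mon_compU /fps_X eqxx mul1r addr0.
rewrite /fps_X; case: eqP => [e|_]; rewrite ?mul0r //.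
by case: kN; apply/val_inj.
Qed.

Lemma fps_comp_chom n p (G : 'rV[fps K p]_n) : vanishing_at0 G ->
  chom (fun f => fps_comp f G).
Proof.
move=> G0; split=> [f g|f g||d f].
- exact: fps_compD.
- exact: fps_compM.
- exact: fps_comp1.
- exact: fps_comp_ord.
Qed.

Lemma chom_id n : chom (@id (fps K n)). Proof. by split. Qed.
Lemma chom_comp n p q (Phi : fps K n -> fps K p) (Psi : fps K q -> fps K n) :
  chom Phi -> chom Psi -> chom (Phi \o Psi).
Proof.
move=> [a b o c] [a' b' o' c']; split=> [f g|f g||d f h] /=; rewrite ?a' ?b' ?o' ?a ?b //.
by apply/c/c'.
Qed.

Lemma chom0 n p (Phi : fps K n -> fps K p) : chom Phi -> Phi 0 = 0.
Proof.
by move=> [a _ _ _]; apply: (addrI (Phi 0)); rewrite -a !addr0.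
Qed.
Lemma chomN n p (Phi : fps K n -> fps K p) : chom Phi -> {morph Phi : f / - f}.
Proof.
move=> h f; apply/eqP; rewrite -addr_eq0; case: (h) => a _ _ _.
by rewrite -a addNr chom0.
Qed.
Lemma chomB n p (Phi : fps K n -> fps K p) : chom Phi -> {morph Phi : f g / f - g}.
Proof. by move=> h f g; case: (h) => a _ _ _; rewrite a chomN. Qed.
Lemma chom_sum n p (Phi : fps K n -> fps K p) : chom Phi ->
  forall I r (P : pred I) F, Phi (\sum_(i <- r | P i) F i) = \sum_(i <- r | P i) Phi (F i).
Proof. by move=> h I r P F; case: (h) => a _ _ _; apply: (big_morph Phi a (chom0 h)). Qed.
Lemma chom_prod n p (Phi : fps K n -> fps K p) : chom Phi ->
  forall I r (P : pred I) F, Phi (\prod_(i <- r | P i) F i) = \prod_(i <- r | P i) Phi (F i).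
Proof. by move=> [_ a o _] I r P F; apply: (big_morph Phi a o). Qed.
Lemma chom_exp n p (Phi : fps K n -> fps K p) f k : chom Phi ->
  Phi (f ^+ k) = Phi f ^+ k.
Proof. by move=> [_ a o _]; elim: k => [//|k IH]; rewrite !exprS a IH. Qed.
Lemma chom_agree n p (Phi : fps K n -> fps K p) d f g : chom Phi ->
  agree d f g -> agree d (Phi f) (Phi g).
Proof.
move=> h /agree_sub e; apply/agree_sub; rewrite -chomB //.
by case: h => _ _ _; apply.
Qed.

Lemma fps_ofE n (q : {mpoly K[n]}) : fps_of q =
  \sum_(m <- msupp q) fps_C q@_m * \prod_(i < n) fps_X K i ^+ m i.
Proof.
apply/fps_ext => m; rewrite {1}(mpolyE q) /fps_of raddf_sum fps_sumE /=.
apply: eq_bigr => k _; rewrite mcoeffZ fps_CME; congr (_ * _).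
rewrite mpolyXE_id -[LHS]/(fps_of _ m) fps_of_prod.
congr (_ m); apply: eq_bigr => i _; rewrite fps_ofX.
suff -> : fps_of 'X_i = fps_X K i by [].
by apply/fps_ext => l; rewrite /fps_of /fps_X mcoeffX eq_sym.
Qed.

(** Polynomials are dense, and they are generated by constants and variables. *)
Lemma chom_ext n p (Phi Psi : fps K n -> fps K p) : chom Phi -> chom Psi ->
  (forall c, Phi (fps_C c) = Psi (fps_C c)) ->
  (forall i, Phi (fps_X K i) = Psi (fps_X K i)) -> Phi =1 Psi.
Proof.
move=> h1 h2 hC hX f; apply: agree_all => d.
pose q := fps_of (fps_trunc d f).
have aq : agree d f q by apply/agree_sym/fps_of_trunc.
apply: agree_trans (chom_agree h1 aq) _.
apply/agree_sym; apply: agree_trans (chom_agree h2 aq) _.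
suff -> : Psi q = Phi q by [].
rewrite /q fps_ofE (chom_sum h1) (chom_sum h2); apply: eq_bigr => m _.
case: (h1) => _ m1 _ _; case: (h2) => _ m2 _ _.
rewrite m1 m2 hC (chom_prod h1) (chom_prod h2).
  congr (_ * _); apply: eq_bigr => i _.
by rewrite !chom_exp // hX.
Qed.

Lemma mcompE n p q (G : 'rV[fps K n]_q) (H : 'rV[fps K p]_n) j :
  fps_mcomp G H 0 j = fps_comp (G 0 j) H.
Proof. by rewrite mxE. Qed.

Lemma fps_comp_coef0 n p (f : fps K n) (G : 'rV[fps K p]_n) :
  vanishing_at0 G -> fps_comp f G 0%MM = f 0%MM.
Proof.
move=> G0; have af : agree 1 f (fps_C (f 0%MM)).
  move=> m; rewrite ltnS leqn0 mdeg_eq0 => /eqP ->.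
  by rewrite fps_CE eqxx.
rewrite (fps_comp_agree G0 af) ?mdeg0 //.
by rewrite fps_compC // fps_CE eqxx.
Qed.

Lemma mcomp_vanishing n p q (G : 'rV[fps K n]_q) (H : 'rV[fps K p]_n) :
  vanishing_at0 G -> vanishing_at0 H -> vanishing_at0 (fps_mcomp G H).
Proof. by move=> G0 H0 j; rewrite mcompE fps_comp_coef0. Qed.

Lemma fps_compA n p q (f : fps K n) (G : 'rV[fps K p]_n) (H : 'rV[fps K q]_p) :
  vanishing_at0 G -> vanishing_at0 H ->
  fps_comp (fps_comp f G) H = fps_comp f (fps_mcomp G H).
Proof.
move=> G0 H0; have GH0 := mcomp_vanishing G0 H0.
apply: (@chom_ext _ _ ((fun g => fps_comp g H) \o (fun g => fps_comp g G))
         (fun g => fps_comp g (fps_mcomp G H))) => [||c|i] /=.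
- by apply: chom_comp; apply: fps_comp_chom.
- exact: fps_comp_chom.
- by rewrite !fps_compC.
- by rewrite !fps_compX // mcompE.
Qed.

Lemma fps_mcompA n p q r (F : 'rV[fps K n]_r) (G : 'rV[fps K p]_n)
    (H : 'rV[fps K q]_p) : vanishing_at0 G -> vanishing_at0 H ->
  fps_mcomp (fps_mcomp F G) H = fps_mcomp F (fps_mcomp G H).
Proof.
by move=> G0 H0; apply/rowP => j; rewrite !mcompE fps_compA.
Qed.

Lemma fps_X0 n (i : 'I_n) : fps_X K i 0%MM = 0.
Proof. by rewrite /fps_X eq_sym mnm1_eq0. Qed.
Lemma fps_varsE n j : fps_vars K n 0 j = fps_X K j. Proof. by rewrite mxE. Qed.
Lemma vars_vanishing n : vanishing_at0 (fps_vars K n).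
Proof. by move=> j; rewrite fps_varsE fps_X0. Qed.

Lemma fps_comp_vars n (f : fps K n) : fps_comp f (fps_vars K n) = f.
Proof.
have V := @vars_vanishing n.
apply: (@chom_ext _ _ (fun f => fps_comp f (fps_vars K n)) id) => [||c|i].
- exact: fps_comp_chom.
- exact: chom_id.
- by rewrite fps_compC.
- by rewrite fps_compX // fps_varsE.
Qed.
Lemma mcomp_vars n p (G : 'rV[fps K n]_p) : fps_mcomp G (fps_vars K n) = G.
Proof. by apply/rowP => j; rewrite mcompE fps_comp_vars. Qed.
Lemma vars_mcomp n p (G : 'rV[fps K p]_n) : vanishing_at0 G ->
  fps_mcomp (fps_vars K n) G = G.
Proof. by move=> G0; apply/rowP => j; rewrite mcompE fps_varsE fps_compX. Qed.

Lemma fpsM_coefU n (f g : fps K n) i :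
  (f * g) U_(i)%MM = f 0%MM * g U_(i)%MM + f U_(i)%MM * g 0%MM.
Proof.
have -> : f = (f - fps_C (f 0%MM)) + fps_C (f 0%MM) by rewrite subrK.
set f' := f - _; set c := f 0%MM.
have f'0 : f' 0%MM = 0 by rewrite /f' fpsBE fps_CE eqxx subrr.
rewrite mulrDl !fpsDE fps_CME !fps_CE f'0 eqxx mnm1_eq0 !mulr1n mulr0n add0r addr0.
rewrite addrC; congr (_ + _).
rewrite (@fpsM_coef1 _ _ _ _ _ U_(i)%MM 0%MM) ?addm0 // => k1 k2 e ne.
have : (mdeg k1 + mdeg k2)%N = 1%N by rewrite -mdegD -e mdeg1.
case e1: (mdeg k1) => [|d].
  by move/eqP: e1; rewrite mdeg_eq0 => /eqP ->; rewrite f'0 mul0r.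
move=> e2; have /eqP : mdeg k2 = 0%N by lia.
by rewrite mdeg_eq0 => /eqP k20; case: ne; rewrite e k20 addm0.
Qed.

Lemma fps_comp_coefU n p (f : fps K n) (G : 'rV[fps K p]_n) i : vanishing_at0 G ->
  fps_comp f G U_(i)%MM = \sum_j f U_(j)%MM * G 0 j U_(i)%MM.
Proof.
move=> G0.
pose g : fps K n := fps_C (f 0%MM) + \sum_j fps_C (f U_(j)%MM) * fps_X K j.
have af : agree 2 f g.
  move=> m md; rewrite /g fpsDE fps_sumE fps_CE.
  case e: (mdeg m) md => [|[|d]] // _.
    move/eqP: e; rewrite mdeg_eq0 => /eqP ->; rewrite eqxx big1 ?addr0 //.
    by move=> j _; rewrite fps_CME fps_X0 mulr0.
  have /mdeg1P[j /eqP ->] : mdeg m == 1%N by rewrite e.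
  rewrite mnm1_eq0 add0r (bigD1 j) //= fps_CME /fps_X eqxx mulr1 big1 ?addr0 //.
  move=> k /negPf kj; rewrite fps_CME; case: eqP => [/mnmP /(_ j)|]; rewrite ?mulr0 //.
  by rewrite !mnm1E eqxx kj.
have C := fps_comp_chom G0; case: (C) => aD aM _ _.
rewrite (fps_comp_agree G0 af) ?mdeg1 //.
rewrite /g aD fpsDE fps_compC // fps_CE mnm1_eq0 add0r (chom_sum C) fps_sumE.
by apply: eq_bigr => j _; rewrite aM fps_compC // fps_compX // fps_CME.
Qed.

Lemma jacobian0_comp n p q (G : 'rV[fps K n]_q) (H : 'rV[fps K p]_n) :
  vanishing_at0 H -> jacobian0 (fps_mcomp G H) = jacobian0 H *m jacobian0 G.
Proof.
move=> H0; apply/matrixP => i j; rewrite !mxE fps_comp_coefU //.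
by apply: eq_bigr => s _; rewrite !mxE mulrC.
Qed.

(** * The formal inverse function theorem *)

Lemma mon_comp_agree n p (G G' : 'rV[fps K p]_n) d k :
  (forall i, agree d (G 0 i) (G' 0 i)) -> agree d (mon_comp G k) (mon_comp G' k).
Proof. by move=> h; apply: agree_prod => i _; apply: agree_exp. Qed.

(** Every term of f has at least two factors from G, so an error of order d in one
    of them is multiplied by a factor without constant term.  This is the
    contraction behind [formal_inverse]. *)
Lemma fps_comp_agree_S n p (f : fps K n) (G G' : 'rV[fps K p]_n) d :
  ordge 2 f -> vanishing_at0 G -> vanishing_at0 G' ->
  (forall i, agree d (G 0 i) (G' 0 i)) ->
  agree d.+1 (fps_comp f G) (fps_comp f G').
Proof.
move=> /ordgeE f2 G0 G'0 h m md; rewrite (fps_comp_sum _ G0 md) (fps_comp_sum _ G'0 md).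
apply: eq_bigr => -[k kd] _ /=.
have [l|l] := ltnP (mdeg k) 2; first by rewrite f2 ?mul0r.
congr (_ * _); case: (pickP (fun i => k i != 0%N)) => [i ki|z]; last first.
  by move: l; rewrite mdegE big1 // => i _; apply/eqP/negbFE/z.
have kE : k = (U_(i) + (k - U_(i)))%MM.
  by rewrite addmC submK //; apply/mnm_lepP => j; rewrite mnm1E; case: eqP => // <-; rewrite lt0n.
set k' := (k - _)%MM in kE; rewrite kE !mon_compD !mon_compU.
have k'1 : (0 < mdeg k')%N by move: l; rewrite kE mdegD mdeg1.
have v0 (H : 'rV[fps K p]_n) : vanishing_at0 H -> mon_comp H k' 0%MM = 0.
  by move=> H0; rewrite ((ordgeE _ _).1 (mon_comp_ord (k := k') H0)) ?mdeg0.
by apply: (@agreeM_S _ _ d) => //; [exact: v0|exact: mon_comp_agree].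
Qed.

(** Writing G = id + r with r of order two, the inverse is the fixed point of
    H |-> id - r(H), a contraction for the order filtration. *)
Lemma formal_inverse n (G : 'rV[fps K n]_n) : vanishing_at0 G -> jacobian0 G = 1%:M ->
  exists F : 'rV[fps K n]_n,
    [/\ vanishing_at0 F, jacobian0 F = 1%:M & fps_mcomp G F = fps_vars K n].
Proof.
move=> G0 G1; pose r j : fps K n := G 0 j - fps_X K j.
have r2 j : ordge 2 (r j).
  apply/ordgeE => m; case e: (mdeg m) => [|[|d]] // _.
    by move/eqP: e; rewrite mdeg_eq0 => /eqP ->; rewrite /r fpsBE G0 fps_X0 subrr.
  have /mdeg1P[i /eqP ->] : mdeg m == 1%N by rewrite e.
  move/matrixP/(_ i j): G1; rewrite !mxE /r fpsBE => ->.
  rewrite /fps_X; apply/eqP; rewrite subr_eq0; apply/eqP; congr (_ %:R).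
  by congr nat_of_bool; apply/eqP/eqP => [->//|/mnmP/(_ j)]; rewrite !mnm1E eqxx; case: eqP.
pose Phi (H : 'rV[fps K n]_n) : 'rV[fps K n]_n := \row_j (fps_X K j - fps_comp (r j) H).
pose it s := iter s Phi 0.
have Phi0 H : vanishing_at0 H -> vanishing_at0 (Phi H).
  move=> H0 j; rewrite mxE fpsBE fps_X0 fps_comp_coef0 // sub0r.
  by rewrite ((ordgeE _ _).1 (r2 j)) ?oppr0 ?mdeg0.
have it0 s : vanishing_at0 (it s).
  elim: s => [|s IH]; last exact: Phi0.
  by move=> j; rewrite mxE fps0E.
have PhiS d H H' : vanishing_at0 H -> vanishing_at0 H' ->
    (forall j, agree d (H 0 j) (H' 0 j)) ->
    forall j, agree d.+1 (Phi H 0 j) (Phi H' 0 j).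
  move=> H0 H'0 h j m md; rewrite !mxE !fpsBE.
  by rewrite (fps_comp_agree_S (r2 j) H0 H'0 h md).
have st s : forall j, agree s (it s 0 j) (it s.+1 0 j).
  by elim: s => [j m //|s IH]; apply: (PhiS s (it s) (it s.+1) (it0 _) (it0 _) IH).
have st2 s t : (s <= t)%N -> forall j, agree s (it s 0 j) (it t 0 j).
  move=> /subnKC <-; elim: (t - s)%N => [|u IH] j; first by rewrite addn0.
  apply: agree_trans (IH j) _; rewrite addnS; exact: agree_le (leq_addr u s) (st _ j).
pose F : 'rV[fps K n]_n := \row_j (fun m => it (mdeg m).+1 0 j m).
have aF d j : agree d (F 0 j) (it d 0 j).
  by move=> m md; rewrite mxE (st2 _ _ md).
have F0 : vanishing_at0 F by move=> j; rewrite (aF 1%N) ?mdeg0 ?it0.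
have fix_F : Phi F = F.
  apply/rowP => j; apply: agree_all => d.
  have h1 := PhiS d _ _ F0 (it0 d) (aF d) j.
  apply: agree_le (leqnSn d) _; apply: agree_trans h1 _.
  exact/agree_sym/(aF d.+1).
have GF : fps_mcomp G F = fps_vars K n.
  apply/rowP => j; rewrite mcompE fps_varsE.
  have -> : G 0 j = r j + fps_X K j by rewrite subrK.
  rewrite fps_compD // fps_compX // -[in F 0 j]fix_F mxE.
  by rewrite addrCA subrr addr0.
exists F; split => //.
have := jacobian0_comp G F0; rewrite GF G1 mulmx1 => <-.
apply/matrixP => i j; rewrite !mxE /fps_X; congr (_ %:R); congr nat_of_bool.
by apply/eqP/eqP => [/mnmP/(_ j)|->//]; rewrite !mnm1E eqxx; case: eqP.
Qed.

End Comp.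

(** * Series in (Z, conj Z) *)

(** Exponents of monomials in (Z, conj Z) as pairs.  The definition is locked
    because comparing two unfolded pairs enumerates their indices. *)
HB.lock Definition mpair (n : nat) (a b : 'X_{1..n}) : 'X_{1..n + n} :=
  [multinom (match split i with inl j => a j | inr j => b j end) | i < n + n].

Arguments mpair {n} a b.

Section SplitMonomials.
Variable n : nat.
Implicit Types (a b : 'X_{1..n}) (m : 'X_{1..n + n}).
Definition mfst (m : 'X_{1..n + n}) : 'X_{1..n} := [multinom m (lshift n i) | i < n].
Definition msnd (m : 'X_{1..n + n}) : 'X_{1..n} := [multinom m (rshift n i) | i < n].
Lemma mpairEl a b i : mpair a b (lshift n i) = a i.
Proof. by rewrite mpair.unlock mnmE -[lshift n i]/(unsplit (inl i)) unsplitK. Qed.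
Lemma mpairEr a b i : mpair a b (rshift n i) = b i.
Proof. by rewrite mpair.unlock mnmE -[rshift n i]/(unsplit (inr i)) unsplitK. Qed.
Lemma mfst_pair a b : mfst (mpair a b) = a.
Proof. by apply/mnmP => i; rewrite mnmE mpairEl. Qed.
Lemma msnd_pair a b : msnd (mpair a b) = b.
Proof. by apply/mnmP => i; rewrite mnmE mpairEr. Qed.
Lemma mpairK m : mpair (mfst m) (msnd m) = m.
Proof.
apply/mnmP => i; rewrite -(splitK i); case: (split i) => j /=.
  by rewrite mpairEl mnmE.
by rewrite mpairEr mnmE.
Qed.
Lemma mpairD a b a' b' : (mpair a b + mpair a' b')%MM = mpair (a + a')%MM (b + b')%MM.
Proof.
apply/mnmP => i; rewrite -(splitK i); case: (split i) => j /=.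
  by rewrite !mnmDE !mpairEl mnmDE.
by rewrite !mnmDE !mpairEr mnmDE.
Qed.
Lemma mpair0 : mpair 0%MM 0%MM = 0%MM :> 'X_{1..n + n}.
Proof.
apply/mnmP => i; rewrite -(splitK i); case: (split i) => j /=.
  by rewrite mpairEl !mnm0E.
by rewrite mpairEr !mnm0E.
Qed.
Lemma mpairUl (i : 'I_n) : U_(lshift n i)%MM = mpair U_(i)%MM 0%MM.
Proof.
apply/mnmP => j; rewrite -(splitK j); case: (split j) => k /=.
  by rewrite mpairEl !mnm1E (inj_eq (@lshift_inj _ _)).
by rewrite mpairEr mnm0E !mnm1E eq_lrshift.
Qed.
Lemma mpairUr (i : 'I_n) : U_(rshift n i)%MM = mpair 0%MM U_(i)%MM.
Proof.
apply/mnmP => j; rewrite -(splitK j); case: (split j) => k /=.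
  by rewrite mpairEl mnm0E !mnm1E eq_rlshift.
by rewrite mpairEr !mnm1E (inj_eq (@rshift_inj _ _)).
Qed.
Lemma mpair_inj a b a' b' : mpair a b = mpair a' b' -> a = a' /\ b = b'.
Proof. by move=> e; rewrite -(mfst_pair a b) -{2}(msnd_pair a b) e mfst_pair msnd_pair. Qed.
Lemma mdeg_pair a b : mdeg (mpair a b) = (mdeg a + mdeg b)%N.
Proof.
rewrite !mdegE big_split_ord /=; congr (_ + _)%N; apply: eq_bigr => i _.
  by rewrite mpairEl.
by rewrite mpairEr.
Qed.
End SplitMonomials.

Section SplitProduct.
Variables (K : comNzRingType) (n : nat).
Implicit Types f g : fps K (n + n).

Lemma split_coef0 f g a b :
  (forall a1 b1 a2 b2, a = (a1 + a2)%MM -> b = (b1 + b2)%MM ->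
     f (mpair a1 b1) * g (mpair a2 b2) = 0) -> (f * g) (mpair a b) = 0.
Proof.
move=> h; apply: fpsM_coef0 => k1 k2; rewrite -(mpairK k1) -(mpairK k2) mpairD.
by move=> /mpair_inj[e1 e2]; apply: h.
Qed.

Lemma split_coef1 f g a b a1 b1 a2 b2 : a = (a1 + a2)%MM -> b = (b1 + b2)%MM ->
  (forall a1' b1' a2' b2', a = (a1' + a2')%MM -> b = (b1' + b2')%MM ->
     (a1', b1') <> (a1, b1) -> f (mpair a1' b1') * g (mpair a2' b2') = 0) ->
  (f * g) (mpair a b) = f (mpair a1 b1) * g (mpair a2 b2).
Proof.
move=> ea eb h; apply: fpsM_coef1; first by rewrite mpairD ea eb.
move=> k1 k2; rewrite -(mpairK k1) -(mpairK k2) mpairD.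
move=> /mpair_inj[e1 e2] ne; apply: h => // -[e3 e4]; apply: ne.
by rewrite e3 e4.
Qed.

Lemma fps_ext_split f g : (forall a b, f (mpair a b) = g (mpair a b)) -> f = g.
Proof. by move=> h; apply/fps_ext => m; rewrite -(mpairK m). Qed.

Lemma fps_shift_comp (e : 'I_n -> 'I_(n + n)) (s : 'X_{1..n} -> 'X_{1..n + n})
    (t : 'X_{1..n + n} -> 'X_{1..n}) (P : pred 'X_{1..n + n}) (f : fps K n) :
  (forall k, fps_of 'X_[s k] = \prod_(i < n) fps_X K (e i) ^+ k i :> fps K (n + n)) ->
  (forall k, t (s k) = k) -> (forall k, P (s k)) -> (forall m, P m -> s (t m) = m) ->
  (forall k, mdeg (s k) = mdeg k) ->
  forall m, fps_comp f (\row_i fps_X K (e i)) m = if P m then f (t m) else 0.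
Proof.
move=> hs ts Ps st ds m.
have V : vanishing_at0 (\row_i fps_X K (e i) : 'rV[fps K (n + n)]_n).
  by move=> i; rewrite mxE fps_X0.
rewrite (fps_comp_sum _ V (leqnn _)).
have mE k : mon_comp (\row_i fps_X K (e i) : 'rV[fps K (n + n)]_n) k m = (m == s k)%:R.
  transitivity (fps_of ('X_[s k] : {mpoly K[n + n]}) m).
    by rewrite hs; congr (_ m); apply: eq_bigr => i _; rewrite mxE.
  by rewrite /fps_of mcoeffX eq_sym.
case: ifPn => Pm; last first.
  rewrite big1 // => k _; rewrite mE; case: eqP => [e0|]; rewrite ?mulr0 //.
  by exfalso; move: Pm; rewrite e0 Ps.
have b : (mdeg (t m) < (mdeg m).+1)%N by rewrite -ds st.
rewrite (bigD1 (BMultinom b)) //= mE st // eqxx mulr1 big1 ?addr0 // => k /eqP kN.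
rewrite mE; case: eqP => [e0|]; rewrite ?mulr0 //.
by case: kN; apply: val_inj; rewrite /= -[LHS]ts -e0.
Qed.

Lemma fps_comp_left (f : fps K n) a b :
  fps_comp f (lsubmx (fps_vars K (n + n))) (mpair a b) = f a *+ (b == 0%MM).
Proof.
have -> : lsubmx (fps_vars K (n + n)) = \row_i fps_X K (lshift n i).
  by apply/rowP => i; rewrite !mxE.
rewrite (@fps_shift_comp (lshift n) (fun k => mpair k 0%MM) (@mfst n) (fun m => msnd m == 0%MM)).
- by rewrite msnd_pair mfst_pair; case: eqP.
- move=> k; rewrite mpolyXE_id fps_of_prod big_split_ord /= [X in _ * X]big1 ?mulr1.
    apply: eq_bigr => i _; rewrite mpairEl fps_ofX.
    suff -> : fps_of 'X_(lshift n i) = fps_X K (lshift n i) by [].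
    by apply/fps_ext => l; rewrite /fps_of /fps_X mcoeffX eq_sym.
  by move=> i _; rewrite mpairEr mnm0E expr0 fps_of1.
- by move=> k; rewrite mfst_pair.
- by move=> k; rewrite msnd_pair.
- by move=> m /eqP e; rewrite -[RHS](mpairK m) e.
- by move=> k; rewrite mdeg_pair mdeg0 addn0.
Qed.

Lemma fps_comp_right (f : fps K n) a b :
  fps_comp f (rsubmx (fps_vars K (n + n))) (mpair a b) = f b *+ (a == 0%MM).
Proof.
have -> : rsubmx (fps_vars K (n + n)) = \row_i fps_X K (rshift n i).
  by apply/rowP => i; rewrite !mxE.
rewrite (@fps_shift_comp (@rshift n n) (fun k => mpair 0%MM k) (@msnd n) (fun m => mfst m == 0%MM)).
- by rewrite msnd_pair mfst_pair; case: eqP.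
- move=> k; rewrite mpolyXE_id fps_of_prod big_split_ord /= [X in X * _]big1 ?mul1r.
    apply: eq_bigr => i _; rewrite mpairEr fps_ofX.
    suff -> : fps_of 'X_(rshift n i) = fps_X K (rshift n i) by [].
    by apply/fps_ext => l; rewrite /fps_of /fps_X mcoeffX eq_sym.
  by move=> i _; rewrite mpairEl mnm0E expr0 fps_of1.
- by move=> k; rewrite msnd_pair.
- by move=> k; rewrite mfst_pair.
- by move=> m /eqP e; rewrite -[RHS](mpairK m) e.
- by move=> k; rewrite mdeg_pair mdeg0.
Qed.
End SplitProduct.

(** The entries of [hol] and [antihol].  Locking keeps unification from unfolding
    substitutions. *)
HB.lock Definition hol1 (R : realType) (n : nat) (f : fps R[i] n) : fps R[i] (n + n) :=
  fps_comp f (vZ R n).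
HB.lock Definition antihol1 (R : realType) (n : nat) (f : fps R[i] n) : fps R[i] (n + n) :=
  fps_comp (fps_map Num.conj f) (vZbar R n).

Arguments hol1 {R n} f.
Arguments antihol1 {R n} f.

Section Conj.
Variable R : realType.
Local Notation C := R[i].

Definition fps_conj n (f : fps C n) : fps C n := fps_map Num.conj f.

Lemma fps_conj_chom n : chom (@fps_conj n).
Proof.
split=> [f g|f g||d f h].
- by apply/fps_ext => m; rewrite /fps_conj /fps_map !fpsDE rmorphD.
- apply/fps_ext => m; rewrite /fps_conj /fps_map !fpsME rmorph_sum.
  by apply: eq_bigr => k _; rewrite rmorphM.
- by apply/fps_ext => m; rewrite /fps_conj /fps_map !fps1E rmorph_nat.
- by move=> m md; rewrite /fps_conj /fps_map h // !fps0E rmorph0.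
Qed.
Lemma fps_conjC n c : fps_conj (fps_C c) = fps_C (Num.conj c) :> fps C n.
Proof. by apply/fps_ext => m; rewrite /fps_conj /fps_map !fps_CE rmorphMn. Qed.
Lemma fps_conjX n i : fps_conj (fps_X C i) = fps_X C i :> fps C n.
Proof. by apply/fps_ext => m; rewrite /fps_conj /fps_map /fps_X rmorph_nat. Qed.
Lemma fps_conj0 n (f : fps C n) : fps_conj f 0%MM = Num.conj (f 0%MM).
Proof. by []. Qed.

Lemma conj_vanishing n N (H : 'rV[fps C n]_N) : vanishing_at0 H ->
  vanishing_at0 (map_mx (@fps_conj n) H).
Proof. by move=> H0 j; rewrite mxE fps_conj0 H0 rmorph0. Qed.

Lemma fps_conj_comp n p (f : fps C n) (G : 'rV[fps C p]_n) : vanishing_at0 G ->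
  fps_conj (fps_comp f G) = fps_comp (fps_conj f) (map_mx (@fps_conj p) G).
Proof.
move=> G0; have G0' := conj_vanishing G0.
apply: (@chom_ext _ _ _ ((@fps_conj p) \o (fun f => fps_comp f G))
  ((fun f => fps_comp f (map_mx (@fps_conj p) G)) \o (@fps_conj n))) => [||c|i] /=.
- by apply: chom_comp; [exact: fps_conj_chom|exact: fps_comp_chom].
- by apply: chom_comp; [exact: fps_comp_chom|exact: fps_conj_chom].
- by rewrite fps_compC // !fps_conjC fps_compC.
- by rewrite fps_conjX !fps_compX // mxE.
Qed.

Lemma vZ_vanishing n : vanishing_at0 (vZ R n).
Proof. by move=> i; rewrite !mxE fps_X0. Qed.
Lemma vZbar_vanishing n : vanishing_at0 (vZbar R n).
Proof. by move=> i; rewrite !mxE fps_X0. Qed.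

Lemma hol1E n (f : fps C n) : hol1 f = fps_comp f (vZ R n).
Proof. by rewrite hol1.unlock. Qed.
Lemma antihol1E n (f : fps C n) : antihol1 f = fps_comp (fps_conj f) (vZbar R n).
Proof. by rewrite antihol1.unlock. Qed.

Lemma holE n N (H : 'rV[fps C n]_N) j : hol H 0 j = hol1 (H 0 j).
Proof. by rewrite mxE hol1E. Qed.
Lemma antiholE n N (H : 'rV[fps C n]_N) j : antihol H 0 j = antihol1 (H 0 j).
Proof. by rewrite antihol1E !mxE. Qed.

Lemma hol1_coef n (f : fps C n) a b : hol1 f (mpair a b) = f a *+ (b == 0%MM).
Proof. rewrite hol1E; exact: fps_comp_left. Qed.
Lemma antihol1_coef n (f : fps C n) a b : antihol1 f (mpair a b) = Num.conj (f b) *+ (a == 0%MM).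
Proof. rewrite antihol1E; exact: fps_comp_right. Qed.
(** The coefficients of f(Z) conj(g)(conj Z) form a matrix of rank one in the pair
    of exponents; sums of k such products have rank at most k. *)
Lemma hol1_antihol1_coef n (f g : fps C n) a b :
  (hol1 f * antihol1 g) (mpair a b) = f a * Num.conj (g b).
Proof.
rewrite (@split_coef1 _ _ _ _ _ _ a 0%MM 0%MM b) ?addm0 ?add0m //.
  by rewrite hol1_coef antihol1_coef !eqxx !mulr1n.
move=> a1 b1 a2 b2 ea eb ne; rewrite hol1_coef antihol1_coef.
case: (b1 =P 0%MM) => [b10|_]; last by rewrite mulr0n mul0r.
case: (a2 =P 0%MM) => [a20|_]; last by rewrite mulr0n mulr0.
by case: ne; rewrite b10 ea a20 addm0.
Qed.

Lemma hol1_chom n : chom (@hol1 R n).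
Proof.
suff -> : @hol1 R n = fun f => fps_comp f (vZ R n) by apply/fps_comp_chom/vZ_vanishing.
by apply/funext => f; apply: hol1E.
Qed.
Lemma antihol1_chom n : chom (@antihol1 R n).
Proof.
suff -> : @antihol1 R n = (fun f => fps_comp f (vZbar R n)) \o (@fps_conj n).
  exact: chom_comp (fps_comp_chom (@vZbar_vanishing n)) (@fps_conj_chom n).
by apply/funext => f; apply: antihol1E.
Qed.
Lemma hol1C n c : hol1 (fps_C c : fps C n) = fps_C c.
Proof. by rewrite hol1E fps_compC //; apply: vZ_vanishing. Qed.
Lemma antihol1C n c : antihol1 (fps_C c : fps C n) = fps_C (Num.conj c).
Proof. by rewrite antihol1E fps_conjC fps_compC //; apply: vZbar_vanishing. Qed.

Lemma hol_vanishing n N (H : 'rV[fps C n]_N) : vanishing_at0 H -> vanishing_at0 (hol H).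
Proof. by move=> H0; apply: mcomp_vanishing => //; apply: vZ_vanishing. Qed.
Lemma antihol_vanishing n N (H : 'rV[fps C n]_N) : vanishing_at0 H -> vanishing_at0 (antihol H).
Proof.
by move=> H0; apply: mcomp_vanishing; [apply: conj_vanishing|apply: vZbar_vanishing].
Qed.
Lemma row_mx_vanishing n a b (A : 'rV[fps C n]_a) (B : 'rV[fps C n]_b) :
  vanishing_at0 A -> vanishing_at0 B -> vanishing_at0 (row_mx A B).
Proof.
move=> A0 B0 j; rewrite -(splitK j); case: (split j) => i /=.
  by rewrite row_mxEl.
by rewrite row_mxEr.
Qed.

Lemma pullbackE n N (rho : fps C (N + N)) (F : 'rV[fps C n]_N) :
  pullback rho F = fps_comp rho (row_mx (hol F) (antihol F)).
Proof. by []. Qed.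
Lemma pb_vanishing n N (F : 'rV[fps C n]_N) : vanishing_at0 F ->
  vanishing_at0 (row_mx (hol F) (antihol F)).
Proof. by move=> h; apply: row_mx_vanishing; [apply: hol_vanishing|apply: antihol_vanishing]. Qed.

Lemma pullback_chom n N (F : 'rV[fps C n]_N) : vanishing_at0 F ->
  chom (fun rho => pullback rho F).
Proof. by move=> F0; apply: fps_comp_chom; apply: pb_vanishing. Qed.

Lemma pullback_hol1 n N (f : fps C N) (F : 'rV[fps C n]_N) : vanishing_at0 F ->
  pullback (hol1 f) F = hol1 (fps_comp f F).
Proof.
move=> F0; have pF := pb_vanishing F0.
rewrite pullbackE !hol1E (fps_compA f (@vZ_vanishing N) pF) (fps_compA f F0 (@vZ_vanishing n)).
congr (fps_comp f _); apply/rowP => i.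
rewrite mcompE -/(hol F) holE hol1E.
have -> : vZ R N 0 i = fps_X C (lshift N i) by rewrite !mxE.
by rewrite (fps_compX _ pF) row_mxEl holE hol1E.
Qed.
Lemma pullback_antihol1 n N (f : fps C N) (F : 'rV[fps C n]_N) : vanishing_at0 F ->
  pullback (antihol1 f) F = antihol1 (fps_comp f F).
Proof.
move=> F0; have pF := pb_vanishing F0; have cF := conj_vanishing F0.
rewrite pullbackE !antihol1E (fps_conj_comp f F0).
rewrite (fps_compA _ (@vZbar_vanishing N) pF) (fps_compA _ cF (@vZbar_vanishing n)).
congr (fps_comp _ _); apply/rowP => i; rewrite mcompE -/(antihol F) antiholE antihol1E.
have -> : vZbar R N 0 i = fps_X C (rshift N i) by rewrite !mxE.
by rewrite (fps_compX _ pF) row_mxEr antiholE antihol1E.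
Qed.

(** Both sides substitute (F o G, conj (F o G)), by associativity of substitution in
    the holomorphic and antiholomorphic halves. *)
Lemma pullback_comp n p q (rho : fps C (n + n)) (F : 'rV[fps C p]_n)
    (G : 'rV[fps C q]_p) : vanishing_at0 F -> vanishing_at0 G ->
  pullback (pullback rho F) G = pullback rho (fps_mcomp F G).
Proof.
move=> F0 G0; have pF := pb_vanishing F0; have pG := pb_vanishing G0.
rewrite {1 2 3}/pullback (fps_compA rho pF pG).
congr (fps_comp _ _); apply/rowP => i; rewrite mcompE -(splitK i).
case: (split i) => j /=.
  rewrite (row_mxEl (hol F)) (row_mxEl (hol (fps_mcomp F G))) !holE mcompE.
  exact: pullback_hol1.
rewrite (row_mxEr (hol F)) (row_mxEr (hol (fps_mcomp F G))) !antiholE mcompE.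
exact: pullback_antihol1.
Qed.

Lemma pullback_coef0 n N (rho : fps C (N + N)) (F : 'rV[fps C n]_N) :
  vanishing_at0 F -> pullback rho F 0%MM = rho 0%MM.
Proof. by move=> F0; exact: fps_comp_coef0 (pb_vanishing F0). Qed.
End Conj.

(** * The rank of a multiple of a nondegenerate series *)

Lemma exists_min (T : eqType) (r : rel T) (s : seq T) x0 : total r -> transitive r ->
  x0 \in s -> exists2 x, x \in s & {in s, forall y, r x y}.
Proof.
move=> tot tr; elim: s x0 => [//|a s IH] x0 _.
case: s IH => [|b s] IH.
  exists a; first exact: mem_head.
  by move=> y; rewrite inE => /eqP ->; case/orP: (tot a a).
have [x xs xm] := IH b (mem_head _ _).
case/orP: (tot a x) => h.
  exists a; first exact: mem_head.
  move=> y; rewrite inE => /predU1P[->|/xm]; last exact: tr.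
  by case/orP: (tot a a).
exists x; first by rewrite inE xs orbT.
by move=> y; rewrite inE => /predU1P[->//|/xm].
Qed.

Lemma triangular_row_free (K : fieldType) n (M : 'M[K]_n) (r : rel 'I_n) :
  total r -> transitive r -> antisymmetric r ->
  (forall i, M i i != 0) -> (forall i j, M i j != 0 -> r j i) -> row_free M.
Proof.
move=> tot tr anti diag tri; apply: inj_row_free => v vM.
apply/rowP => i0; rewrite mxE; apply/eqP/negPn/negP => vi0.
have [|i] := @exists_min _ (fun i j => r j i) [seq i <- enum 'I_n | v 0 i != 0] i0
  (fun x y => tot y x) (fun y x z h1 h2 => tr _ _ _ h2 h1).
  by rewrite mem_filter vi0 mem_enum.
rewrite mem_filter => /andP[vi _] imax.
have /rowP/(_ i) := vM; rewrite !mxE (bigD1 i) //= big1 ?addr0 => [|j ji].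
  by move/eqP; rewrite mulf_eq0 (negPf vi) (negPf (diag i)).
apply/eqP; rewrite mulf_eq0; case: (v 0 j =P 0) => //= /eqP vj.
apply/negPn/negP => /tri rij; case/eqP: ji; apply: anti; rewrite rij andbT.
by apply: imax; rewrite mem_filter vj mem_enum.
Qed.

(** In this section [e] lists the distinguished variables z_j, of weight one, and
    [rho] is a series whose terms of weight at most two are multiples of the
    z_j conj(z_j), all with nonzero coefficient. *)
Section RankLemma.
Variables (K : fieldType) (N n : nat) (e : 'I_n -> 'I_N) (q : 'I_N -> nat).
Hypothesis (e_inj : injective e) (q_gt0 : forall i, (0 < q i)%N).
Hypothesis (q_e : forall j, q (e j) = 1%N).

Definition wt (m : 'X_{1..N}) : nat := \sum_i q i * m i.
Lemma wtD m1 m2 : wt (m1 + m2)%MM = (wt m1 + wt m2)%N.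
Proof. by rewrite /wt -big_split; apply: eq_bigr => i _; rewrite mnmDE mulnDr. Qed.
Lemma wtU i : wt U_(i)%MM = q i.
Proof.
rewrite /wt (bigD1 i) //= mnm1E eqxx muln1 big1 ?addn0 // => j ji.
by rewrite mnm1E eq_sym (negPf ji) muln0.
Qed.
Lemma wt_mdeg m : (mdeg m <= wt m)%N.
Proof.
by rewrite mdegE; apply: leq_sum => i _; rewrite -[X in (X <= _)%N]mul1n leq_mul2r q_gt0 orbT.
Qed.

Variables (A rho : fps K (N + N)).
Hypothesis rho_e : forall j, rho (mpair U_(e j)%MM U_(e j)%MM) != 0.
Hypothesis rho_wt : forall a b, rho (mpair a b) != 0 ->
  (exists j, a = U_(e j)%MM /\ b = U_(e j)%MM) \/ (3 <= wt a + wt b)%N.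

(** The product A * rho, as a matrix indexed by pairs of exponents, contains a
    triangular n x n minor.  Among the terms of A of least weight choose those whose
    exponent difference is minimal for a monomial order; they share one difference,
    and for each j one of them has the largest exponent of z_j.  Multiplied by
    z_j conj(z_j) it gives a term of A * rho that no other product can cancel, and
    minimality makes these n terms the diagonal of a triangular minor.  The terms
    of A are returned so that the position of the minor can be controlled. *)
Lemma rank_minors : A <> 0 -> exists a b : 'I_n -> 'X_{1..N},
  [/\ forall j, A (mpair (a j) (b j)) != 0 &
      row_free (\matrix_(i, j) (A * rho) (mpair (a i + U_(e i))%MM (b j + U_(e j))%MM))].
Proof.
move=> An0.
have [d [[a00 [b00 A00 d00]] dmin]] : exists d,
    (exists a, exists2 b, A (mpair a b) != 0 & (wt a + wt b)%N = d) /\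
    forall a b, A (mpair a b) != 0 -> (d <= wt a + wt b)%N.
  pose P d := `[< exists a, exists2 b, A (mpair a b) != 0 & (wt a + wt b)%N = d >].
  have exP : exists d, P d.
    apply: contrapT => h; apply: An0; apply: fps_ext_split => a b.
    rewrite fps0E; apply/eqP/negPn/negP => Aab; apply: h.
    by exists (wt a + wt b)%N; apply/asboolP; exists a; exists b.
  case: (ex_minnP exP) => d /asboolP Pd h; exists d; split => // a b Aab.
  by apply: h; apply/asboolP; exists a; exists b.
pose T : eqType := ('X_{1..N} * 'X_{1..N})%type.
pose bd := [seq bmnm m | m <- enum {: 'X_{1..N < d.+1}}].
have bdP m : (wt m <= d)%N -> m \in bd.
  move=> h; have b : (mdeg m < d.+1)%N by rewrite ltnS (leq_trans (wt_mdeg m)).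
  by apply/mapP; exists (BMultinom b); rewrite ?mem_enum.
pose S : seq T := [seq p <- allpairs pair bd bd |
   (A (mpair p.1 p.2) != 0) && (wt p.1 + wt p.2 == d)%N].
have SP p : p \in S <-> A (mpair p.1 p.2) != 0 /\ (wt p.1 + wt p.2)%N = d.
  rewrite mem_filter; split=> [/andP[/andP[h1 /eqP h2] _] //|[h1 h2]].
  rewrite h1 h2 eqxx /=; case: p h1 h2 => a b /= _ h2.
  by apply: allpairs_f; apply: bdP; rewrite -h2 ?leq_addr ?leq_addl.
(* compares the differences of exponents without subtracting *)
pose r2 : rel T := fun p p' => ((p.1 + p'.2)%MM <= (p'.1 + p.2)%MM)%O.
have r2tot : total r2 by move=> p p'; apply: le_total.
have r2tr : transitive r2.
  move=> p' p p''; rewrite /r2 => h1 h2.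
  have := lem_add h1 h2.
  have -> : (p.1 + p'.2 + (p'.1 + p''.2))%MM = ((p'.1 + p'.2) + (p.1 + p''.2))%MM.
    by apply/mnmP => i; rewrite !mnmDE; lia.
  have -> : (p'.1 + p.2 + (p''.1 + p'.2))%MM = ((p'.1 + p'.2) + (p''.1 + p.2))%MM.
    by apply/mnmP => i; rewrite !mnmDE; lia.
  by rewrite lemc_add2r.
have S00 : (a00, b00) \in S by apply/SP.
have [[a0 b0] p0S p0min] := exists_min r2tot r2tr S00.
pose S0 := [seq p <- S | (p.1 + b0)%MM == (a0 + p.2)%MM].
(* the class of p0, maximal in the j-th exponent *)
have ex j : exists p : T, [/\ A (mpair p.1 p.2) != 0, (wt p.1 + wt p.2)%N = d,
    (p.1 + b0)%MM = (a0 + p.2)%MM &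
    forall a b, A (mpair a b) != 0 -> (wt a + wt b)%N = d ->
      (a + b0)%MM = (a0 + b)%MM -> (a (e j) <= p.1 (e j))%N].
  have [|||p] := @exists_min T (fun p p' => p'.1 (e j) <= p.1 (e j))%N S0 (a0, b0).
  - by move=> p p'; apply: leq_total.
  - by move=> p p' p'' h1 h2; apply: leq_trans h2 h1.
  - by rewrite mem_filter p0S eqxx.
  rewrite mem_filter => /andP[/eqP h1 /SP[h2 h3]] h4; exists p; split => // a b h5 h6 h7.
  apply: (h4 (a, b)); rewrite mem_filter; apply/andP; split; first exact/eqP.
  exact/SP.
have [p pP] := choice ex.
pose al j := (p j).1; pose be j := (p j).2.
have hA j : A (mpair (al j) (be j)) != 0 by case: (pP j).
have hd j : (wt (al j) + wt (be j))%N = d by case: (pP j).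
have hc j : (al j + b0)%MM = (a0 + be j)%MM by case: (pP j).
have hm j : forall a b, A (mpair a b) != 0 -> (wt a + wt b)%N = d ->
  (a + b0)%MM = (a0 + b)%MM -> (a (e j) <= al j (e j))%N by case: (pP j).
exists al, be; split => //.
pose a j := (al j + U_(e j))%MM; pose b j := (be j + U_(e j))%MM.
have wa j : wt (a j) = (wt (al j)).+1 by rewrite wtD wtU q_e addn1.
have wb j : wt (b j) = (wt (be j)).+1 by rewrite wtD wtU q_e addn1.
(* a_j is the only one whose exponent of z_j exceeds the maximum over the class *)
have a_inj : injective a.
  move=> i j aij; apply/eqP/negPn/negP => ij.
  have : (al j (e j) < a i (e j))%N by rewrite aij mnmDE mnm1E eqxx addn1.
  rewrite mnmDE mnm1E (inj_eq e_inj) (negPf ij) addn0 ltnNge.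
  by rewrite (hm j _ _ (hA i) (hd i) (hc i)).
pose key : rel 'I_n := fun j i =>
  (wt (a j) < wt (a i))%N || (wt (a j) == wt (a i)) && (a j <= a i)%O.
apply: (@triangular_row_free _ _ _ key).
- move=> i j; rewrite /key; case: (ltngtP (wt (a i)) (wt (a j))) => //= _.
  exact: le_total.
- move=> j i k; rewrite /key => /orP[h1|/andP[/eqP h1 h1']] /orP[h2|/andP[/eqP h2 h2']].
  + by rewrite (ltn_trans h1 h2).
  + by rewrite -h2 h1.
  + by rewrite h1 h2.
  + by rewrite h1 h2 eqxx (le_trans h1' h2') orbT.
- move=> i j; rewrite /key; case: (ltngtP (wt (a i)) (wt (a j))) => //= _ h.
  exact/a_inj/le_anti.
- move=> j; rewrite mxE (@split_coef1 _ _ _ _ _ _ (al j) (be j) U_(e j)%MM U_(e j)%MM) //.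
    by rewrite mulf_neq0.
  move=> a1 b1 a2 b2 ea eb ne; apply/eqP; rewrite mulf_eq0.
  apply/negPn/negP; rewrite negb_or => /andP[A1 r1].
  have W1 := dmin _ _ A1.
  have := congr1 wt ea; have := congr1 wt eb; rewrite !wtD !wtU !q_e => W2 W3.
  case: (rho_wt r1) => [[i [a2E b2E]]|W4]; last by have := hd j; lia.
  have d1 : (wt a1 + wt b1)%N = d.
    by have := hd j; move: W2 W3; rewrite a2E b2E !wtU !q_e; lia.
  have c1 : (a1 + b0)%MM = (a0 + b1)%MM.
    apply: (@addmI _ U_(e i)%MM); move: ea eb (hc j); rewrite a2E b2E.
    move=> /mnmP ea /mnmP eb /mnmP h; apply/mnmP => s.
    by move: (ea s) (eb s) (h s); rewrite !mnmDE; lia.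
  case: (i =P j) => [ij|ij].
    case: ne; move: ea eb; rewrite a2E b2E ij => /mnmP ea /mnmP eb.
    by congr (_, _); apply/mnmP => s; move: (ea s) (eb s); rewrite !mnmDE; lia.
  have := hm j _ _ A1 d1 c1; move: (congr1 (fun m : 'X_{1..N} => m (e j)) ea).
  rewrite a2E !mnmDE !mnm1E eqxx (inj_eq e_inj); case: eqP => // _; lia.
move=> i j; rewrite mxE => Fij.
have [a1 [b1 [a2 [b2 [ea eb A1 r1]]]]] : exists a1 b1 a2 b2,
    [/\ a i = (a1 + a2)%MM, b j = (b1 + b2)%MM, A (mpair a1 b1) != 0 & rho (mpair a2 b2) != 0].
  apply: contrapT => h; case/eqP: Fij; apply: split_coef0 => a1 b1 a2 b2 ea eb.
  apply/eqP; rewrite mulf_eq0; apply/negPn/negP; rewrite negb_or => /andP[A1 r1].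
  by apply: h; exists a1, b1, a2, b2.
have W1 := dmin _ _ A1.
have := congr1 wt ea; have := congr1 wt eb; rewrite !wtD !wtU !q_e => W2 W3.
have W5 := hd j; have W6 := wb j; have W7 := wa j; have W8 := wa i.
rewrite /key.
case: (rho_wt r1) => [[s [a2E b2E]]|W4]; last first.
  apply/orP; left; lia.
move: W2 W3; rewrite a2E b2E !wtU !q_e => W2 W3.
case: ltngtP => //= W9; first by exfalso; lia.
have d1 : (wt a1 + wt b1)%N = d by lia.
have S1 : (a1, b1) \in S by apply/SP.
have := p0min _ S1; rewrite /r2 /= -(lemc_add2r U_(e s)%MM).
have -> : (U_(e s) + (a0 + b1))%MM = (b0 + a j)%MM.
  move: eb (hc j); rewrite b2E => /mnmP eb /mnmP h; apply/mnmP => t.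
  by move: (eb t) (h t); rewrite /a !mnmDE; lia.
have -> : (U_(e s) + (a1 + b0))%MM = (b0 + a i)%MM.
  by rewrite ea a2E; apply/mnmP => t; rewrite !mnmDE; lia.
by rewrite lemc_add2r.
Qed.

(** A form of Huang's lemma: a nonzero multiple of [rho] is not a sum of fewer than n
    products of a series in Z and a series in conj Z.  It suffices that the
    decomposition holds on the rows [Rw] and the columns [Cl], if these contain the
    support of A shifted by every z_j conj(z_j). *)
Lemma rank_lemma k (p' q' : 'I_k -> 'X_{1..N} -> K) (Rw Cl : 'X_{1..N} -> Prop) :
  (forall a b j, A (mpair a b) != 0 -> Rw (a + U_(e j))%MM /\ Cl (b + U_(e j))%MM) ->
  (forall a b, Rw a -> Cl b -> (A * rho) (mpair a b) = \sum_s p' s a * q' s b) ->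
  (k < n)%N -> A = 0.
Proof.
move=> hRC hF kn; apply: contrapT => An0.
have [a [b [hA]]] := rank_minors An0.
set M := \matrix_(i, j) _ => Mfree.
have ME : M = (\matrix_(i, s) p' s (a i + U_(e i))%MM) *m
              (\matrix_(s, j) q' s (b j + U_(e j))%MM).
  apply/matrixP => i j; rewrite !mxE hF.
  - by apply: eq_bigr => s _; rewrite !mxE.
  - by case: (hRC _ _ i (hA i)).
  - by case: (hRC _ _ j (hA j)).
have : (\rank M <= k)%N by rewrite ME; apply: leq_trans (mxrankM_maxl _ _) (rank_leq_col _).
by move: Mfree; rewrite /row_free => /eqP ->; rewrite leqNgt kn.
Qed.
End RankLemma.

(** * Inverses of power series *)
Section FpsInverse.
Variables (K : fieldType) (n : nat).
Implicit Types u v L : fps K n.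

(** The geometric series of L, for L without constant term. *)
Definition fps_geom L : fps K n := fun m => (\sum_(k < (mdeg m).+1) L ^+ k) m.

Lemma fps_geom_agree L d : L 0%MM = 0 ->
  agree d (fps_geom L) (\sum_(k < d) L ^+ k).
Proof.
move=> L0 m md; rewrite /fps_geom -(subnKC md) big_split_ord /=.
rewrite fpsDE [X in _ = _ + X]fps_sumE [X in _ = _ + X]big1 ?addr0 //.
move=> k _; have := ordge_exp (k := (mdeg m).+1 + k) (ordge1 L0).
by move=> /ordgeE -> //; rewrite mul1n leq_addr.
Qed.

Lemma fps_geomE L : L 0%MM = 0 -> (1 - L) * fps_geom L = 1.
Proof.
move=> L0; apply: agree_all => d.
apply: agree_trans (agreeM (@agree_refl _ _ d _) (fps_geom_agree (d := d) L0)) _.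
have -> : (1 - L) * (\sum_(k < d) L ^+ k) = 1 - L ^+ d.
  by rewrite -opprB mulNr -subrX1 opprB.
apply/agree_sub; rewrite addrAC subrr sub0r => m md; rewrite fpsNE.
by have /ordgeE -> := ordge_exp (k := d) (ordge1 L0); rewrite ?fps0E ?oppr0 ?mul1n.
Qed.

Lemma fps_inv_exists u : u 0%MM != 0 -> exists v, u * v = 1.
Proof.
move=> u0; pose L := 1 - fps_C (u 0%MM)^-1 * u.
have L0 : L 0%MM = 0 by rewrite /L fpsBE fps1E fps_CME eqxx mulVf // subrr.
exists (fps_C (u 0%MM)^-1 * fps_geom L); rewrite mulrA [u * _]mulrC.
by rewrite -[X in X * _](subKr 1) fps_geomE.
Qed.
End FpsInverse.

Section Coefs.
Variables (K : comNzRingType) (N : nat).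

Lemma fpsM_restr (F G F' G' : fps K N) m :
  (forall k1 k2, m = (k1 + k2)%MM -> F k1 = F' k1 /\ G k2 = G' k2) ->
  (F * G) m = (F' * G') m.
Proof.
move=> h; rewrite !fpsME; apply: eq_bigr => k /eqP e.
by case: (h _ _ e) => -> ->.
Qed.

Lemma mnmU_split (i : 'I_N) (a b : 'X_{1..N}) : U_(i)%MM = (a + b)%MM ->
  (a = U_(i)%MM /\ b = 0%MM) \/ (a = 0%MM /\ b = U_(i)%MM).
Proof.
move=> e; have := congr1 mdeg e; rewrite mdeg1 mdegD.
case ea: (mdeg a) => [|d] h.
  by move/eqP: ea; rewrite mdeg_eq0 => /eqP a0; right; move: e; rewrite a0 add0m.
have /eqP : mdeg b = 0%N by lia.
by rewrite mdeg_eq0 => /eqP b0; left; move: e; rewrite b0 addm0.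
Qed.

Lemma mnm_add_eq0 (a b : 'X_{1..N}) : 0%MM = (a + b)%MM -> a = 0%MM /\ b = 0%MM.
Proof. by move=> /esym/eqP; rewrite mnmD_eq0 => /andP[/eqP -> /eqP ->]. Qed.

Lemma fps_X_coef0 (i : 'I_N) (f : fps K N) (m : 'X_{1..N}) : m i = 0%N -> (fps_X K i * f) m = 0.
Proof.
move=> mi; apply: fpsM_coef0 => k1 k2 e; rewrite /fps_X; case: eqP => [k1E|]; last by rewrite mul0r.
by move: mi; rewrite e k1E mnmDE mnm1E eqxx.
Qed.
End Coefs.

Lemma mulr_rank_one (A : comPzRingType) (x y t p q : A) :
  x * y * (t * (p * q)) = t * ((x * p) * (y * q)).
Proof. ring. Qed.
Lemma mulr_quadric (A : comPzRingType) (x y p q c s t xp yq s' t' : A) :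
  xp = x * p -> yq = y * q -> x * y * s = s' -> x * y * t = t' ->
  x * y * (p - q - c * s - c * t) = xp * y - x * yq - c * s' - c * t'.
Proof. move=> -> -> <- <-; ring. Qed.

(** * Two maps of one hypersurface: the rigidity argument *)
Section Core.
Variable R : realType.
Local Notation C := R[i].

Section QuadricSeries.
Variables (N n k : nat) (c : C) (eps : 'I_n -> C) (eta : 'I_k -> C).

(** The defining series of a quadric, up to the factor c = 2i, along a map whose
    tangential components are split into f and phi. *)
Definition split_quadric (g : fps C N) (f : 'rV[fps C N]_n) (phi : 'rV[fps C N]_k) : fps C (N + N) :=
  hol1 g - antihol1 g - fps_C c * (\sum_j fps_C (eps j) * (hol1 (f 0 j) * antihol1 (f 0 j)))
  - fps_C c * (\sum_j fps_C (eta j) * (hol1 (phi 0 j) * antihol1 (phi 0 j))).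

Lemma split_quadric_coef g f phi a b : split_quadric g f phi (mpair a b) =
  g a *+ (b == 0%MM) - Num.conj (g b) *+ (a == 0%MM)
  - c * (\sum_j eps j * (f 0 j a * Num.conj (f 0 j b)))
  - c * (\sum_j eta j * (phi 0 j a * Num.conj (phi 0 j b))).
Proof.
rewrite /split_quadric !fpsBE !fps_CME hol1_coef antihol1_coef !fps_sumE.
by congr (_ - _ * _ - _ * _); apply: eq_bigr => j _; rewrite fps_CME hol1_antihol1_coef.
Qed.

Lemma split_quadric_mul (u u' : fps C N) g f phi a b : (hol1 u * antihol1 u' * split_quadric g f phi) (mpair a b) =
  (u * g) a * Num.conj (u' b) - u a * Num.conj ((u' * g) b)
  - c * (\sum_j eps j * ((u * f 0 j) a * Num.conj ((u' * f 0 j) b)))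
  - c * (\sum_j eta j * ((u * phi 0 j) a * Num.conj ((u' * phi 0 j) b))).
Proof.
have [_ hM _ _] := @hol1_chom R N; have [_ aM _ _] := @antihol1_chom R N.
have sumE I (r : seq I) (t : I -> C) (p q : I -> fps C N) :
    hol1 u * antihol1 u' * (\sum_(j <- r) fps_C (t j) * (hol1 (p j) * antihol1 (q j))) =
    \sum_(j <- r) fps_C (t j) * (hol1 (u * p j) * antihol1 (u' * q j)).
  rewrite mulr_sumr; apply: eq_bigr => j _; rewrite hM aM; exact: mulr_rank_one.
have -> : hol1 u * antihol1 u' * split_quadric g f phi =
  hol1 (u * g) * antihol1 u' - hol1 u * antihol1 (u' * g)
  - fps_C c * (\sum_j fps_C (eps j) * (hol1 (u * f 0 j) * antihol1 (u' * f 0 j)))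
  - fps_C c * (\sum_j fps_C (eta j) * (hol1 (u * phi 0 j) * antihol1 (u' * phi 0 j))).
  exact: (mulr_quadric (fps_C c) (hM u g) (aM u' g) (sumE _ (index_enum _) eps (f 0) (f 0))
           (sumE _ (index_enum _) eta (phi 0) (phi 0))).
rewrite !fpsBE !fps_CME !hol1_antihol1_coef !fps_sumE.
by congr (_ - _ * _ - _ * _); apply: eq_bigr => j _; rewrite fps_CME hol1_antihol1_coef.
Qed.
End QuadricSeries.

Variables (n k1 k2 : nat) (c : C) (eps : 'I_n -> C) (e1 : 'I_k1 -> C) (e2 : 'I_k2 -> C).
Hypothesis (c_neq0 : c != 0) (eps_neq0 : forall j, eps j != 0).
Hypothesis (hk : (k1 + k2 < n)%N).
Local Notation N := (n + 1)%N.
Local Notation zi := (fun j : 'I_n => lshift 1 j : 'I_N).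
Local Notation wi := (rshift n (ord0 : 'I_1) : 'I_N).
Local Notation Xz := (\row_(j < n) fps_X C (lshift 1 j) : 'rV[fps C N]_n).
Local Notation Xw := (fps_X C wi).

Variables (g : fps C N) (f : 'rV[fps C N]_n) (phi : 'rV[fps C N]_k2) (phi1 : 'rV[fps C N]_k1).
Variable a : fps C (N + N).
Hypothesis (g0 : g 0%MM = 0) (gz : forall j, g U_(zi j)%MM = 0) (gw : g U_(wi)%MM = 1).
Hypothesis (f0 : forall i, f 0 i 0%MM = 0).
Hypothesis (fz : forall i j, f 0 i U_(zi j)%MM = (i == j)%:R).
Hypothesis (fw : forall i, f 0 i U_(wi)%MM = 0).
Hypothesis (phi_ord : forall s m, (mdeg m < 2)%N -> phi 0 s m = 0).
Hypothesis (phi1_ord : forall s m, (mdeg m < 2)%N -> phi1 0 s m = 0).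

Let rho := split_quadric c eps e1 Xw Xz phi1.
Hypothesis key : split_quadric c eps e2 g f phi = a * rho.

Lemma zi_neq_wi j : (zi j == wi) = false. Proof. exact: eq_lrshift. Qed.
Lemma wi_neq_zi j : (wi == zi j) = false. Proof. exact: eq_rlshift. Qed.
Lemma mnmU_inj (M : nat) (i j : 'I_M) : (U_(i)%MM == U_(j)%MM) = (i == j).
Proof.
apply/eqP/eqP => [/mnmP/(_ j)|->//]; rewrite !mnm1E eqxx; by case: eqP.
Qed.

Lemma rho_coef al be : rho (mpair al be) =
  (al == U_(wi)%MM)%:R *+ (be == 0%MM) - (be == U_(wi)%MM)%:R *+ (al == 0%MM)
  - c * (\sum_j eps j * ((al == U_(zi j)%MM)%:R * (be == U_(zi j)%MM)%:R))
  - c * (\sum_s e1 s * (phi1 0 s al * Num.conj (phi1 0 s be))).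
Proof.
rewrite /rho split_quadric_coef; congr (_ - _ - _ * _ - _).
  by rewrite /fps_X rmorph_nat.
by apply: eq_bigr => j _; rewrite !mxE /fps_X rmorph_nat.
Qed.

Lemma phi1_sum0 al be : (mdeg al < 2)%N -> \sum_s e1 s * (phi1 0 s al * Num.conj (phi1 0 s be)) = 0.
Proof. by move=> h; rewrite big1 // => s _; rewrite phi1_ord // mul0r mulr0. Qed.
Lemma phi1_sum0r al be : (mdeg be < 2)%N -> \sum_s e1 s * (phi1 0 s al * Num.conj (phi1 0 s be)) = 0.
Proof. by move=> h; rewrite big1 // => s _; rewrite [phi1 0 s be]phi1_ord // rmorph0 !mulr0. Qed.

Lemma rho_0 be : rho (mpair 0%MM be) = - (be == U_(wi)%MM)%:R.
Proof.
rewrite rho_coef phi1_sum0 ?mdeg0 // !(eq_sym 0%MM) !mnm1_eq0 mul0rn eqxx mulr1n sub0r.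
rewrite big1 ?mulr0 ?subr0 // => j _.
by rewrite eq_sym mnm1_eq0 mul0r mulr0.
Qed.
Lemma rho_r0 al : rho (mpair al 0%MM) = (al == U_(wi)%MM)%:R.
Proof.
rewrite rho_coef phi1_sum0r ?mdeg0 // !(eq_sym 0%MM) !mnm1_eq0 mul0rn eqxx mulr1n subr0.
rewrite big1 ?mulr0 ?subr0 // => j _.
by rewrite [0%MM == _]eq_sym mnm1_eq0 !mulr0.
Qed.
Lemma rho_w be : rho (mpair U_(wi)%MM be) = (be == 0%MM)%:R.
Proof.
rewrite rho_coef phi1_sum0 ?mdeg1 // eqxx mnm1_eq0 mulr0n subr0.
rewrite big1 ?mulr0 ?subr0 => [|j _].
  by case: (be == 0%MM); rewrite ?mulr0n ?mulr1n.
by rewrite mnmU_inj wi_neq_zi mul0r mulr0.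
Qed.
Lemma rho_z j be : rho (mpair U_(zi j)%MM be) = - (c * eps j) *+ (be == U_(zi j)%MM).
Proof.
rewrite rho_coef phi1_sum0 ?mdeg1 // mnm1_eq0 mnmU_inj zi_neq_wi mul0rn mulr0n subrr sub0r.
rewrite (bigD1 j) //= big1 => [|i /negPf ij].
  by rewrite eqxx mul1r mulr0 subr0 addr0; case: eqP; rewrite ?mulr1n ?mulr0n ?mulr1 ?mulr0 ?oppr0.
by rewrite mnmU_inj (inj_eq (@lshift_inj _ _)) eq_sym ij mul0r mulr0.
Qed.

(** With weight three, the terms w and conj w of the defining series are heavier than
    the form in z, as the rank lemma requires. *)
Let q (i : 'I_N) : nat := if i == wi then 3 else 1.
Lemma q_pos i : (0 < q i)%N. Proof. by rewrite /q; case: ifP. Qed.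
Lemma q_zi j : q (zi j) = 1%N. Proof. by rewrite /q zi_neq_wi. Qed.
Lemma rho_zz j : rho (mpair U_(zi j)%MM U_(zi j)%MM) != 0.
Proof. by rewrite rho_z eqxx mulr1n oppr_eq0 mulf_neq0. Qed.

Lemma rho_weight al be : rho (mpair al be) != 0 ->
  (exists j, al = U_(zi j)%MM /\ be = U_(zi j)%MM) \/ (3 <= wt q al + wt q be)%N.
Proof.
move=> h; case: (leqP 2 (mdeg al)) => [la|].
  case: (leqP 2 (mdeg be)) => [lb|].
    right; apply: leq_trans (leq_add (wt_mdeg q_pos al) (wt_mdeg q_pos be)); lia.
  case e: (mdeg be) => [|[|d]] // _.
    move/eqP: e; rewrite mdeg_eq0 => /eqP b0; move: h la.
    rewrite b0 rho_r0; case: (al =P _) => [->|]; last by rewrite eqxx.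
    by rewrite mdeg1.
  have /mdeg1P[i /eqP bE] : mdeg be == 1%N by rewrite e.
  right; move: (wt_mdeg q_pos al); rewrite bE wtU; have := q_pos i; lia.
case e: (mdeg al) => [|[|d]] // _.
  move/eqP: e; rewrite mdeg_eq0 => /eqP a0; move: h.
  rewrite a0 rho_0; case: (be =P _) => [->|]; last by rewrite oppr0 eqxx.
  by right; rewrite !wtU /q eqxx; lia.
have /mdeg1P[i /eqP aE] : mdeg al == 1%N by rewrite e.
move: h; rewrite aE -(splitK i); case: (split i) => j /=.
  rewrite rho_z; case: (be =P _) => [-> _|]; last by rewrite mulr0n eqxx.
  by left; exists j.
rewrite (ord1 j) rho_w; case: (be =P _) => [-> _|]; last by rewrite eqxx.
by right; rewrite wtU /q eqxx.
Qed.

(** The terms linear in w of [key], on conj w = 0. *)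
Lemma multiplier_axis (be : 'X_{1..N}) : be wi = 0%N -> a (mpair 0%MM be) = (be == 0%MM)%:R.
Proof.
move=> bw; have := congr1 (fun F : fps C (N + N) => F (mpair U_(wi)%MM be)) key.
rewrite split_quadric_coef gw mnm1_eq0 mulr0n subr0.
rewrite big1 => [|i _]; last by rewrite fw mul0r mulr0.
rewrite big1 => [|s _]; last by rewrite phi_ord ?mdeg1 // mul0r mulr0.
rewrite mulr0 !subr0 (@split_coef1 _ _ _ _ _ _ 0%MM be U_(wi)%MM 0%MM) ?add0m ?addm0 //.
  by rewrite rho_w eqxx mulr1 => <-; case: eqP; rewrite ?mulr1n ?mulr0n.
move=> a1 b1 a2 b2 ea eb ne.
case: (mnmU_split ea) => -[a1E a2E]; rewrite a2E.
  rewrite rho_0; case: (b2 =P _) => [b2E|]; rewrite ?oppr0 ?mulr0 //.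
  by move: bw; rewrite eb b2E mnmDE mnm1E eqxx; lia.
rewrite rho_w; case: (b2 =P _) => [b2E|]; rewrite ?mulr0 //.
by case: ne; rewrite a1E eb b2E addm0.
Qed.

(** The terms linear in z_j of [key], on conj w = 0: the first jet of f at 0 and the
    previous lemma determine f there. *)
Lemma f_axis j (be : 'X_{1..N}) : be wi = 0%N -> Num.conj (f 0 j be) = (be == U_(zi j)%MM)%:R.
Proof.
move=> bw; have := congr1 (fun F : fps C (N + N) => F (mpair U_(zi j)%MM be)) key.
rewrite split_quadric_coef gz mnm1_eq0 mul0rn mulr0n subr0.
rewrite (bigD1 j) //= big1 => [|i /negPf ij]; last by rewrite fz ij mul0r mulr0.
rewrite fz eqxx mul1r addr0.
rewrite big1 => [|s _]; last by rewrite phi_ord ?mdeg1 // mul0r mulr0.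
rewrite mulr0 subr0 sub0r => E; apply: (mulfI (eps_neq0 j)); apply: (mulfI c_neq0).
apply: oppr_inj; rewrite {}E.
have nz a1 b1 a2 b2 : U_(zi j)%MM = (a1 + a2)%MM -> be = (b1 + b2)%MM ->
    a (mpair a1 b1) * rho (mpair a2 b2) != 0 ->
    [/\ a1 = 0%MM, a2 = U_(zi j)%MM & b2 = U_(zi j)%MM].
  move=> ea eb; case: (mnmU_split ea) => -[a1E a2E]; rewrite a2E.
    rewrite rho_0; case: (b2 =P _) => [b2E|]; rewrite ?oppr0 ?mulr0 ?eqxx //.
    by move: bw; rewrite eb b2E mnmDE mnm1E eqxx; lia.
  by rewrite rho_z; case: (b2 =P _) => [b2E _|]; rewrite ?mulr0n ?mulr0 ?eqxx.
have [bj|bj] := posnP (be (zi j)).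
  rewrite split_coef0 => [|a1 b1 a2 b2 ea eb]; last first.
    apply/eqP/negPn/negP => /(nz _ _ _ _ ea eb)[_ _ b2E].
    by move: bj; rewrite eb b2E mnmDE mnm1E eqxx; lia.
  case: eqP => [bE|_]; last by rewrite !mulr0 oppr0.
  by move: bj; rewrite bE mnm1E eqxx.
have bE : be = ((be - U_(zi j)) + U_(zi j))%MM.
  by rewrite submK //; apply/mnm_lepP => s; rewrite mnm1E; case: eqP => // <-.
set b' := (be - _)%MM in bE.
rewrite (@split_coef1 _ _ _ _ _ _ 0%MM b' U_(zi j)%MM U_(zi j)%MM) ?add0m //.
  rewrite multiplier_axis; last by move: bw; rewrite bE mnmDE; lia.
  rewrite rho_z eqxx mulr1n mulrN mulrC mulrA; congr (- (_ * _%:R)).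
  rewrite bE; congr nat_of_bool; apply/eqP/eqP => [->|/mnmP h]; first by rewrite add0m.
  by apply/mnmP => s; have := h s; rewrite mnmDE mnm0E; lia.
move=> a1 b1 a2 b2 ea eb ne; apply/eqP/negPn/negP => /(nz _ _ _ _ ea eb)[a1E _ b2E].
case: ne; rewrite a1E; congr (_, _); apply/mnmP => s.
by move: eb; rewrite bE b2E => /mnmP/(_ s); rewrite !mnmDE; lia.
Qed.

(** The restriction of the multiplier to conj Z = 0. *)
Let h : fps C N := fun al => a (mpair al 0%MM).

Lemma g_factor : g = Xw * h.
Proof.
apply/fps_ext => al; have := congr1 (fun F : fps C (N + N) => F (mpair al 0%MM)) key.
rewrite split_quadric_coef eqxx g0 rmorph0 mul0rn subr0 mulr1n.
rewrite big1 => [|i _]; last by rewrite f0 rmorph0 !mulr0.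
rewrite big1 => [|s _]; last by rewrite [phi 0 s 0%MM]phi_ord ?mdeg0 // rmorph0 !mulr0.
rewrite mulr0 !subr0 => ->.
rewrite mulrC (@fpsM_restr _ _ _ _ (hol1 Xw) (hol1 h)).
  by have [_ hM _ _] := @hol1_chom R N; rewrite -hM hol1_coef eqxx mulr1n.
move=> m1 m2; rewrite -(mpairK m1) -(mpairK m2) mpairD => /mpair_inj[_ /mnm_add_eq0[-> ->]].
by rewrite rho_r0 !hol1_coef eqxx !mulr1n.
Qed.

(** Restriction to conj w = 0. *)
Let restr (F : fps C (N + N)) : fps C (N + N) := fun m => if msnd m wi == 0%N then F m else 0.
Let A1 := restr (a - hol1 h).

(** On conj w = 0, where f is known by [f_axis], only the terms of phi and phi1 have
    order two or more in conj z. *)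
Lemma residue_coef (al be : 'X_{1..N}) : be wi = 0%N -> (A1 * restr rho) (mpair al be) =
  g al *+ (be == 0%MM) - c * (\sum_j eps j * ((f 0 j - h * Xz 0 j) al * (be == U_(zi j)%MM)%:R))
  - (h * Xw) al *+ (be == 0%MM)
  - c * (\sum_s e2 s * (phi 0 s al * Num.conj (phi 0 s be)))
  + c * (\sum_s e1 s * ((h * phi1 0 s) al * Num.conj (phi1 0 s be))).
Proof.
move=> bw; rewrite (@fpsM_restr _ _ _ _ (a - hol1 h) rho) => [|m1 m2]; last first.
  rewrite -(mpairK m1) -(mpairK m2) mpairD => /mpair_inj[_ e]; rewrite /A1 /restr !msnd_pair.
  by move: bw; rewrite e mnmDE => /eqP; rewrite addn_eq0 => /andP[-> ->].
rewrite mulrBl fpsBE -key.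
have -> : hol1 h * rho = hol1 h * antihol1 1 * rho.
  by have [_ _ o _] := @antihol1_chom R N; rewrite o mulr1.
rewrite split_quadric_coef split_quadric_mul !mul1r !fps1E rmorph_nat.
have -> : Num.conj (g be) = 0 by rewrite g_factor fps_X_coef0 // rmorph0.
have -> : Num.conj (Xw be) = 0.
  rewrite /fps_X; case: eqP => [e|_]; last by rewrite rmorph0.
  by move: bw; rewrite e mnm1E eqxx.
under eq_bigr => j _ do rewrite f_axis //.
under [X in _ - (_ - c * X - _)]eq_bigr => j _.
  rewrite !mul1r {2}mxE /fps_X rmorph_nat; over.
under [X in _ - (_ - _ - c * X)]eq_bigr => j _ do rewrite !mul1r.
under [X in _ = _ - c * X - _ - _ + _]eq_bigr => j _.
  rewrite fpsBE mulrBl mulrBr; over.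
rewrite sumrB /= mul0rn mulr0 mulr_natr; ring.
Qed.

(** The previous formula writes [A1] times the defining series as k1 + k2 products on
    the columns of degree at least two.  As [A1] vanishes on conj Z = 0, the minors of
    the rank lemma lie in those columns, so [A1] = 0; the columns conj z_j then give
    f = h z. *)
Lemma f_factor j : f 0 j = h * Xz 0 j.
Proof.
pose Cl (be : 'X_{1..N}) := be wi = 0%N /\ (2 <= mdeg be)%N.
have A10 : A1 = 0.
  apply: (@rank_lemma C N n zi q (@lshift_inj _ _) q_pos q_zi A1 (restr rho) _ _ (k1 + k2)%N
    (fun s al => match split s with inl i => c * e1 i * (h * phi1 0 i) al
                                  | inr i => - c * e2 i * phi 0 i al end)
    (fun s be => match split s with inl i => Num.conj (phi1 0 i be)
                                  | inr i => Num.conj (phi 0 i be) end)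
    (fun _ => True) Cl) => //.
  - by move=> i; rewrite /restr msnd_pair mnm1E zi_neq_wi eqxx; apply: rho_zz.
  - move=> al be; rewrite /restr; case: ifP => [_|]; last by rewrite eqxx.
    exact: rho_weight.
  - move=> al be i; rewrite /A1 /restr msnd_pair; case: (be wi =P 0%N) => [bw|]; last by rewrite eqxx.
    move=> ne; split => //; split; first by rewrite mnmDE bw mnm1E zi_neq_wi.
    rewrite mdegD mdeg1 addn1 ltnS lt0n mdeg_eq0; apply: contraNN ne => /eqP ->.
    by rewrite fpsBE hol1_coef eqxx mulr1n subrr.
  - move=> al be _ [bw b2]; rewrite residue_coef //.
    have b0 : (be == 0%MM) = false by apply/negP => /eqP e; move: b2; rewrite e mdeg0.
    rewrite b0 !mulr0n subr0 sub0r big1 ?mulr0 ?oppr0 ?sub0r => [|i _]; last first.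
      case: eqP => [e|_]; last by rewrite !mulr0.
      by move: b2; rewrite e mdeg1.
    rewrite big_split_ord /= addrC !mulr_sumr -sumrN; congr (_ + _); apply: eq_bigr => s _.
      by rewrite -[rshift _ _]/(unsplit (inr s)) unsplitK !mulrA !mulNr.
    by rewrite -[lshift _ _]/(unsplit (inl s)) unsplitK !mulrA.
apply/fps_ext => al; apply/eqP; rewrite -subr_eq0 -fpsBE.
have bw : (U_(zi j)%MM : 'X_{1..N}) wi = 0%N by rewrite mnm1E zi_neq_wi.
have := residue_coef al bw; rewrite A10 mul0r fps0E mnm1_eq0 !mulr0n subr0 sub0r.
rewrite (bigD1 j) //= eqxx mulr1 big1 => [|i /negPf ij]; last first.
  by rewrite mnmU_inj (inj_eq (@lshift_inj _ _)) eq_sym ij !mulr0.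
rewrite big1 => [|s _]; last by rewrite [phi 0 s U_(_)%MM]phi_ord ?mdeg1 // rmorph0 !mulr0.
rewrite big1 => [|s _]; last by rewrite [phi1 0 s U_(_)%MM]phi1_ord ?mdeg1 // rmorph0 !mulr0.
rewrite mulr0 !addr0 subr0 => /esym/eqP; rewrite oppr_eq0 mulf_eq0 (negPf c_neq0) /=.
by rewrite mulf_eq0 (negPf (eps_neq0 j)).
Qed.

(** Here v = 1 / h.  After division by h conj(h), [key] compares the defining series
    along (z, v phi, w) and (z, phi1, w), except that the rows w and the columns
    conj w carry the extra terms w (conj(v) - 1) and (v - 1) conj w.  Off this row and
    this column there are k1 + k2 products, so the rank lemma shows that the two series
    coincide; the row w then forces v = 1 + r w with r real. *)
Lemma core_rigidity : exists (v : fps C N) (r : C),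
  [/\ Num.conj r = r, v = 1 + fps_C r * Xw, v * g = Xw, (forall j, v * f 0 j = Xz 0 j) &
      \sum_s fps_C (e2 s) * (hol1 (v * phi 0 s) * antihol1 (v * phi 0 s)) =
      \sum_s fps_C (e1 s) * (hol1 (phi1 0 s) * antihol1 (phi1 0 s))].
Proof.
have [v hv] : exists v, h * v = 1.
  by apply: fps_inv_exists; rewrite /h multiplier_axis ?mnm0E // eqxx oner_eq0.
have vg : v * g = Xw by rewrite g_factor mulrCA [v * h]mulrC hv mulr1.
have vf j : v * f 0 j = Xz 0 j by rewrite f_factor mulrA [v * h]mulrC hv mul1r.
pose A2 := a * (hol1 v * antihol1 v) - 1.
have E al be : (A2 * rho) (mpair al be) =
    Xw al * Num.conj (v be) - v al * Num.conj (Xw be)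
    - c * (\sum_s e2 s * ((v * phi 0 s) al * Num.conj ((v * phi 0 s) be)))
    - (Xw al *+ (be == 0%MM) - Num.conj (Xw be) *+ (al == 0%MM))
    + c * (\sum_s e1 s * (phi1 0 s al * Num.conj (phi1 0 s be))).
  rewrite /A2 mulrBl mul1r mulrAC -key [_ * (hol1 v * _)]mulrC fpsBE split_quadric_mul /rho split_quadric_coef vg.
  under eq_bigr => j _ do rewrite vf.
  ring.
have A20 : A2 = 0.
  apply: (@rank_lemma C N n zi q (@lshift_inj _ _) q_pos q_zi A2 rho _ _ (k1 + k2)%N
    (fun s al => match split s with inl i => c * e1 i * phi1 0 i al
                                  | inr i => - c * e2 i * (v * phi 0 i) al end)
    (fun s be => match split s with inl i => Num.conj (phi1 0 i be)
                                  | inr i => Num.conj ((v * phi 0 i) be) end)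
    (fun al => al <> U_(wi)%MM) (fun be => be <> U_(wi)%MM)) => //.
  - exact: rho_zz.
  - exact: rho_weight.
  - by move=> al be j _; split=> /mnmP/(_ (zi j)); rewrite mnmDE !mnm1E eqxx wi_neq_zi; lia.
  - move=> al be /eqP/negPf na /eqP/negPf nb; rewrite E /fps_X na nb /= !conjC0.
    rewrite mul0r mulr0 !mul0rn !subr0 sub0r.
    rewrite big_split_ord /= addrC !mulr_sumr -sumrN; congr (_ + _); apply: eq_bigr => s _.
      by rewrite -[rshift _ _]/(unsplit (inr s)) unsplitK !mulrA !mulNr.
    by rewrite -[lshift _ _]/(unsplit (inl s)) unsplitK !mulrA.
have E0 al be := etrans (esym (E al be)) (congr1 (fun F : fps C (N + N) => (F * rho) (mpair al be)) A20).
have v_row be : Num.conj (v be) = (be == 0%MM)%:R + v U_(wi)%MM * (be == U_(wi)%MM)%:R.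
  have := E0 U_(wi)%MM be; rewrite mul0r fps0E /fps_X eqxx rmorph_nat mnm1_eq0 !mulr0n subr0 mul1r.
  rewrite big1 => [|s _]; last first.
    by rewrite fpsM_coefU !phi_ord ?mdeg0 ?mdeg1 // !mulr0 addr0 mul0r mulr0.
  rewrite phi1_sum0 ?mdeg1 // !mulr0 subr0 addr0 => /eqP.
  by rewrite subr_eq0 subr_eq => /eqP ->.
pose r := v U_(wi)%MM.
have r_real : Num.conj r = r.
  by rewrite {1}/r v_row mnm1_eq0 eqxx mulr1 add0r.
have vE : v = 1 + fps_C r * Xw.
  apply/fps_ext => be; rewrite -[LHS]conjCK v_row fpsDE fps1E fps_CME.
  by rewrite rmorphD rmorphM !rmorph_nat -/r /= r_real.
exists v, r; split => //; apply: fps_ext_split => al be; rewrite !fps_sumE.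
under eq_bigr => s _ do rewrite fps_CME hol1_antihol1_coef.
under [RHS]eq_bigr => s _ do rewrite fps_CME hol1_antihol1_coef.
apply: (mulfI c_neq0).
have vE' : v al = (al == 0%MM)%:R + r * (al == U_(wi)%MM)%:R.
  by rewrite vE fpsDE fps1E fps_CME.
have := E0 al be; rewrite mul0r fps0E v_row -/r vE' /fps_X !rmorph_nat.
set S1 := \sum_s _; set S2 := \sum_s _ => e0.
apply/eqP; rewrite -subr_eq0; apply/eqP; apply: oppr_inj; rewrite oppr0 -[RHS]e0.
by case: eqP => _; case: eqP => _; case: eqP => _; case: eqP => _;
   rewrite /= ?mulr0n ?mulr1n; ring.
Qed.
End Core.

(** * Linear fractional maps as power series *)

Section FpsScalars.
Variables (K : comNzRingType) (n : nat).
Fact fps_C_zmod : zmod_morphism (@fps_C K n).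
Proof. by move=> a b; rewrite fps_CD fps_CN. Qed.
Fact fps_C_monoid : monoid_morphism (@fps_C K n).
Proof. by split; [|exact: fps_CM]. Qed.
HB.instance Definition _ := GRing.isZmodMorphism.Build K (fps K n) (@fps_C K n) fps_C_zmod.
HB.instance Definition _ := GRing.isMonoidMorphism.Build K (fps K n) (@fps_C K n) fps_C_monoid.
End FpsScalars.

Section Projective.
Variables (K : fieldType).

Definition lin_form p (a : 'cV[K]_p) : fps K p := \sum_i fps_C (a i 0) * fps_X K i.

Lemma lin_form0 p (a : 'cV[K]_p) : lin_form a 0%MM = 0.
Proof. by rewrite /lin_form fps_sumE big1 // => i _; rewrite fps_CME fps_X0 mulr0. Qed.

(** The map x |-> x A / (1 + x v) of row vectors. *)
Definition linfrac M (A : 'M[K]_M) (v : 'cV[K]_M) : 'rV[fps K M]_M :=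
  \row_j (lin_form (col j A) * fps_geom (- lin_form v)).

Lemma linfrac_vanishing M (A : 'M[K]_M) v : vanishing_at0 (linfrac A v).
Proof. by move=> j; rewrite mxE fpsM_coef0E lin_form0 mul0r. Qed.

Local Notation "B ^f" := (map_mx (@fps_C K _) B).

Lemma comp_lin_form p q (a : 'cV[K]_p) (H : 'rV[fps K q]_p) : vanishing_at0 H ->
  fps_comp (lin_form a) H = (H *m a^f) 0 0.
Proof.
move=> H0; have hC := fps_comp_chom H0; have [_ hM _ _] := hC.
rewrite /lin_form (chom_sum hC) mxE; apply: eq_bigr => i _.
by rewrite hM fps_compC // fps_compX // mxE mulrC.
Qed.

(** Clearing the denominator turns statements about linear fractional maps into
    linear algebra; by [linfrac_comp_uniq] the equation characterizes the composite. *)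
Lemma linfrac_comp M p (A : 'M[K]_M) v (H : 'rV[fps K p]_M) : vanishing_at0 H ->
  (1 + (H *m v^f) 0 0) *: fps_mcomp (linfrac A v) H = H *m A^f.
Proof.
move=> H0; apply/rowP => j; rewrite mxE mcompE [linfrac A v 0 j]mxE fps_compM //.
rewrite !comp_lin_form // -comp_lin_form // mulrCA.
have -> : (H *m (col j A)^f) 0 0 = (H *m A^f) 0 j.
  by rewrite !mxE; apply: eq_bigr => i _; rewrite !mxE.
rewrite -[in 1 + _](fps_comp1 H0) -fps_compD // -fps_compM //.
have e : (1 + lin_form v) * fps_geom (- lin_form v) = 1.
  by rewrite -[in 1 + _](opprK (lin_form v)) fps_geomE // fpsNE lin_form0 oppr0.
by rewrite e fps_comp1 // mulr1.
Qed.

Lemma den_coef0 M p (v : 'cV[K]_M) (H : 'rV[fps K p]_M) : vanishing_at0 H ->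
  (1 + (H *m v^f) 0 0) 0%MM = 1.
Proof.
move=> H0; rewrite fpsDE fps1E eqxx mxE fps_sumE big1 ?addr0 // => i _.
by rewrite fpsM_coef0E H0 mul0r.
Qed.

Lemma unit_cancel p (d : fps K p) : d 0%MM != 0 -> injective ( *%R d).
Proof.
move=> /fps_inv_exists[v dv] f g /(congr1 ( *%R v)).
by rewrite !mulrA [v * d]mulrC dv !mul1r.
Qed.

Lemma linfrac_comp_uniq M p (A : 'M[K]_M) v (H G : 'rV[fps K p]_M) : vanishing_at0 H ->
  (1 + (H *m v^f) 0 0) *: G = H *m A^f -> G = fps_mcomp (linfrac A v) H.
Proof.
move=> H0 e; apply/rowP => j; apply: (@unit_cancel _ (1 + (H *m v^f) 0 0)).
  by rewrite den_coef0 // oner_eq0.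
have /rowP/(_ j) := e; rewrite -(linfrac_comp A v H0) !mxE; exact.
Qed.

Lemma linfrac_linfrac M p (A1 A2 : 'M[K]_M) v1 v2 (H : 'rV[fps K p]_M) : vanishing_at0 H ->
  fps_mcomp (linfrac A2 v2) (fps_mcomp (linfrac A1 v1) H) =
  fps_mcomp (linfrac (A1 *m A2) (v1 + A1 *m v2)) H.
Proof.
move=> H0; set G1 := fps_mcomp (linfrac A1 v1) H.
have G10 : vanishing_at0 G1 by apply: mcomp_vanishing => //; apply: linfrac_vanishing.
apply: linfrac_comp_uniq => //.
have e1 := linfrac_comp A1 v1 H0; have e2 := linfrac_comp A2 v2 G10.
rewrite -/G1 in e1.
have -> : 1 + (H *m (v1 + A1 *m v2)^f) 0 0 =
    (1 + (H *m v1^f) 0 0) * (1 + (G1 *m v2^f) 0 0).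
  rewrite map_mxD map_mxM mulmxDr mulmxA -e1 -scalemxAl !mxE addrA mulrDr mulr1.
  by [].
rewrite -scalerA map_mxM mulmxA -e1 -scalemxAl; congr (_ *: _); exact: e2.
Qed.

Lemma linfrac_id M : linfrac (1%:M : 'M[K]_M) 0 = fps_vars K M.
Proof.
rewrite -(mcomp_vars (linfrac 1%:M 0)); apply/esym/linfrac_comp_uniq.
  exact: vars_vanishing.
by rewrite map_mx0 mulmx0 map_mx1 mulmx1 mxE addr0 scale1r.
Qed.

Lemma linfrac_inverse M (A : 'M[K]_M) v : A \in unitmx ->
  fps_mcomp (linfrac A v) (linfrac (invmx A) (- (invmx A *m v))) = fps_vars K M /\
  fps_mcomp (linfrac (invmx A) (- (invmx A *m v))) (linfrac A v) = fps_vars K M.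
Proof.
move=> uA; have V := @vars_vanishing K M; split.
  rewrite -[X in fps_mcomp _ X]mcomp_vars linfrac_linfrac // mulVmx // addrC subrr.
  by rewrite mcomp_vars linfrac_id.
rewrite -[X in fps_mcomp _ X]mcomp_vars linfrac_linfrac // mulmxV // mulmxN mulmxA mulmxV //.
by rewrite mul1mx subrr mcomp_vars linfrac_id.
Qed.

Lemma linfrac_jacobian M p (A : 'M[K]_M) v (H : 'rV[fps K p]_M) : vanishing_at0 H ->
  jacobian0 (fps_mcomp (linfrac A v) H) = jacobian0 H *m A.
Proof.
move=> H0; apply/matrixP => i j; rewrite [LHS]mxE [RHS]mxE.
have G0 : vanishing_at0 (fps_mcomp (linfrac A v) H).
  by apply: mcomp_vanishing => //; apply: linfrac_vanishing.
have /rowP/(_ j) := linfrac_comp A v H0; rewrite [LHS]mxE [RHS]mxE.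
move/(congr1 (fun f : fps K p => f U_(i)%MM)); rewrite fpsM_coefU den_coef0 // G0.
rewrite mulr0 addr0 mul1r => ->.
rewrite fps_sumE; apply: eq_bigr => s _; rewrite !mxE [_ * fps_C _]mulrC fps_CME mulrC.
by [].
Qed.
End Projective.

(** * Convergence of linear fractional maps *)
Section Convergence.
Variable R : realType.
Local Notation C := R[i].

Lemma pow_half_small (B e : C) : 0 <= B -> 0 < e ->
  exists d0 : nat, forall d, (d0 <= d)%N -> B * 2^-1 ^+ d < e.
Proof.
move=> B0 e0; have Be0 : 0 <= B / e by rewrite divr_ge0 // ltW.
have [N hN] : exists N : nat, B / e < N%:R.
  move: (B / e) Be0 => [a b]; rewrite lecE /= => /andP[/eqP -> a0].
  exists (Num.bound a); have := archi_boundP a0.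
  have -> : (Num.bound a)%:R = ((Num.bound a)%:R)%:C%C :> C by rewrite rmorph_nat.
  by rewrite ltcE /= eqxx.
exists N => d Nd; rewrite exprVn ltr_pdivrMr ?exprn_gt0 ?ltr0n //.
rewrite mulrC -ltr_pdivrMr //; apply: lt_le_trans hN _.
by rewrite -natrX ler_nat (leq_trans _ (ltnW (ltn_expl d (isT : 1 < 2)%N))).
Qed.

Lemma has_value_unique n (f : fps C n) Z y y' :
  has_value f Z y -> has_value f Z y' -> y = y'.
Proof.
move=> h h'; apply/eqP; rewrite -subr_eq0 -normr_eq0; apply/negPn/negP => ne.
have e0 : 0 < `|y - y'| / 2 by rewrite divr_gt0 ?ltr0n // lt_def ne normr_ge0.
have [d hd] := h _ e0; have [d' hd'] := h' _ e0.
have a := hd (maxn d d') (leq_maxl _ _); have b := hd' (maxn d d') (leq_maxr _ _).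
set t := _.@[_] in a b.
have : `|y - y'| < `|y - y'| / 2 + `|y - y'| / 2.
  have -> : y - y' = - (t - y) + (t - y') by ring.
  apply: le_lt_trans (ler_normD _ _) _; rewrite normrN.
  have -> : - (t - y) + (t - y') = y - y' by ring.
  exact: ltrD a b.
by rewrite -mulrDl -mulr2n -[X in _ < X / _]mulr_natr mulfK ?pnatr_eq0 // ltxx.
Qed.

Section Truncation.
Variables (K : fieldType) (M : nat).
Implicit Types (a v : 'cV[K]_M).
Definition lin_mpoly a : {mpoly K[M]} := \sum_i a i 0 *: 'X_i.

Lemma fps_of_lin_mpoly a : fps_of (lin_mpoly a) = lin_form a.
Proof.
apply/fps_ext => m; rewrite /fps_of /lin_mpoly /lin_form raddf_sum fps_sumE /=.
apply: eq_bigr => i _; rewrite mcoeffZ fps_CME mcoeffX.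
by rewrite /fps_X eq_sym.
Qed.

Lemma meval_lin_mpoly a (x : 'I_M -> K) : (lin_mpoly a).@[x] = \sum_i a i 0 * x i.
Proof.
rewrite /lin_mpoly raddf_sum /=; apply: eq_bigr => i _.
by rewrite mevalZ mevalXU.
Qed.

Definition degle d (p : {mpoly K[M]}) := forall m, (d < mdeg m)%N -> p@_m = 0.
Lemma degleM d e p q : degle d p -> degle e q -> degle (d + e) (p * q).
Proof.
move=> hp quadric_along m md; rewrite -[LHS]/(fps_of (p * q) m) fps_ofM.
apply: fpsM_coef0 => k1 k2 mE; rewrite /fps_of.
have [l|l] := ltnP d (mdeg k1); first by rewrite hp // mul0r.
by rewrite quadric_along ?mulr0 //; move: md; rewrite mE mdegD; lia.
Qed.
Lemma degle_lin a : degle 1 (lin_mpoly a).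
Proof.
move=> m m1; rewrite /lin_mpoly raddf_sum big1 // => i _ /=.
rewrite mcoeffZ mcoeffX; case: eqP => [e|]; rewrite ?mulr0 //.
by move: m1; rewrite -e mdeg1.
Qed.
Lemma degle_exp d p k : degle d p -> degle (d * k) (p ^+ k).
Proof.
move=> h; elim: k => [|k IH].
  by rewrite muln0 expr0 => m m0; rewrite mcoeff1; case: eqP m0 => // ->; rewrite mdeg0.
by rewrite exprS mulnS; apply: degleM.
Qed.

(** The powers of a linear form are homogeneous, so truncating the geometric series by
    degree is truncating it by number of terms. *)
Lemma trunc_lin_frac a v d : fps_trunc d.+1 (lin_form a * fps_geom (lin_form v)) =
  lin_mpoly a * \sum_(k < d) lin_mpoly v ^+ k.
Proof.
have L0 := lin_form0 v.
apply/mpolyP => m; case: (ltnP (mdeg m) d.+1) => md.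
  rewrite fps_truncE //.
  have := @agreeM _ _ d.+1 _ _ _ _ (agree_refl (lin_form a)) (fps_geom_agree (d := d.+1) L0).
  move=> /(_ m md) ->; rewrite big_ord_recr /= mulrDr fpsDE.
  have o := ordgeM (ordge1 (lin_form0 a)) (ordge_exp (k := d) (ordge1 L0)).
  rewrite ((ordgeE _ _).1 o) ?addr0; last by rewrite mul1n.
  rewrite -[RHS]/(fps_of _ m) fps_ofM fps_of_lin_mpoly.
  suff -> : fps_of (\sum_(k < d) lin_mpoly v ^+ k) = \sum_(k < d) lin_form v ^+ k by [].
  apply/fps_ext => l; rewrite fps_sumE /fps_of raddf_sum; apply: eq_bigr => k _ /=.
  by rewrite -[LHS]/(fps_of _ l) fps_ofX fps_of_lin_mpoly.
rewrite /fps_trunc raddf_sum big1 /= => [|[k kd] _ /=]; last first.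
  rewrite mcoeffZ mcoeffX; case: eqP => [e|]; rewrite ?mulr0 //.
  by move: kd; rewrite e ltnNge md.
case: d md => [|d] md; first by rewrite big_ord0 mulr0 mcoeff0.
apply/esym; apply: (@degleM 1 d _ _ (degle_lin a)); last by lia.
move=> l ld; rewrite raddf_sum big1 // => k _ /=.
by apply: (degle_exp (k := k) (degle_lin v)); have := ltn_ord k; lia.
Qed.
End Truncation.

Lemma lin_formN (K : fieldType) M (v : 'cV[K]_M) : - lin_form v = lin_form (- v).
Proof.
rewrite /lin_form -sumrN; apply: eq_bigr => i _.
by rewrite mxE fps_CN mulNr.
Qed.

Lemma linfracE (K : fieldType) M (A : 'M[K]_M) v j :
  linfrac A v 0 j = lin_form (col j A) * fps_geom (lin_form (- v)).
Proof. by rewrite mxE lin_formN. Qed.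

Lemma addr1_neq0 (t : C) : `|t| <= 2^-1 -> 1 + t != 0.
Proof.
move=> ht; apply/eqP => h.
have t1 : `|t| = 1.
  by rewrite (_ : t = -1) ?normrN1 //; apply/eqP; rewrite -addr_eq0 addrC h.
have : (1 : C) < 1.
  by rewrite -{1}t1 (le_lt_trans ht) // invf_lt1 ?ltr0n // ltr1n.
by rewrite ltxx.
Qed.

Lemma linfrac_value M (A : 'M[C]_M) v (Z : 'rV[C]_M) j : `|(Z *m v) 0 0| <= 2^-1 ->
  has_value (linfrac A v 0 j) Z ((Z *m A) 0 j / (1 + (Z *m v) 0 0)).
Proof.
set t := (Z *m v) 0 0 => ht e e0.
have t1 := addr1_neq0 ht.
have [d0 hd0] := pow_half_small (normr_ge0 ((Z *m A) 0 j / (1 + t))) e0.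
exists d0.+1 => -[//|d]; rewrite ltnS => d0d.
rewrite linfracE trunc_lin_frac mevalM meval_lin_mpoly raddf_sum /=.
have -> : \sum_i (col j A) i 0 * Z 0 i = (Z *m A) 0 j.
  by rewrite mxE; apply: eq_bigr => i _; rewrite mxE mulrC.
have -> : \sum_(k < d) (lin_mpoly (- v) ^+ k).@[fun i => Z 0 i] = \sum_(k < d) (- t) ^+ k.
  apply: eq_bigr => k _; rewrite rmorphXn /= meval_lin_mpoly; congr (_ ^+ _).
  by rewrite /t mxE -sumrN; apply: eq_bigr => i _; rewrite mxE mulNr mulrC.
have -> : \sum_(k < d) (- t) ^+ k = (1 - (- t) ^+ d) / (1 + t).
  apply: (mulIf t1); rewrite mulfVK // -[1 - _]opprB subrX1 -mulNr opprB opprK.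
  exact: mulrC.
have -> : (Z *m A) 0 j * ((1 - (- t) ^+ d) / (1 + t)) - (Z *m A) 0 j / (1 + t) =
   - ((Z *m A) 0 j / (1 + t) * (- t) ^+ d) by ring.
rewrite normrN normrM normrX normrN.
apply: le_lt_trans (hd0 d d0d); apply: ler_wpM2l; first exact: normr_ge0.
by apply: lerXn2r; rewrite ?nnegrE ?normr_ge0 ?invr_ge0 ?ler0n.
Qed.

Definition majorized n (f F : fps C n) := forall m, `|f m| <= F m.
Lemma majorizedM n (f F g G : fps C n) : majorized f F -> majorized g G -> majorized (f * g) (F * G).
Proof.
move=> h h' m; rewrite !fpsME; apply: le_trans (ler_norm_sum _ _ _) _.
by apply: ler_sum => k _; rewrite normrM; apply: ler_pM.
Qed.
Lemma majorized_sum n I (r : seq I) (f F : I -> fps C n) : (forall i, majorized (f i) (F i)) ->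
  majorized (\sum_(i <- r) f i) (\sum_(i <- r) F i).
Proof.
move=> h m; rewrite !fps_sumE; apply: le_trans (ler_norm_sum _ _ _) _.
by apply: ler_sum => i _; apply: h.
Qed.
Lemma majorized_exp n (f F : fps C n) k : majorized f F -> majorized (f ^+ k) (F ^+ k).
Proof.
move=> h; elim: k => [|k IH]; last by rewrite !exprS; apply: majorizedM.
by move=> m; rewrite !expr0 fps1E normr_nat.
Qed.
Lemma majorized_geom n (f F : fps C n) : majorized f F -> majorized (fps_geom f) (fps_geom F).
Proof. by move=> h m; apply: majorized_sum => k; apply: majorized_exp. Qed.
Lemma majorized_lin M (a : 'cV[C]_M) : majorized (lin_form a) (lin_form (map_mx Num.norm a)).
Proof.
apply: majorized_sum => i m; rewrite !fps_CME normrM mxE /fps_X.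
by rewrite normr_nat.
Qed.

Lemma small_radius M (v : 'cV[C]_M) : exists2 r : C, 0 < r &
  (\sum_i `|v i 0|) * r <= 2^-1.
Proof.
have s0 : 0 <= \sum_i `|v i 0| by apply: sumr_ge0 => i _; apply: normr_ge0.
have s1 : 0 < 1 + \sum_i `|v i 0| by apply: ltr_wpDr.
exists (2^-1 / (1 + \sum_i `|v i 0|)).
  by rewrite divr_gt0 // invr_gt0 ltr0n.
rewrite mulrCA -[X in _ <= X]mulr1; apply: ler_wpM2l; first by rewrite invr_ge0 ler0n.
by rewrite ler_pdivrMr // mul1r lerDr ler01.
Qed.

(** Replacing the coefficients of the linear forms by their absolute values gives a
    majorant, whose partial sums at (r, ..., r) are partial sums of a geometric series of
    ratio at most 1/2. *)
Lemma linfrac_convergent M (A : 'M[C]_M) v j : convergent (linfrac A v 0 j).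
Proof.
rewrite linfracE; set a := col j A; set u := - v.
have [r r0 hr] := small_radius u; exists r => //.
pose la := \sum_i `|a i 0| * r.
have la0 : 0 <= la by apply: sumr_ge0 => i _; rewrite mulr_ge0 ?normr_ge0 // ltW.
exists (la * 2) => d.
pose F := lin_form (map_mx Num.norm a) * fps_geom (lin_form (map_mx Num.norm u)).
have dF : majorized (lin_form a * fps_geom (lin_form u)) F.
  by apply: majorizedM; [apply: majorized_lin|apply/majorized_geom/majorized_lin].
apply: (@le_trans _ _ (\sum_(m : 'X_{1..M < d}) F m * r ^+ mdeg m)).
  apply: ler_sum => m _; apply: ler_wpM2r; last exact: dF.
  by rewrite exprn_ge0 // ltW.
have -> : \sum_(m : 'X_{1..M < d}) F m * r ^+ mdeg m = (fps_trunc d F).@[fun => r].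
  rewrite /fps_trunc raddf_sum /=; apply: eq_bigr => m _.
  by rewrite mevalZ mevalX mdegE (big_morph _ (exprD r) (expr0 r)).
case: d => [|d].
  by rewrite /fps_trunc big1 ?raddf0 ?mulr_ge0 ?ler0n // => -[].
rewrite trunc_lin_frac mevalM meval_lin_mpoly raddf_sum /=.
have -> : \sum_i (map_mx Num.norm a) i 0 * r = la by apply: eq_bigr => i _; rewrite mxE.
apply: ler_wpM2l => //.
set s := \sum_i `|u i 0| * r.
have s0 : 0 <= s by apply: sumr_ge0 => i _; rewrite mulr_ge0 ?normr_ge0 // ltW.
have s2 : s <= 2^-1 by rewrite /s -mulr_suml.
apply: (@le_trans _ _ (\sum_(k < d) 2^-1 ^+ k)).
  apply: ler_sum => k _; rewrite rmorphXn /= meval_lin_mpoly.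
  have -> : \sum_i (map_mx Num.norm u) i 0 * r = s by apply: eq_bigr => i _; rewrite mxE.
  by apply: lerXn2r; rewrite ?nnegrE ?invr_ge0 ?ler0n.
have h2 : (2^-1 - 1 : C) = - 2^-1.
  by rewrite -[X in _ - X](@mulVf _ (2 : C)) ?pnatr_eq0 //; ring.
have : \sum_(k < d) (2^-1 : C) ^+ k = 2 * (1 - 2^-1 ^+ d).
  have := subrX1 (2^-1 : C) d; rewrite h2 => /(congr1 (fun x => - 2 * x)).
  rewrite !mulNr mulrN opprK mulrA mulfV ?pnatr_eq0 // mul1r => <-.
  by rewrite -mulrN opprB.
move=> ->; rewrite -[X in _ <= X]mulr1; apply: ler_wpM2l; first exact: ler0n.
by rewrite lerBlDr lerDl exprn_ge0 // invr_ge0 ler0n.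
Qed.

Lemma linfrac_germ M (A : 'M[C]_M) v : holomorphic_germ (linfrac A v).
Proof. by split=> [|j]; [apply: linfrac_vanishing|apply: linfrac_convergent]. Qed.
End Convergence.

(** * Linear fractional automorphisms of a quadric *)
Section Quadric.
Variable R : realType.
Local Notation C := R[i].
Variables (m : nat) (eps : 'I_m -> C).
Local Notation M := (m + 1)%N.
Local Notation wi := (rshift m (ord0 : 'I_1) : 'I_M).

(** The polarized Hermitian form on homogeneous coordinates (x0 : z : w) whose null
    points with x0 = 1 are those of Im w = sum of eps_j |z_j|^2.  The ring S is either
    the field itself, for points, or a ring of series in (Z, conj Z). *)
Definition proj_form (S : comNzRingType) (io : C -> S) (x0 : S) (x : 'rV[S]_M) (y0 : S) (y : 'rV[S]_M) : S :=
  io (2 * 'i)^-1 * (x 0 wi * y0 - x0 * y 0 wi)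
  - \sum_j io (eps j) * (x 0 (lshift 1 j) * y 0 (lshift 1 j)).

(** Quantifying over all scalar extensions lets one computation serve points and
    power series. *)
Definition similitude (A : 'M[C]_M) (v : 'cV[C]_M) (lam : C) :=
  forall (S : comNzRingType) (io : {rmorphism C -> S}) x0 x y0 y,
    proj_form io (x0 + (x *m map_mx io v) 0 0) (x *m map_mx io A)
            (y0 + (y *m map_mx io (map_mx Num.conj v)) 0 0)
            (y *m map_mx io (map_mx Num.conj A)) = io lam * proj_form io x0 x y0 y.

Definition quad_aut A v := A \in unitmx /\ exists2 lam, lam != 0 & similitude A v lam.

Lemma quad_aut_comp A1 v1 A2 v2 : quad_aut A1 v1 -> quad_aut A2 v2 ->
  quad_aut (A1 *m A2) (v1 + A1 *m v2).
Proof.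
move=> [u1 [l1 l10 h1]] [u2 [l2 l20 h2]]; split; first by rewrite unitmx_mul u1.
exists (l1 * l2) => [|S io x0 x y0 y]; first exact: mulf_neq0.
rewrite (rmorphM io) [io l1 * _]mulrC -mulrA -h1 -h2.
by congr (proj_form _ _ _ _ _); rewrite ?map_mxD ?map_mxM ?mulmxDr ?mulmxA // ?mxE ?addrA ?mulmxA.
Qed.

Lemma quad_aut_inv A v : quad_aut A v -> quad_aut (invmx A) (- (invmx A *m v)).
Proof.
move=> [uA [l l0 h]]; split; first by rewrite unitmx_inv.
exists l^-1 => [|S io x0 x y0 y]; first by rewrite invr_eq0.
set X := proj_form _ _ _ _ _.
have -> : proj_form io x0 x y0 y = io l * X.
  rewrite -h; congr (proj_form _ _ _ _ _).
  - by rewrite -mulmxA -map_mxM map_mxN map_mxM mulmxN mulmxA mxE addrNK.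
  - by rewrite -mulmxA -map_mxM mulVmx // map_mx1 mulmx1.
  - rewrite -mulmxA -!map_mxM map_mxN map_mxN map_mxM map_mxM mulmxN mulmxA mxE.
    by rewrite -mulmxA -map_mxM addrNK.
  - by rewrite -mulmxA -!map_mxM mulVmx // !map_mx1 mulmx1.
by rewrite mulrA -(rmorphM io) mulVf // rmorph1 mul1r.
Qed.

(** Near 0 the series converge to the linear fractional map, which multiplies the
    Hermitian form by a nonzero factor. *)
Lemma linfrac_Aut (Q : 'rV[C]_M -> Prop) A v :
  (forall Z, Q Z <-> proj_form idfun 1 Z 1 (map_mx Num.conj Z) = 0) ->
  quad_aut A v -> Aut0 Q (linfrac A v).
Proof.
move=> hQ.
have pres A' v' : quad_aut A' v' -> preserves_germ Q (linfrac A' v').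
  move=> [_ [l l0 h]]; have [r r0 hr] := small_radius v'.
  exists r => // Z W Zr QZ hW.
  have hv : `|(Z *m v') 0 0| <= 2^-1.
    rewrite mxE; apply: le_trans hr; apply: le_trans (ler_norm_sum _ _ _) _.
    rewrite mulr_suml; apply: ler_sum => i _; rewrite normrM mulrC.
    by apply: ler_wpM2l; rewrite ?normr_ge0 // ltW.
  set t := (Z *m v') 0 0 in hv.
  have t1 := addr1_neq0 hv.
  have WE : Z *m A' = (1 + t) *: W.
    apply/rowP => j; rewrite [RHS]mxE.
    rewrite (has_value_unique (hW j) (linfrac_value A' j hv)) mulrC.
    by rewrite mulfVK.
  have mid p q (B : 'M[C]_(p, q)) : map_mx idfun B = B by apply: map_mx_id.
  apply/hQ; have := h _ idfun 1 Z 1 (map_mx Num.conj Z).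
  rewrite !mid -!map_mxM ((hQ Z).1 QZ) mulr0 -/t.
  have -> : (map_mx Num.conj (Z *m v')) 0 0 = Num.conj t by rewrite mxE.
  rewrite WE => e.
  have t2 : Num.conj (1 + t) != 0 by rewrite conjC_eq0.
  apply: (mulfI (mulf_neq0 t1 t2)).
  rewrite mulr0 -[RHS]e /proj_form mulrBr mulr_sumr /= !mxE !rmorphM !rmorphD !rmorph1 /=.
  congr (_ - _); first by ring.
  by apply: eq_bigr => j _; rewrite !mxE rmorphM rmorphD rmorph1 /=; ring.
move=> qA; have qA' := quad_aut_inv qA; have [uA _] := qA.
exists (linfrac (invmx A) (- (invmx A *m v))); split.
- exact: linfrac_germ.
- exact: linfrac_germ.
- exact: linfrac_inverse.
- exact: pres.
- exact: pres.
Qed.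
End Quadric.

(** * Hermitian forms: Witt extension and inertia *)
Section Witt.
Variable C : numClosedFieldType.

Definition ctmx p q (B : 'M[C]_(p, q)) : 'M[C]_(q, p) := (map_mx Num.conj B)^T.
Lemma ctmxM p q r (A : 'M[C]_(p, q)) (B : 'M[C]_(q, r)) : ctmx (A *m B) = ctmx B *m ctmx A.
Proof. by rewrite /ctmx map_mxM trmx_mul. Qed.
Lemma ctmxB p q (A B : 'M[C]_(p, q)) : ctmx (A - B) = ctmx A - ctmx B.
Proof. by rewrite /ctmx map_mxB linearB. Qed.
Lemma ctmxK p q (A : 'M[C]_(p, q)) : ctmx (ctmx A) = A.
Proof. by apply/matrixP => i j; rewrite !mxE conjCK. Qed.
Lemma ctmxZ p q a (A : 'M[C]_(p, q)) : ctmx (a *: A) = Num.conj a *: ctmx A.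
Proof. by rewrite /ctmx map_mxZ linearZ. Qed.
Lemma ctmx1 p : ctmx (1%:M : 'M[C]_p) = 1%:M.
Proof. by rewrite /ctmx map_mx1 trmx1. Qed.

Lemma ctmx_diag p (d : 'rV[C]_p) : (forall j, Num.conj (d 0 j) = d 0 j) ->
  ctmx (diag_mx d) = diag_mx d.
Proof.
move=> h; apply/matrixP => a b; rewrite !mxE eq_sym.
by case: (a =P b) => [->|_]; rewrite ?mulr1n ?mulr0n ?h ?rmorph0.
Qed.

Lemma mxBE p q (A B : 'M[C]_(p, q)) i j : (A - B) i j = A i j - B i j.
Proof. by rewrite !mxE. Qed.

Section Reflection.
Variables (m : nat) (D : 'M[C]_m).
Hypothesis D_herm : ctmx D = D.
Definition isometric (U : 'M[C]_m) := U *m D *m ctmx U = D.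
Definition hf (x y : 'rV[C]_m) : C := (x *m D *m ctmx y) 0 0.

Lemma hfC x y : hf y x = Num.conj (hf x y).
Proof.
have -> : hf y x = (ctmx (x *m D *m ctmx y)) 0 0.
  by rewrite /hf !ctmxM ctmxK D_herm mulmxA.
by rewrite /ctmx mxE mxE.
Qed.
Lemma hfBr x y z : hf x (y - z) = hf x y - hf x z.
Proof. by rewrite /hf ctmxB mulmxBr mxBE. Qed.
Lemma hfBl x y z : hf (x - y) z = hf x z - hf y z.
Proof. by rewrite /hf !mulmxBl mxBE. Qed.
Lemma isometricM U V : isometric U -> isometric V -> isometric (U *m V).
Proof.
move=> hU hV; rewrite /isometric ctmxM -[RHS]hU -[in RHS]hV.
by rewrite !mulmxA.
Qed.
Lemma isometric1 : isometric 1%:M.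
Proof. by rewrite /isometric ctmx1 mulmx1 mul1mx. Qed.
Lemma isometric_hf U x y : isometric U -> hf (x *m U) (y *m U) = hf x y.
Proof.
move=> hU; rewrite /hf ctmxM; congr (fun_of_matrix _ 0 0).
by rewrite -[in RHS]hU !mulmxA.
Qed.

(** The map x |-> x - h(x, d) / h(u, d) d with d = u - e; it is isometric because
    h(u, u) = h(e, e) gives h(d, d) = h(u, d) + conj(h(u, d)). *)
Lemma quasi_reflection u e : hf u u = hf e e -> hf u (u - e) != 0 ->
  exists S, [/\ isometric S, u *m S = e & forall x, hf x (u - e) = 0 -> x *m S = x].
Proof.
move=> hue; set d := u - e; set k := hf u d => k0.
have kc0 : Num.conj k != 0 by rewrite conjC_eq0.
pose P := D *m ctmx d *m d.
have xP x : x *m P = hf x d *: d.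
  rewrite /P !mulmxA [X in X *m d](mx11_scalar _) mul_scalar_mx.
  by [].
exists (1%:M - k^-1 *: P); split; last first.
- by move=> x hx; rewrite mulmxBr mulmx1 -scalemxAr xP hx scale0r scaler0 subr0.
- by rewrite mulmxBr mulmx1 -scalemxAr xP -/k scalerA mulVf // scale1r opprB addrC subrK.
have adP : ctmx P = ctmx d *m d *m D by rewrite /P !ctmxM ctmxK D_herm mulmxA.
have hdd : hf d d = k + Num.conj k.
  by rewrite {1}/d hfBl -/k {1}/d hfBr (hfC u e) /k hfBr rmorphB /= -(hfC u u) hue; ring.
have expand a b (Q : 'M[C]_m) : (1%:M - a *: P) *m D *m (1%:M - b *: Q) =
    D - a *: (P *m D) - b *: (D *m Q - a *: (P *m D *m Q)).
  rewrite mulmxBl mul1mx -scalemxAl mulmxBr mulmx1 -scalemxAr mulmxBl -scalemxAl.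
  by [].
rewrite /isometric ctmxB ctmx1 ctmxZ expand adP.
have -> : P *m D *m (ctmx d *m d *m D) = hf d d *: (P *m D).
  have -> : P *m D *m (ctmx d *m d *m D) = D *m ctmx d *m (d *m D *m ctmx d) *m d *m D.
    by rewrite /P !mulmxA.
  rewrite (mx11_scalar (d *m D *m ctmx d)) -/(hf d d) mul_mx_scalar.
  by rewrite -!scalemxAl.
have -> : D *m (ctmx d *m d *m D) = P *m D by rewrite /P !mulmxA.
apply/matrixP => i j; move: (P *m D) => Y; rewrite !mxE hdd fmorphV /=.
by field; rewrite k0 kc0.
Qed.
End Reflection.

Lemma hf_diag m (eps : 'I_m -> C) x y :
  hf (diag_mx (\row_j eps j)) x y = \sum_j eps j * (x 0 j * Num.conj (y 0 j)).
Proof.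
rewrite /hf mul_mx_diag mxE; apply: eq_bigr => j _.
by rewrite !mxE mulrCA mulrA.
Qed.

(** The rows are carried to the first basis vectors one after the other, each by a
    reflection that fixes the earlier ones. *)
Lemma witt n k (eps : 'I_(n + k) -> C) (B : 'M[C]_(n, n + k)) :
  (forall j, eps j != 0) -> (forall j, Num.conj (eps j) = eps j) ->
  let D := diag_mx (\row_j eps j) in
  (forall a b, hf D (row a B) (row b B) = eps (lshift k a) *+ (a == b)) ->
  exists U, isometric D U /\ B *m U = row_mx 1%:M 0.
Proof.
move=> e0 er D hB.
have DH : ctmx D = D.
  by apply: ctmx_diag => j; rewrite mxE er.
have hfD := hf_diag eps; rewrite -/D in hfD.
have hfe x j : hf D x (delta_mx 0 j) = eps j * x 0 j.
  rewrite hfD (bigD1 j) //= mxE !eqxx rmorph1 mulr1 big1 ?addr0 // => i /negPf ij.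
  by rewrite mxE eqxx ij rmorph0 !mulr0.
have hrow U a b : isometric D U ->
    hf D (row a (B *m U)) (row b (B *m U)) = eps (lshift k a) *+ (a == b).
  by move=> hU; rewrite !row_mul isometric_hf.
have step i : (i <= n)%N -> exists U, isometric D U /\
    forall a : 'I_n, (a < i)%N -> row a (B *m U) = delta_mx 0 (lshift k a).
  elim: i => [_|i IH lin]; first by exists 1%:M; split => //; apply: isometric1.
  have [U [hU rU]] := IH (ltnW lin).
  pose i' := Ordinal lin; pose e : 'rV[C]_(n + k) := delta_mx 0 (lshift k i').
  pose u := row i' (B *m U).
  have ua (a : 'I_n) : (a < i)%N -> u 0 (lshift k a) = 0.
    move=> ai; apply: (mulfI (e0 (lshift k a))); rewrite mulr0 -hfe -rU // /u hrow //.
    by rewrite -val_eqE /= gtn_eqF.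
  have uu : hf D u u = eps (lshift k i') by rewrite /u hrow // eqxx.
  (* if the reflection along u - e is undefined, the one along u + e is not *)
  pose th : C := if u 0 (lshift k i') == 1 then -1 else 1.
  have th2 : th * th = 1 by rewrite /th; case: ifP => _; rewrite ?mulrNN mulr1.
  have thr : Num.conj th = th by rewrite /th; case: ifP => _; rewrite ?rmorphN rmorph1.
  have hfz x : hf D x (th *: e) = th * hf D x e.
    by rewrite /hf ctmxZ thr -scalemxAr mxE.
  have ee : hf D (th *: e) (th *: e) = eps (lshift k i').
    by rewrite hfz hfe mxE mxE !eqxx mulr1 mulrCA th2 mulr1.
  have [||S [hS uS Sfix]] := @quasi_reflection _ D DH u (th *: e).
  - by rewrite uu ee.
  - rewrite hfBr uu hfz hfe mulrCA -[X in X - _]mulr1 -mulrBr mulf_neq0 // subr_eq0.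
    rewrite /th; case: (u 0 _ =P 1) => [->|/eqP ne]; last by rewrite mul1r eq_sym.
    by rewrite mulr1 -addr_eq0 -mulr2n pnatr_eq0.
  pose T : 'M[C]_(n + k) := diag_mx (\row_j (if j == lshift k i' then th else 1)).
  have adT : ctmx T = T.
    apply: ctmx_diag => j; rewrite mxE.
    by case: ifP; rewrite ?thr ?rmorph1.
  have hT : isometric D T.
    rewrite /isometric adT; apply/matrixP => a b.
    rewrite mul_mx_diag mxE mul_mx_diag mxE !mxE.
    case: (a =P b) => [->|]; rewrite ?mulr1n ?mulr0n ?mulr0 ?mul0r //.
    by case: (b =P _) => _; rewrite ?mul1r ?mulr1 // mulrAC th2 mul1r.
  have eT j : (delta_mx 0 j : 'rV[C]_(n + k)) *m T = (if j == lshift k i' then th else 1) *: delta_mx 0 j.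
    apply/rowP => c; rewrite mul_mx_diag !mxE eqxx /=.
    by case: (c =P j) => [->|_]; rewrite ?mul1r ?mulr1 ?mul0r ?mulr0.
  exists (U *m (S *m T)); split; first by apply: isometricM => //; apply: isometricM.
  move=> a; rewrite ltnS leq_eqVlt => /orP[/eqP ai|ai].
    have -> : a = i' by apply: val_inj.
    rewrite mulmxA row_mul -/u mulmxA uS -scalemxAl eT eqxx scalerA th2 scale1r.
    by [].
  rewrite mulmxA row_mul (rU a ai) mulmxA Sfix.
    rewrite eT (inj_eq (@lshift_inj _ _)) -val_eqE /= ltn_eqF // scale1r.
    by [].
  rewrite hfBr hfz hfe mxE eqxx /= (inj_eq (@lshift_inj _ _)) -val_eqE /= gtn_eqF // !mulr0 subr0.
  by rewrite hfC // hfe ua // mulr0 rmorph0.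
have [U [hU rU]] := step n (leqnn n); exists U; split => //.
apply/row_matrixP => a; rewrite rU // row_row_mx row1 row0.
apply/rowP => j; rewrite -(splitK j); case: (split j) => c /=.
  by rewrite row_mxEl !mxE eqxx (inj_eq (@lshift_inj _ _)).
by rewrite row_mxEr !mxE eq_rlshift.
Qed.

(** Each of the l + r equations x_i = 0 for i < l and (x B)_j = 0 for the negative
    directions j lowers the dimension by at most one, so they have a common solution
    x <> 0.  There the form is nonnegative, while it is lam times a positive number. *)
Lemma inertia n m l r (s : nat -> C) (eps : 'I_m -> C) (ng : 'I_r -> nat) (lam : C) (B : 'M[C]_(n, m)) :
  (l + r < n)%N -> (forall j, Num.conj (eps j) = eps j) ->
  (forall j : 'I_m, (exists t, ng t = j) \/ 0 <= eps j) ->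
  (forall i, (l <= i)%N -> s i = 1) ->
  lam != 0 -> Num.conj lam = lam ->
  let D := diag_mx (\row_j eps j) in
  (forall a b, hf D (row a B) (row b B) = lam * (s a *+ (a == b))) ->
  0 < lam.
Proof.
move=> lrn er hng hs l0 lr D hB.
have hfD := hf_diag eps; rewrite -/D in hfD.
pose W : 'M[C]_(n, l + r) := \matrix_(i, c) match split c with
  | inl t => ((i : nat) == t)%:R
  | inr t => if insub (ng t) is Some j then B i j else 0 end.
have [x xW x0] : exists2 x : 'rV[C]_n, x *m W = 0 & x != 0.
  have : kermx W != 0.
    rewrite kermx_eq0 /row_free neq_ltn.
    by rewrite (leq_ltn_trans (rank_leq_col _) lrn).
  by move/rowV0Pn => [x /sub_kermxP xW xn]; exists x.
have xl (i : 'I_n) : (i < l)%N -> x 0 i = 0.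
  move=> il; have /rowP/(_ (lshift r (Ordinal il))) := xW; rewrite !mxE (bigD1 i) //= big1.
    by rewrite mxE -[lshift _ _]/(unsplit (inl _)) unsplitK eqxx mulr1 addr0.
  move=> j /negPf ji; rewrite mxE -[lshift _ _]/(unsplit (inl _)) unsplitK /=.
  by rewrite (val_eqE j i) ji mulr0.
have xneg (j : 'I_m) : (exists t, ng t = j) -> (x *m B) 0 j = 0.
  move=> [t tj]; have /rowP/(_ (rshift l t)) := xW; rewrite [LHS]mxE [RHS]mxE => h.
  rewrite -[RHS]h mxE; apply: eq_bigr => i _; rewrite mxE -[rshift _ _]/(unsplit (inr _)) unsplitK /=.
  by rewrite tj valK.
have pos : 0 <= hf D (x *m B) (x *m B).
  rewrite hfD; apply: sumr_ge0 => j _; case: (hng j) => [/xneg ->|e].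
    by rewrite mul0r mulr0.
  by rewrite mulr_ge0 // mul_conjC_ge0.
have E : hf D (x *m B) (x *m B) = lam * \sum_i x 0 i * Num.conj (x 0 i).
  have -> : hf D (x *m B) (x *m B) = (x *m (B *m D *m ctmx B) *m ctmx x) 0 0.
    by rewrite /hf ctmxM !mulmxA.
  have -> : B *m D *m ctmx B = \matrix_(a, b) (lam * (s a *+ (a == b))).
    apply/matrixP => a b; rewrite [RHS]mxE -hB /hf -row_mul.
    rewrite !mxE; apply: eq_bigr => c _; congr (_ * _).
      by rewrite [RHS]mxE.
    by rewrite !mxE.
  rewrite mxE mulr_sumr; apply: eq_bigr => i _; rewrite [ctmx x _ _]mxE mxE mulrA; congr (_ * _); last by rewrite mxE.
  rewrite (bigD1 i) //= big1 => [|j /negPf ji]; last by rewrite mxE ji mulr0n !mulr0.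
  rewrite mxE eqxx mulr1n addr0; have [il|il] := ltnP i l; first by rewrite xl // mul0r mulr0.
  by rewrite hs // mulr1 mulrC.
have sp : 0 < \sum_i x 0 i * Num.conj (x 0 i).
  have [i xi] : exists i, x 0 i != 0.
    apply/existsP; rewrite -negb_forall; apply: contra x0 => /forallP h.
    by apply/eqP/rowP => i; rewrite mxE; apply/eqP.
  rewrite (bigD1 i) //=; apply: ltr_wpDr.
    by apply: sumr_ge0 => j _; rewrite mul_conjC_ge0.
  by rewrite mul_conjC_gt0.
move: pos; rewrite E pmulr_lge0 // le_eqVlt eq_sym (negPf l0).
by [].
Qed.
End Witt.

(** * The hyperquadrics in diagonal form *)
Section Signs.
Variable R : realType.
Local Notation C := R[i].
Local Notation c0 := ((2 * 'i)^-1 : C).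

Definition sg (s j : nat) : C := if (j < s)%N then -1 else 1.
(** The signs of [herm_renum]: l negative ones among the first n coordinates, l' - l
    among the last k. *)
Definition sgn n k (l l' : nat) (j : 'I_(n + k)) : C :=
  match split j with inl i => sg l i | inr s => sg (l' - l) s end.

Lemma sg_neq0 s j : sg s j != 0.
Proof. by rewrite /sg; case: ifP; rewrite ?oppr_eq0 oner_eq0. Qed.
Lemma sg_real s j : Num.conj (sg s j) = sg s j.
Proof. by rewrite /sg; case: ifP; rewrite ?rmorphN rmorph1. Qed.
Lemma sgn_neq0 n k l l' (j : 'I_(n + k)) : sgn l l' j != 0.
Proof. by rewrite /sgn; case: split => ?; apply: sg_neq0. Qed.
Lemma sgn_real n k l l' (j : 'I_(n + k)) : Num.conj (sgn l l' j) = sgn l l' j.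
Proof. by rewrite /sgn; case: split => ?; apply: sg_real. Qed.
Lemma sgn_l n k l l' i : sgn l l' (lshift k i : 'I_(n + k)) = sg l i.
Proof. by rewrite /sgn -[lshift k i]/(unsplit (inl i)) unsplitK. Qed.
Lemma sgn_r n k l l' i : sgn l l' (rshift n i : 'I_(n + k)) = sg (l' - l) i.
Proof. by rewrite /sgn -[rshift n i]/(unsplit (inr i)) unsplitK. Qed.

Section Herm.
Variables (S : comNzRingType) (io : {rmorphism C -> S}).
Lemma herm_sg m s (a b : 'rV[S]_m) :
  herm s a b = \sum_(j < m) io (sg s j) * (a 0 j * b 0 j).
Proof.
rewrite /herm [RHS](bigID (fun j : 'I_m => (j < s)%N)) /=; congr (_ + _).
  by rewrite -sumrN; apply: eq_bigr => j js; rewrite /sg js rmorphN rmorph1 mulN1r.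
apply: eq_big => j; first by rewrite -leqNgt.
by rewrite /sg ltnNge => ->; rewrite rmorph1 mul1r.
Qed.

Lemma herm_renum_sg n k l l' (a b : 'rV[S]_(n + k)) : (l <= n)%N -> (l <= l')%N ->
  herm_renum l l' a b = \sum_j io (sgn l l' j) * (a 0 j * b 0 j).
Proof.
move=> ln ll'; rewrite /herm_renum.
rewrite (big_mkcond (fun j : 'I_(n + k) => (j < l)%N)).
rewrite (big_mkcond (fun j : 'I_(n + k) => (l <= j < n)%N)).
rewrite (big_mkcond (fun j : 'I_(n + k) => (n <= j < n + l' - l)%N)).
rewrite (big_mkcond (fun j : 'I_(n + k) => (n + l' - l <= j)%N)) /=.
rewrite -sumrN -big_split /= -sumrB -big_split /=; apply: eq_bigr => j _.
rewrite /sgn; case: splitP => i ji; rewrite /sg ji.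
  have -> : (n <= i)%N = false by rewrite leqNgt ltn_ord.
  have -> : (n + l' - l <= i)%N = false by have := ltn_ord i; lia.
  rewrite andbT /=; case: ltnP => _; rewrite ?rmorphN rmorph1; ring.
have -> : (n + i < l)%N = false by lia.
rewrite andbF leq_addr /=.
have -> : (n + i < n + l' - l)%N = (i < l' - l)%N by apply/idP/idP; lia.
have -> : (n + l' - l <= n + i)%N = ~~ (i < l' - l)%N by apply/idP/idP; lia.
by case: ltnP => _ /=; rewrite ?rmorphN rmorph1; ring.
Qed.
End Herm.

Lemma proj_form_affine (S : comNzRingType) (io : C -> S) m (eps : 'I_m -> C) (x y : 'rV[S]_(m + 1)) :
  proj_form eps io 1 x 1 y = io c0 * (x 0 (rshift m ord0) - y 0 (rshift m ord0))
  - \sum_j io (eps j) * (x 0 (lshift 1 j) * y 0 (lshift 1 j)).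
Proof. by rewrite /proj_form mulr1 mul1r. Qed.

Lemma proj_form_coord (S : comNzRingType) (io : C -> S) m (eps : 'I_m -> C) (x y : 'rV[S]_(m + 1))
    (xs ys : 'I_(m + 1) -> S) : (forall j, x 0 j = xs j) -> (forall j, y 0 j = ys j) ->
  proj_form eps io 1 x 1 y = io c0 * (xs (rshift m ord0) - ys (rshift m ord0))
  - \sum_j io (eps j) * (xs (lshift 1 j) * ys (lshift 1 j)).
Proof.
by move=> hx hy; rewrite proj_form_affine hx hy; under eq_bigr => j _ do rewrite hx hy.
Qed.

Section DefiningSeries.
Variables (p m : nat) (eps : 'I_m -> C).
Local Notation wi := (rshift m (ord0 : 'I_1)).

Definition quadric_along (K : 'rV[fps C p]_(m + 1)) : fps C (p + p) :=
  proj_form eps (@fps_C C (p + p)) 1 (hol K) 1 (antihol K).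

Lemma quadric_alongE K : quadric_along K = fps_C c0 * (hol1 (K 0 wi) - antihol1 (K 0 wi))
  - \sum_j fps_C (eps j) * (hol1 (K 0 (lshift 1 j)) * antihol1 (K 0 (lshift 1 j))).
Proof.
exact: (@proj_form_coord _ (@fps_C C _) m eps (hol K) (antihol K) (fun j => hol1 (K 0 j))
  (fun j => antihol1 (K 0 j)) (holE K) (antiholE K)).
Qed.

Lemma quadric_along_coef K a b : quadric_along K (mpair a b) =
  c0 * (K 0 wi a *+ (b == 0%MM) - Num.conj (K 0 wi b) *+ (a == 0%MM))
  - \sum_j eps j * (K 0 (lshift 1 j) a * Num.conj (K 0 (lshift 1 j) b)).
Proof.
rewrite quadric_alongE fpsBE fps_CME fpsBE hol1_coef antihol1_coef fps_sumE; congr (_ - _).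
by apply: eq_bigr => j _; rewrite fps_CME hol1_antihol1_coef.
Qed.
End DefiningSeries.

Lemma hol_vars p : hol (fps_vars C p) = vZ R p.
Proof. by apply: vars_mcomp; apply: vZ_vanishing. Qed.
Lemma antihol_vars p : antihol (fps_vars C p) = vZbar R p.
Proof.
apply/rowP => j; rewrite antiholE fps_varsE antihol1E fps_conjX fps_compX //.
exact: vZbar_vanishing.
Qed.

Lemma quadric_along_vars n l : @vImw R n - herm l (vz R n) (vzbar R n) = quadric_along (fun j : 'I_n => sg l j) (fps_vars C (n + 1)).
Proof.
rewrite /quadric_along hol_vars antihol_vars proj_form_affine (herm_sg (@fps_C C _)).
rewrite /vImw; congr (fps_C _ * (_ - _) - _).
- exact: mxE.
- exact: mxE.
- by apply: eq_bigr => j _; congr (_ * (_ * _)); exact: mxE.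
Qed.

Lemma hyperquadric_seriesE n k l l' : (l <= n)%N -> (l <= l')%N ->
  hyperquadric_series R n k l l' = quadric_along (@sgn n k l l') (fps_vars C (n + k + 1)).
Proof.
move=> ln ll'; rewrite /hyperquadric_series /quadric_along hol_vars antihol_vars proj_form_affine.
rewrite (herm_renum_sg (@fps_C C _)) // /vImw; congr (fps_C _ * (_ - _) - _).
- exact: mxE.
- exact: mxE.
- by apply: eq_bigr => j _; congr (_ * (_ * _)); exact: mxE.
Qed.

Lemma pullback_quadric_along p q m (eps : 'I_m -> C) (K : 'rV[fps C p]_(m + 1)) (F : 'rV[fps C q]_p) :
  vanishing_at0 F -> pullback (quadric_along eps K) F = quadric_along eps (fps_mcomp K F).
Proof.
move=> F0; have hC := pullback_chom F0; have [_ hM _ _] := hC.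
have cC c : pullback (fps_C c) F = fps_C c by apply/fps_compC/pb_vanishing.
rewrite !quadric_alongE (chomB hC) hM cC (chomB hC) !pullback_hol1 // !pullback_antihol1 // !mcompE.
congr (_ - _); rewrite (chom_sum hC); apply: eq_bigr => j _.
by rewrite !hM cC pullback_hol1 // pullback_antihol1 // mcompE.
Qed.

Lemma hyperquadric_proj_form n k l l' Z : (l <= n)%N -> (l <= l')%N ->
  hyperquadric R n k l l' Z <->
  proj_form (@sgn n k l l') idfun 1 Z 1 (map_mx Num.conj Z) = 0.
Proof.
move=> ln ll'; rewrite /hyperquadric (herm_renum_sg idfun) // proj_form_affine /=.
have -> : 'Im (rsubmx Z 0 0) = c0 * (Z 0 (rshift (n + k) ord0) - (map_mx Num.conj Z) 0 (rshift (n + k) ord0)).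
  rewrite !mxE ImE; move: (Z 0 _) => x.
  by rewrite invfM invCi; ring.
split=> [->|/eqP]; last by rewrite subr_eq0 => /eqP ->; apply: eq_bigr => j _; rewrite !mxE.
apply/eqP; rewrite subr_eq0; apply/eqP; apply: eq_bigr => j _; rewrite !mxE.
by [].
Qed.

End Signs.

(** * Two families of automorphisms *)
Section Automorphisms.
Variable R : realType.
Local Notation C := R[i].
Local Notation c0 := ((2 * 'i)^-1 : C).

Lemma proj_formZ (S : comNzRingType) (io : C -> S) m (eps : 'I_m -> C) (a b : S) (x y : 'rV[S]_(m + 1)) :
  proj_form eps io a (a *: x) b (b *: y) = a * b * proj_form eps io 1 x 1 y.
Proof.
rewrite /proj_form !mxE [RHS]mulrBr mulr_sumr; congr (_ - _); first by ring.
by apply: eq_bigr => j _; rewrite !mxE; ring.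
Qed.

Lemma proj_form_descent (S : comNzRingType) (io : C -> S) m (eps : 'I_m -> C)
    (a a' b b' : S) (x x' y y' : 'rV[S]_(m + 1)) (X : S) :
  a = a' -> b = b' -> x' = a *: x -> y' = b *: y ->
  proj_form eps io a' x' b' y' = X -> a * b * proj_form eps io 1 x 1 y = X.
Proof. by move=> <- <- -> -> <-; rewrite proj_formZ. Qed.

Section Pullback.
Variables (m p : nat) (eps : 'I_m -> C).
Implicit Types H : 'rV[fps C p]_(m + 1).

Lemma hol1_mulmx q r (H : 'rV[fps C p]_q) (B : 'M[C]_(q, r)) j :
  hol1 ((H *m map_mx (@fps_C C p) B) 0 j) = (hol H *m map_mx (@fps_C C (p + p)) B) 0 j.
Proof.
have hC := @hol1_chom R p; have [_ hM _ _] := hC.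
rewrite [in LHS]mxE [RHS]mxE (chom_sum hC); apply: eq_bigr => s _.
by rewrite hM (holE H s); congr (_ * _); rewrite !mxE hol1C.
Qed.
Lemma antihol1_mulmx q r (H : 'rV[fps C p]_q) (B : 'M[C]_(q, r)) j :
  antihol1 ((H *m map_mx (@fps_C C p) B) 0 j) =
  (antihol H *m map_mx (@fps_C C (p + p)) (map_mx Num.conj B)) 0 j.
Proof.
have hC := @antihol1_chom R p; have [_ hM _ _] := hC.
rewrite [in LHS]mxE [RHS]mxE (chom_sum hC); apply: eq_bigr => s _.
by rewrite hM (antiholE H s); congr (_ * _); rewrite !mxE antihol1C.
Qed.

(** A linear fractional automorphism multiplies the defining series by a unit: the
    factor of the Hermitian form over the two denominators. *)
Lemma quadric_along_linfrac A v H : quad_aut eps A v -> vanishing_at0 H ->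
  exists2 u : fps C (p + p), u 0%MM != 0 & quadric_along eps (fps_mcomp (linfrac A v) H) = u * quadric_along eps H.
Proof.
move=> [uA [lam l0 sim]] H0; have E := linfrac_comp A v H0; have D0 := den_coef0 v H0.
set T := fps_mcomp _ _ in E *; set d := (1 + _) in E D0.
have [hD hM h1 _] := @hol1_chom R p; have [aD aM a1 _] := @antihol1_chom R p.
have hd : hol1 d = 1 + (hol H *m map_mx (@fps_C C (p + p)) v) 0 0.
  by rewrite /d hD h1 hol1_mulmx.
have ad : antihol1 d = 1 + (antihol H *m map_mx (@fps_C C (p + p)) (map_mx Num.conj v)) 0 0.
  have cong (x : fps C p) (X : fps C (p + p)) : antihol1 x = X -> antihol1 (1 + x) = 1 + X.
    by move=> <-; rewrite aD a1.
  exact: (cong _ _ (antihol1_mulmx H v 0)).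
have hT : hol H *m map_mx (@fps_C C (p + p)) A = hol1 d *: hol T.
  apply/rowP => j; rewrite -hol1_mulmx -E [RHS]mxE (holE T j) -hM; congr hol1.
  exact: mxE.
have aT : antihol H *m map_mx (@fps_C C (p + p)) (map_mx Num.conj A) = antihol1 d *: antihol T.
  apply/rowP => j; rewrite -antihol1_mulmx -E [RHS]mxE (antiholE T j) -aM; congr antihol1.
  exact: mxE.
have Q := proj_form_descent hd ad hT aT (sim _ (@fps_C C (p + p)) 1 (hol H) 1 (antihol H)).
have n0 : (hol1 d * antihol1 d) 0%MM != 0.
  by rewrite -mpair0 hol1_antihol1_coef D0 rmorph1 mulr1 oner_eq0.
have [w wE] := fps_inv_exists n0.
have w0 : w 0%MM != 0.
  apply/eqP => h; move: (congr1 (fun f : fps C (p + p) => f 0%MM) wE).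
  by rewrite fpsM_coef0E h mulr0 fps1E eqxx => /eqP; rewrite eq_sym oner_eq0.
exists (w * fps_C lam).
  by rewrite mulrC fps_CME mulf_neq0.
rewrite -mulrA -[X in w * X]Q mulrA [w * _]mulrC wE mul1r.
by [].
Qed.
End Pullback.

Section Families.
Variables (m : nat) (eps : 'I_m -> C).
Local Notation M := (m + 1)%N.
Local Notation wi := (rshift m (ord0 : 'I_1) : 'I_M).
Local Notation D := (diag_mx (\row_j eps j)).

Definition bil (S : comNzRingType) (io : C -> S) (x y : 'rV[S]_m) : S :=
  (x *m map_mx io D *m y^T) 0 0.

Lemma bilE (S : comNzRingType) (io : {rmorphism C -> S}) x y :
  bil io x y = \sum_j io (eps j) * (x 0 j * y 0 j).
Proof.
rewrite /bil.
have -> : map_mx io D = diag_mx (\row_j io (eps j)).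
  by apply/matrixP => a b; rewrite !mxE rmorphMn.
rewrite mul_mx_diag mxE; apply: eq_bigr => j _.
by rewrite !mxE mulrCA mulrA.
Qed.

Lemma bilZ (S : comNzRingType) (io : {rmorphism C -> S}) (a b : S) x y :
  bil io (a *: x) (b *: y) = a * b * bil io x y.
Proof.
by rewrite !bilE mulr_sumr; apply: eq_bigr => j _; rewrite !mxE; ring.
Qed.

Lemma bilZl (S : comNzRingType) (io : {rmorphism C -> S}) (a : S) x y :
  bil io (a *: x) y = a * bil io x y.
Proof. by rewrite -[y in LHS]scale1r bilZ mulr1. Qed.
Lemma bilZr (S : comNzRingType) (io : {rmorphism C -> S}) (b : S) x y :
  bil io x (b *: y) = b * bil io x y.
Proof. by rewrite -[x in LHS]scale1r bilZ mul1r. Qed.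

Lemma bil_isometric (S : comNzRingType) (io : {rmorphism C -> S}) U x y : isometric D U ->
  bil io (x *m map_mx io U) (y *m map_mx io (map_mx Num.conj U)) = bil io x y.
Proof.
move=> hU; rewrite /bil; congr (fun_of_matrix _ 0 0).
have e : (map_mx io (map_mx Num.conj U))^T = map_mx io (ctmx U).
  by apply/matrixP => i j; rewrite !mxE.
by rewrite trmx_mul e -[in RHS]hU !map_mxM !mulmxA.
Qed.

Lemma bilBl (S : comNzRingType) (io : {rmorphism C -> S}) x x' y :
  bil io (x - x') y = bil io x y - bil io x' y.
Proof.
by rewrite !bilE -sumrB; apply: eq_bigr => j _; rewrite !mxE; ring.
Qed.
Lemma bilBr (S : comNzRingType) (io : {rmorphism C -> S}) x y y' :
  bil io x (y - y') = bil io x y - bil io x y'.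
Proof.
by rewrite !bilE -sumrB; apply: eq_bigr => j _; rewrite !mxE; ring.
Qed.

Lemma proj_formE (S : comNzRingType) (io : {rmorphism C -> S}) x0 (x : 'rV[S]_M) y0 y :
  proj_form eps io x0 x y0 y = io c0 * (rsubmx x 0 0 * y0 - x0 * rsubmx y 0 0)
   - bil io (lsubmx x) (lsubmx y).
Proof.
rewrite /proj_form bilE !mxE; congr (_ - _); apply: eq_bigr => j _.
by rewrite !mxE.
Qed.

(** The map (z, w) |-> (s z U, s^2 w). *)
Lemma lin_aut (U : 'M[C]_m) (s : C) : isometric D U -> U \in unitmx -> s != 0 -> Num.conj s = s ->
  quad_aut eps (block_mx (s *: U) 0 0 (s ^+ 2)%:M) 0.
Proof.
move=> hU uU s0 sr; split.
  rewrite unitmxE det_ublock unitrM detZ unitrM -unitmxE uU unitrX ?unitfE //= det_scalar.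
  by rewrite !expf_neq0.
exists (s ^+ 2) => [|S io x0 x y0 y]; first by rewrite expf_neq0.
rewrite !map_mx0 !mulmx0 !mxE !addr0 !proj_formE.
rewrite !map_block_mx !map_mx0 !map_scalar_mx !map_mxZ.
rewrite -[in LHS](hsubmxK x) -[in LHS](hsubmxK y) !mul_row_block !mulmx0 !addr0 !add0r.
rewrite !row_mxKl !row_mxKr !mul_mx_scalar [RHS]mulrBr; congr (_ - _).
  by rewrite !mxE /= !rmorphXn /= sr; ring.
rewrite /= sr -!scalemxAr bilZ bil_isometric // rmorphXn /= expr2.
by [].
Qed.

(** The isotropy map (z, w) |-> (z - w b, w) / (1 + 2i h(z, b) - (i h(b, b) + r) w): it
    moves the derivative in w of the tangential components, and r is free. *)
Lemma shift_aut (b : 'rV[C]_m) (r : C) : (forall j, Num.conj (eps j) = eps j) ->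
  Num.conj r = r ->
  quad_aut eps (block_mx 1%:M 0 (- b) 1%:M)
    (col_mx ((2 * 'i) *: (D *m ctmx b)) (- ('i * hf D b b + r))%:M).
Proof.
move=> er rr; split.
  by rewrite unitmxE det_lblock !det1 mulr1 unitr1.
exists 1 => [|S io x0 x y0 y]; first exact: oner_neq0.
have DH : ctmx D = D by apply: ctmx_diag => j; rewrite mxE er.
set gam := hf D b b.
have gr : Num.conj gam = gam by rewrite -(hfC DH).
pose iS (B : 'rV[C]_m) : 'rV[S]_m := map_mx io B.
have Db j : (D *m ctmx b) j 0 = eps j * Num.conj (b 0 j) by rewrite mul_diag_mx !mxE.
have gamE : io gam = bil io (iS b) (iS (map_mx Num.conj b)).
  rewrite bilE /gam /hf mul_mx_diag mxE rmorph_sum; apply: eq_bigr => j _ /=.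
  by rewrite !mxE -!rmorphM mulrCA mulrA.
have xb (z : 'rV[S]_m) : (z *m map_mx io (D *m ctmx b)) 0 0 = bil io z (iS (map_mx Num.conj b)).
  rewrite bilE mxE; apply: eq_bigr => j _.
  by rewrite [map_mx _ _ _ _]mxE Db !mxE rmorphM /= mulrCA.
have yb (z : 'rV[S]_m) :
    (z *m map_mx io (map_mx Num.conj (D *m ctmx b))) 0 0 = bil io (iS b) z.
  rewrite bilE mxE; apply: eq_bigr => j _.
  rewrite [map_mx _ (map_mx _ _) _ _]mxE [map_mx _ (D *m _) _ _]mxE Db !mxE.
  by rewrite rmorphM /= conjCK er rmorphM /= mulrC mulrA.
pose z := lsubmx x; pose w := rsubmx x 0 0; pose ch := lsubmx y; pose ta := rsubmx y 0 0.
have xE : x = row_mx z w%:M by rewrite -[LHS]hsubmxK [in LHS](mx11_scalar (rsubmx x)).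
have yE : y = row_mx ch ta%:M by rewrite -[LHS]hsubmxK [in LHS](mx11_scalar (rsubmx y)).
have XA : x *m map_mx io (block_mx 1%:M 0 (- b) 1%:M) = row_mx (z - w *: iS b) w%:M.
  rewrite xE map_block_mx map_mx0 !map_mx1 map_mxN mul_row_block !mulmx1 mulmx0 add0r.
  by rewrite mulmxN mul_scalar_mx.
have YA : y *m map_mx io (map_mx Num.conj (block_mx 1%:M 0 (- b) 1%:M)) =
    row_mx (ch - ta *: iS (map_mx Num.conj b)) ta%:M.
  rewrite yE !map_block_mx !map_mx0 !map_mx1 !map_mxN mul_row_block !mulmx1 mulmx0 add0r.
  by rewrite mulmxN mul_scalar_mx.
have Xv : (x *m map_mx io (col_mx ((2 * 'i) *: (D *m ctmx b)) (- ('i * gam + r))%:M)) 0 0 =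
    2 * io 'i * bil io z (iS (map_mx Num.conj b)) - w * (io 'i * io gam + io r).
  rewrite xE map_col_mx mul_row_col map_mxZ -scalemxAr mxE [X in X + _]mxE xb.
  rewrite map_scalar_mx mul_mx_scalar [X in _ + X]mxE [w%:M _ _]mxE eqxx mulr1n.
  by rewrite rmorphN rmorphD !rmorphM rmorph_nat /=; ring.
have Yv : (y *m map_mx io (map_mx Num.conj (col_mx ((2 * 'i) *: (D *m ctmx b)) (- ('i * gam + r))%:M))) 0 0 =
    - (2 * io 'i * bil io (iS b) ch) + ta * (io 'i * io gam - io r).
  rewrite yE !map_col_mx mul_row_col !map_mxZ -scalemxAr mxE [X in X + _]mxE yb.
  rewrite !map_scalar_mx mul_mx_scalar [X in _ + X]mxE [ta%:M _ _]mxE eqxx mulr1n.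
  rewrite /= rmorphN rmorphD !rmorphM /= gr rr conjCi rmorph_nat.
  by rewrite !(rmorphN, rmorphD, rmorphM, rmorph_nat) /=; ring.
rewrite XA YA Xv Yv rmorph1 mul1r !proj_formE !row_mxKl !row_mxKr -/z -/w -/ch -/ta.
rewrite bilBl !bilBr !bilZl !bilZr -gamE [w%:M _ _]mxE [ta%:M _ _]mxE !eqxx !mulr1n.
have kE : io c0 * (2 * io 'i) = 1.
  rewrite -[2]/(2%:R) -(rmorph_nat io 2) -!rmorphM mulVf ?rmorph1 //.
  by rewrite mulf_neq0 ?pnatr_eq0 ?neq0Ci.
move: (io c0) (io 'i) (io gam) (io r) (bil io z ch) (bil io z _) (bil io _ ch) kE => k I G rh B0 B1 B2 kE.
apply/eqP; rewrite -subr_eq0; apply/eqP.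
transitivity ((k * (2 * I) - 1) * (- w * B2 + w * ta * G - B1 * ta)); first by ring.
by rewrite kE subrr mul0r.
Qed.

End Families.
End Automorphisms.

(** * First-order normalization of an embedding *)
Section Normalization.
Variable R : realType.
Local Notation C := R[i].
Local Notation c0 := ((2 * 'i)^-1 : C).

Lemma c0_neq0 : c0 != 0.
Proof. by rewrite invr_eq0 mulf_neq0 ?pnatr_eq0 ?neq0Ci. Qed.

Lemma quadric_along_vars_coef m (eps : 'I_m -> C) (a b : 'X_{1..m + 1}) :
  quadric_along eps (fps_vars C (m + 1)) (mpair a b) =
  c0 * ((a == U_(rshift m ord0)%MM)%:R *+ (b == 0%MM)
        - (b == U_(rshift m ord0)%MM)%:R *+ (a == 0%MM))
  - \sum_j eps j * ((a == U_(lshift 1 j)%MM)%:R * (b == U_(lshift 1 j)%MM)%:R).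
Proof.
rewrite quadric_along_coef fps_varsE /fps_X rmorph_nat; congr (_ - _).
by apply: eq_bigr => j _; rewrite fps_varsE rmorph_nat.
Qed.

Lemma isometric_unit m (eps : 'I_m -> C) U : (forall j, eps j != 0) ->
  isometric (diag_mx (\row_j eps j)) U -> U \in unitmx.
Proof.
move=> e0 hU.
have : diag_mx (\row_j eps j) \in unitmx.
  rewrite unitmxE det_diag unitfE; apply/prodf_neq0 => j _.
  by rewrite mxE.
by rewrite -hU !unitmx_mul => /andP[/andP[]].
Qed.

(** Comparing the terms of order at most two in H^* Im(w') = a sigma: the last component
    is lam w to first order with lam = a(0) real, and the z-derivatives B of the
    others satisfy h(B, B) = lam h.  By inertia lam > 0, which uses l + l' < n; by Witt's
    theorem a linear automorphism makes B / sqrt(lam) the standard inclusion, and then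
    [shift_aut] removes the derivatives in w. *)
Lemma normalize_jet n k l l' (H : 'rV[fps C (n + 1)]_(n + k + 1))
    (a sigma : fps C ((n + 1) + (n + 1))) :
  (l <= l')%N -> (l + l' < n)%N -> vanishing_at0 H -> a 0%MM != 0 ->
  (forall al be, (mdeg al + mdeg be < 3)%N ->
     sigma (mpair al be) = quadric_along (fun j : 'I_n => sg R l j) (fps_vars C (n + 1)) (mpair al be)) ->
  quadric_along (@sgn R n k l l') H = a * sigma ->
  exists (A : 'M[C]_(n + k + 1)) (v : 'cV[C]_(n + k + 1)),
    quad_aut (@sgn R n k l l') A v /\
    jacobian0 (fps_mcomp (linfrac A v) H) = block_mx (row_mx 1%:M 0) 0 0 1%:M.
Proof.
move=> ll' lln H0 a0 hs key; set eps := @sgn R n k l l' in key *.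
pose wi : 'I_(n + 1) := rshift n ord0; pose wo : 'I_(n + k + 1) := rshift (n + k) ord0.
pose zi (i : 'I_n) : 'I_(n + 1) := lshift 1 i.
pose G := H 0 wo.
have s00 : sigma 0%MM = 0.
  rewrite -mpair0 hs ?mdeg0 // quadric_along_vars_coef !(eq_sym 0%MM) !mnm1_eq0 eqxx subrr mulr0 sub0r.
  by rewrite big1 ?oppr0 // => j _; rewrite eq_sym mnm1_eq0 mul0r mulr0.
have sU i : sigma (mpair U_(i)%MM 0%MM) = c0 * (i == wi)%:R.
  rewrite hs ?mdeg1 ?mdeg0 // quadric_along_vars_coef mnmU_inj mnm1_eq0 mulr0n subr0 eqxx mulr1n.
  rewrite big1 ?subr0 // => j _.
  by rewrite [0%MM == _]eq_sym mnm1_eq0 !mulr0.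
have sV i : sigma (mpair 0%MM U_(i)%MM) = - (c0 * (i == wi)%:R).
  rewrite hs ?mdeg1 ?mdeg0 // quadric_along_vars_coef mnmU_inj mnm1_eq0 mulr0n eqxx mulr1n.
  rewrite big1 ?subr0 => [|j _]; first by rewrite sub0r mulrN.
  by rewrite [0%MM == _]eq_sym mnm1_eq0 mul0r !mulr0.
have GU i : G U_(i)%MM = a 0%MM * (i == wi)%:R.
  have := congr1 (fun f : fps C ((n + 1) + (n + 1)) => f (mpair U_(i)%MM 0%MM)) key.
  rewrite quadric_along_coef -/wo H0 rmorph0 mul0rn subr0 eqxx mulr1n big1 ?subr0 => [|s _]; last first.
    by rewrite H0 rmorph0 !mulr0.
  rewrite -[in RHS]mpairUl fpsM_coefU s00 mulr0 addr0 mpairUl sU mulrCA.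
  by move/(mulfI c0_neq0).
have GV : Num.conj (a 0%MM) = a 0%MM.
  have := congr1 (fun f : fps C ((n + 1) + (n + 1)) => f (mpair 0%MM U_(wi)%MM)) key.
  rewrite quadric_along_coef -/wo H0 mul0rn sub0r eqxx mulr1n big1 ?subr0 => [|s _]; last first.
    by rewrite H0 mul0r !mulr0.
  rewrite -[in RHS]mpairUr fpsM_coefU s00 mulr0 addr0 mpairUr sV eqxx mulr1 -/G GU eqxx mulr1.
  by rewrite !mulrN mulrC => /oppr_inj/(mulIf c0_neq0).
set lam := a 0%MM in a0 GU GV.
pose B : 'M[C]_(n, n + k) := \matrix_(i, s) H 0 (lshift 1 s) U_(zi i)%MM.
pose b0 : 'rV[C]_(n + k) := \row_s H 0 (lshift 1 s) U_(wi)%MM.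
have JH : jacobian0 H = block_mx B 0 b0 lam%:M.
  apply/matrixP => i j; rewrite mxE -(splitK i) -(splitK j).
  case: (split i) => i'; case: (split j) => j' /=.
  - by rewrite block_mxEul mxE.
  - by rewrite block_mxEur (ord1 j') -/G GU eq_lrshift mulr0 mxE.
  - by rewrite block_mxEdl (ord1 i') mxE.
  - by rewrite block_mxEdr (ord1 i') (ord1 j') -/G GU eqxx mulr1 mxE eqxx.
have er := @sgn_real R n k l l'; have e0 := @sgn_neq0 R n k l l'.
have hB i j : hf (diag_mx (\row_s eps s)) (row i B) (row j B) = lam * (sg R l i *+ (i == j)).
  have -> : hf (diag_mx (\row_s eps s)) (row i B) (row j B) =
      \sum_s eps s * (H 0 (lshift 1 s) U_(zi i)%MM * Num.conj (H 0 (lshift 1 s) U_(zi j)%MM)).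
    by rewrite hf_diag; apply: eq_bigr => s _; rewrite !mxE.
  have := congr1 (fun f : fps C ((n + 1) + (n + 1)) => f (mpair U_(zi i)%MM U_(zi j)%MM)) key.
  rewrite quadric_along_coef !mnm1_eq0 !mulr0n subrr mulr0 sub0r.
  rewrite (@split_coef1 _ _ _ _ _ _ 0%MM 0%MM U_(zi i)%MM U_(zi j)%MM) ?add0m //; last first.
    move=> a1 b1 a2 b2 ea eb ne.
    case: (mnmU_split ea) => -[a1E a2E]; case: (mnmU_split eb) => -[b1E b2E]; rewrite a2E b2E.
    - by rewrite mpair0 s00 mulr0.
    - by rewrite sV eq_lrshift mulr0 oppr0 mulr0.
    - by rewrite sU eq_lrshift mulr0 mulr0.
    - by case: ne; rewrite a1E b1E.
  rewrite mpair0 -/lam hs ?mdeg1 // quadric_along_vars_coef !mnm1_eq0 !mulr0n subrr mulr0 sub0r.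
  rewrite mulrN => /oppr_inj ->; congr (_ * _).
  rewrite (bigD1 i) //= big1 => [|s /negPf si]; last first.
    by rewrite mnmU_inj (inj_eq (@lshift_inj _ _)) eq_sym si mul0r mulr0.
  rewrite eqxx mul1r addr0 mnmU_inj (inj_eq (@lshift_inj _ _)) eq_sym.
  by case: (i =P j) => _; rewrite ?mulr1 ?mulr0.
have lam_gt0 : 0 < lam.
  apply: (@inertia C n (n + k) l l' (sg R l) eps (fun t : 'I_l' => if (t < l)%N then t : nat else (n + (t - l))%N) lam B) => //.
  - move=> j; rewrite -(splitK j); case: (split j) => i /=.
      rewrite /eps sgn_l /sg; case: ifP => il; last by right; apply: ler01.
      left; have lt : (i < l')%N by apply: leq_trans ll'.
      by exists (Ordinal lt); rewrite /= il.
    rewrite /eps sgn_r /sg; case: ifP => il; last by right; apply: ler01.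
    left; have lt : (l + i < l')%N by lia.
    by exists (Ordinal lt); rewrite /= ltnNge leq_addr /= addKn.
  - by move=> i li; rewrite /sg ltnNge li.
pose s := sqrtC lam.
have s_gt0 : 0 < s by rewrite sqrtC_gt0.
have s0 : s != 0 by rewrite gt_eqF.
have ss : s * s = lam by rewrite -expr2 sqrtCK.
have sr : Num.conj s = s by apply/CrealP; rewrite ger0_real // ltW.
have sVr : Num.conj s^-1 = s^-1 by rewrite fmorphV /= sr.
have hB' i j : hf (diag_mx (\row_s eps s)) (row i (s^-1 *: B)) (row j (s^-1 *: B)) =
    eps (lshift k i) *+ (i == j).
  have -> : hf (diag_mx (\row_s eps s)) (row i (s^-1 *: B)) (row j (s^-1 *: B)) =
      s^-1 * s^-1 * hf (diag_mx (\row_s eps s)) (row i B) (row j B).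
    rewrite /hf !linearZ /= ctmxZ sVr -!scalemxAl -scalemxAr scalerA mxE.
    by [].
  by rewrite hB mulrA -invfM ss mulVf // mul1r /eps sgn_l.
have [U [hU BU]] := witt e0 er hB'.
have uU := isometric_unit e0 hU.
have sV0 : s^-1 != 0 by rewrite invr_eq0.
have qa1 := lin_aut hU uU sV0 sVr.
pose b1 := b0 *m (s^-1 *: U).
have qa2 := @shift_aut R (n + k) eps b1 0 er (rmorph0 _).
set A1 := block_mx (s^-1 *: U) _ _ _ in qa1; set A2 := block_mx _ _ _ _ in qa2.
set v2 := col_mx _ _ in qa2.
exists (A1 *m A2), (0 + A1 *m v2); split; first exact: quad_aut_comp.
rewrite -linfrac_linfrac //.
have T0 : vanishing_at0 (fps_mcomp (linfrac A1 0) H).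
  by apply: mcomp_vanishing => //; apply: linfrac_vanishing.
rewrite linfrac_jacobian // linfrac_jacobian // JH /A1 mulmx_block !mulmx0 !mul0mx !addr0 add0r.
rewrite -scalemxAr scalemxAl BU -/b1 -scalar_mxM expr2 -invfM ss mulfV // /A2 mulmx_block.
rewrite !mulmx1 !mul0mx !mulmx0 !addr0 mul1mx subrr; congr block_mx; exact: add0r.
Qed.

(** If a(0) = 0, the last component of H has no linear term, and then the differential
    maps into the complex tangent space. *)
Lemma transversal_unit n k l l' (rho a : fps C ((n + 1) + (n + 1)))
    (H : 'rV[fps C (n + 1)]_(n + k + 1)) :
  (l <= n)%N -> (l <= l')%N -> rho 0%MM = 0 -> vanishing_at0 H ->
  pullback (hyperquadric_series R n k l l') H = a * rho ->
  CR_transversal rho (hyperquadric_series R n k l l') H -> a 0%MM != 0.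
Proof.
move=> ln ll' r0 H0 key tr; apply/negP => /eqP a0; apply: tr => v _.
move: key; rewrite hyperquadric_seriesE // pullback_quadric_along // vars_mcomp //.
set eps := @sgn R n k l l' => key.
pose wo : 'I_(n + k + 1) := rshift (n + k) ord0.
have GU i : H 0 wo U_(i)%MM = 0.
  have := congr1 (fun f : fps C ((n + 1) + (n + 1)) => f (mpair U_(i)%MM 0%MM)) key.
  rewrite quadric_along_coef -/wo H0 rmorph0 mul0rn subr0 eqxx mulr1n big1 ?subr0 => [|s _]; last first.
    by rewrite H0 rmorph0 !mulr0.
  rewrite -[in RHS]mpairUl fpsM_coefU r0 a0 mulr0 mul0r addr0 => /eqP.
  by rewrite mulf_eq0 (negPf c0_neq0) => /eqP.
have tan (x : 'rV[C]_(n + k + 1)) : x 0 wo = 0 ->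
    tangent (quadric_along eps (fps_vars C (n + k + 1))) x.
  move=> xw; rewrite /tangent big1 // => i _; rewrite mpairUl mpairUr !quadric_along_vars_coef.
  have z0 (p q : 'X_{1..n + k + 1}) : (p == 0%MM) || (q == 0%MM) -> \sum_j eps j * ((p == U_(lshift 1 j)%MM)%:R
      * (q == U_(lshift 1 j)%MM)%:R) = 0.
    case/orP => /eqP ->; rewrite big1 // => j _.
      by rewrite [0%MM == _]eq_sym mnm1_eq0 mul0r mulr0.
    by rewrite [0%MM == _]eq_sym mnm1_eq0 !mulr0.
  rewrite !z0 ?eqxx ?orbT // !subr0 !mnm1_eq0 !mulr0n subr0 sub0r !mulr1n mnmU_inj.
  case: (i =P _) => [->|_]; first by rewrite xw rmorph0 !mulr0 addr0.
  by rewrite oppr0 mulr0 !mul0r addr0.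
have xw : (v *m jacobian0 H) 0 wo = 0.
  by rewrite mxE big1 // => i _; rewrite mxE GU mulr0.
split; first exact: tan.
exists (- 'i *: (v *m jacobian0 H)); first by apply: tan; rewrite mxE xw mulr0.
by rewrite scalerA mulrN -expr2 sqrCi opprK scale1r.
Qed.
End Normalization.

(** * Comparison of the two embeddings *)

Lemma unit_multiplier (A : comPzRingType) (t x y c s : A) : x * c = 1 ->
  t * (y * s) = y * c * (t * (x * s)).
Proof.
move=> h; transitivity ((x * c) * (t * (y * s))); first by rewrite h mul1r.
by ring.
Qed.

Section Assembly.
Variable R : realType.
Local Notation C := R[i].

Lemma split_quadricE n k l l' p (f : 'rV[fps C p]_n) (phi : 'rV[fps C p]_k) (g : 'rV[fps C p]_1) :
  fps_C (2 * 'i) * quadric_along (@sgn R n k l l') (row_mx (row_mx f phi) g) =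
  split_quadric (2 * 'i) (fun j : 'I_n => sg R l j) (fun j : 'I_k => sg R (l' - l) j) (g 0 0) f phi.
Proof.
apply: fps_ext_split => a b; rewrite fps_CME quadric_along_coef split_quadric_coef row_mxEr.
have i2 : (2 * 'i : C) != 0 by rewrite mulf_neq0 ?pnatr_eq0 ?neq0Ci.
rewrite mulrBr mulrA mulfV // mul1r big_split_ord /= mulrDr opprD addrA.
congr (_ - _ * _ - _ * _); apply: eq_bigr => j _.
  by rewrite sgn_l row_mxEl row_mxEl.
by rewrite sgn_r row_mxEl row_mxEr.
Qed.

(** The components in the directions tangent to the standard copy of C^(n+1). *)
Definition horizontal n k p (K : 'rV[fps C p]_(n + k + 1)) : 'rV[fps C p]_(n + 1) :=
  row_mx (lsubmx (lsubmx K)) (rsubmx K).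

Section Blocks.
Variables (n k p q : nat) (K : 'rV[fps C p]_(n + k + 1)).
Lemma f_compE j : (lsubmx (lsubmx K)) 0 j = K 0 (lshift 1 (lshift k j)).
Proof. by rewrite 2!mxE. Qed.
Lemma phi_compE s : (rsubmx (lsubmx K)) 0 s = K 0 (lshift 1 (rshift n s)).
Proof. by rewrite 2!mxE. Qed.
Lemma g_compE : (rsubmx K) 0 0 = K 0 (rshift (n + k) ord0).
Proof. by rewrite mxE; congr (K 0 (rshift _ _)); apply: ord1. Qed.
Lemma horizontal_vanishing : vanishing_at0 K -> vanishing_at0 (horizontal K).
Proof. by move=> K0; apply: row_mx_vanishing => j; rewrite ?f_compE ?mxE; apply: K0. Qed.
End Blocks.

Lemma lsub_mcomp p q a b (K : 'rV[fps C p]_(a + b)) (F : 'rV[fps C q]_p) :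
  lsubmx (fps_mcomp K F) = fps_mcomp (lsubmx K) F.
Proof. by apply/rowP => j; rewrite !mxE. Qed.
Lemma rsub_mcomp p q a b (K : 'rV[fps C p]_(a + b)) (F : 'rV[fps C q]_p) :
  rsubmx (fps_mcomp K F) = fps_mcomp (rsubmx K) F.
Proof. by apply/rowP => j; rewrite !mxE. Qed.

Definition normal_jac n k : 'M[C]_(n + 1, n + k + 1) := block_mx (row_mx 1%:M 0) 0 0 1%:M.

Lemma normal_entry n k (K : 'rV[fps C (n + 1)]_(n + k + 1)) :
  jacobian0 K = normal_jac n k ->
  [/\ forall i j, K 0 (lshift 1 (lshift k i)) U_(lshift 1 j)%MM = (i == j)%:R,
      forall i, K 0 (lshift 1 (lshift k i)) U_(rshift n ord0)%MM = 0,
      forall s i, K 0 (lshift 1 (rshift n s)) U_(i)%MM = 0,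
      forall j, K 0 (rshift (n + k) ord0) U_(lshift 1 j)%MM = 0 &
      K 0 (rshift (n + k) ord0) U_(rshift n ord0)%MM = 1].
Proof.
move=> J; have E i j : K 0 j U_(i)%MM = normal_jac n k i j by rewrite -J mxE.
split=> [i j|i|s i|j|]; rewrite E /normal_jac.
- by rewrite block_mxEul row_mxEl mxE eq_sym.
- by rewrite block_mxEdl mxE.
- rewrite -(splitK i); case: (split i) => i' /=.
    by rewrite block_mxEul row_mxEr mxE.
  by rewrite block_mxEdl mxE.
- by rewrite block_mxEur mxE.
- by rewrite block_mxEdr mxE.
Qed.

Lemma horizontal_jac n k (K : 'rV[fps C (n + 1)]_(n + k + 1)) :
  jacobian0 K = normal_jac n k -> jacobian0 (horizontal K) = 1%:M.
Proof.
move=> /normal_entry[fz fw _ gz gw]; apply/matrixP => i j; rewrite mxE [RHS]mxE /horizontal.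
rewrite -(splitK i) -(splitK j); case: (split i) => i'; case: (split j) => j' /=.
- by rewrite row_mxEl 2!mxE fz (inj_eq (@lshift_inj _ _)) eq_sym.
- by rewrite row_mxEr mxE (ord1 j') gz eq_lrshift.
- by rewrite row_mxEl 2!mxE (ord1 i') fw eq_rlshift.
- by rewrite row_mxEr mxE (ord1 i') (ord1 j') gw eqxx.
Qed.

Lemma coef_lt2_eq0 p (f : fps C p) : f 0%MM = 0 -> (forall i, f U_(i)%MM = 0) ->
  forall m, (mdeg m < 2)%N -> f m = 0.
Proof.
move=> f0 fU m; case e: (mdeg m) => [|[|d]] // _.
  by move/eqP: e; rewrite mdeg_eq0 => /eqP ->.
by have /mdeg1P[i /eqP ->] : mdeg m == 1%N by rewrite e.
Qed.

Lemma levi_jet n l (A : fps C (n + n + 1)) :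
  (forall mu, (mdeg mu < 3)%N -> A mu = 0) ->
  forall al be, (mdeg al + mdeg be < 3)%N ->
  (@vImw R n - herm l (vz R n) (vzbar R n)
   - fps_comp A (row_mx (row_mx (vz R n) (vzbar R n)) (@vRew R n)%:M)) (mpair al be) =
  quadric_along (fun j : 'I_n => sg R l j) (fps_vars C (n + 1)) (mpair al be).
Proof.
move=> A3 al be d3; rewrite -quadric_along_vars fpsBE.
have V : vanishing_at0 (row_mx (row_mx (vz R n) (vzbar R n)) (@vRew R n)%:M).
  apply: row_mx_vanishing.
    apply: row_mx_vanishing => j; rewrite /vz /vzbar mxE; first exact: vZ_vanishing.
    exact: vZbar_vanishing.
  move=> j; rewrite (ord1 j) mxE eqxx mulr1n /vRew fps_CME fpsDE /vw /vwbar.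
  by rewrite [X in X 0%MM + _]mxE [X in _ + X 0%MM]mxE vZ_vanishing vZbar_vanishing addr0 mulr0.
have o : ordge 3 (fps_comp A (row_mx (row_mx (vz R n) (vzbar R n)) (@vRew R n)%:M)).
  by apply: fps_comp_ord => //; apply/ordgeE.
by rewrite ((ordgeE _ _).1 o) ?subr0 // mdeg_pair.
Qed.

Lemma pullback_hyperquadric_series n k l l' p (H : 'rV[fps C p]_(n + k + 1)) : (l <= n)%N -> (l <= l')%N ->
  vanishing_at0 H -> pullback (hyperquadric_series R n k l l') H = quadric_along (@sgn R n k l l') H.
Proof.
move=> ln ll' H0; rewrite (hyperquadric_seriesE R k ln ll') (pullback_quadric_along _ _ H0).
by rewrite (vars_mcomp H0).
Qed.

Lemma pullback_mul n N (r1 r2 : fps C (N + N)) (F : 'rV[fps C n]_N) : vanishing_at0 F ->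
  pullback (r1 * r2) F = pullback r1 F * pullback r2 F.
Proof. by move=> F0; have [_ m _ _] := pullback_chom F0; apply: m. Qed.

Lemma herm_holE m s p (phi : 'rV[fps C p]_m) :
  herm s (hol phi) (antihol phi) =
  \sum_(j < m) fps_C (sg R s j) * (hol1 (phi 0 j) * antihol1 (phi 0 j)).
Proof.
rewrite (herm_sg (@fps_C C (p + p))); apply: eq_bigr => j _.
congr (_ * (_ * _)); [exact: holE | exact: antiholE].
Qed.

Lemma normalize_embedding n k l l' (rho sigma u : fps C ((n + 1) + (n + 1)))
    (H : 'rV[fps C (n + 1)]_(n + k + 1)) (F0 : 'rV[fps C (n + 1)]_(n + 1)) :
  (l <= l')%N -> (l + l' < n)%N -> rho 0%MM = 0 ->
  formal_embedding rho (hyperquadric_series R n k l l') H ->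
  CR_transversal rho (hyperquadric_series R n k l l') H ->
  vanishing_at0 F0 -> u 0%MM != 0 -> pullback rho F0 = u * sigma ->
  (forall al be, (mdeg al + mdeg be < 3)%N ->
     sigma (mpair al be) = quadric_along (fun j : 'I_n => sg R l j) (fps_vars C (n + 1)) (mpair al be)) ->
  exists A v (b : fps C ((n + 1) + (n + 1))),
    [/\ quad_aut (@sgn R n k l l') A v,
        vanishing_at0 (fps_mcomp (linfrac A v) (fps_mcomp H F0)),
        jacobian0 (fps_mcomp (linfrac A v) (fps_mcomp H F0)) = normal_jac n k,
        b 0%MM != 0 &
        quadric_along (@sgn R n k l l') (fps_mcomp (linfrac A v) (fps_mcomp H F0)) = b * sigma].
Proof.
move=> ll' lln r0 [H0 _ [a key]] tr F00 u0 hu hs.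
have ln : (l <= n)%N by lia.
have a0 := transversal_unit ln ll' r0 H0 key tr.
have HF0 := mcomp_vanishing H0 F00.
pose a' := pullback a F0 * u.
have a'0 : a' 0%MM != 0 by rewrite /a' fpsM_coef0E (pullback_coef0 _ F00) mulf_neq0.
have key' : quadric_along (@sgn R n k l l') (fps_mcomp H F0) = a' * sigma.
  rewrite -(pullback_hyperquadric_series ln ll' HF0) -(pullback_comp _ H0 F00) key (pullback_mul _ _ F00) hu.
  exact: mulrA.
have [A [v [qa J]]] := normalize_jet ll' lln HF0 a'0 hs key'.
have [w w0 hw] := quadric_along_linfrac qa HF0.
exists A, v, (w * a'); split => //.
- by apply: mcomp_vanishing => //; apply: linfrac_vanishing.
- by rewrite fpsM_coef0E mulf_neq0.
- rewrite hw key'; exact: mulrA.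
Qed.
Lemma change_coordinates p q r s (T : 'rV[fps C q]_r) (H : 'rV[fps C p]_q)
    (F0 : 'rV[fps C s]_p) (F1 : 'rV[fps C s]_s) :
  vanishing_at0 H -> vanishing_at0 F0 -> vanishing_at0 F1 ->
  fps_mcomp (fps_mcomp T H) (fps_mcomp F0 F1) = fps_mcomp (fps_mcomp T (fps_mcomp H F0)) F1.
Proof.
move=> H0 F00 F10.
rewrite (fps_mcompA T H0 (mcomp_vanishing F00 F10)) -(fps_mcompA H F00 F10).
by rewrite (fps_mcompA T (mcomp_vanishing H0 F00) F10).
Qed.

Lemma change_coordinates_linfrac p q s (A : 'M[C]_q) v B u (H : 'rV[fps C p]_q)
    (F0 : 'rV[fps C s]_p) (F1 : 'rV[fps C s]_s) :
  vanishing_at0 H -> vanishing_at0 F0 -> vanishing_at0 F1 ->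
  fps_mcomp (fps_mcomp (linfrac (A *m B) (v + A *m u)) H) (fps_mcomp F0 F1) =
  fps_mcomp (linfrac B u) (fps_mcomp (fps_mcomp (linfrac A v) (fps_mcomp H F0)) F1).
Proof.
move=> H0 F00 F10; have HF := mcomp_vanishing H0 F00.
have HF1 := mcomp_vanishing HF F10.
apply: etrans (change_coordinates _ H0 F00 F10) _.
apply: etrans (fps_mcompA _ HF F10) _; apply: etrans (esym (linfrac_linfrac A B v u HF1)) _.
apply: f_equal; exact: esym (fps_mcompA (linfrac A v) HF F10).
Qed.

(** Inverting the components of K1 along C^(n+1) makes K1 a graph (z, phi1, w).  The
    other embedding then satisfies [core_rigidity], and the automorphism
    [shift_aut] with b = 0 divides it by 1 - r w', that is, multiplies it by
    v = 1 + r w. *)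
Lemma two_normalized_embeddings n k1 k2 l l1 l2 (b1 b2 sigma : fps C ((n + 1) + (n + 1)))
    (K1 : 'rV[fps C (n + 1)]_(n + k1 + 1)) (K2 : 'rV[fps C (n + 1)]_(n + k2 + 1)) :
  (k1 + k2 < n)%N -> vanishing_at0 K1 -> vanishing_at0 K2 ->
  jacobian0 K1 = normal_jac n k1 -> jacobian0 K2 = normal_jac n k2 -> b1 0%MM != 0 ->
  quadric_along (@sgn R n k1 l l1) K1 = b1 * sigma -> quadric_along (@sgn R n k2 l l2) K2 = b2 * sigma ->
  let z : 'rV[fps C (n + 1)]_n := lsubmx (fps_vars C (n + 1)) in
  let w : 'rV[fps C (n + 1)]_1 := rsubmx (fps_vars C (n + 1)) in
  exists (F1 : 'rV[fps C (n + 1)]_(n + 1)) (phi1 : 'rV[fps C (n + 1)]_k1)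
    (phi2 : 'rV[fps C (n + 1)]_k2) A v,
  [/\ vanishing_at0 F1 /\ jacobian0 F1 = 1%:M, quad_aut (@sgn R n k2 l l2) A v,
      fps_mcomp K1 F1 = row_mx (row_mx z phi1) w /\
      fps_mcomp (linfrac A v) (fps_mcomp K2 F1) = row_mx (row_mx z phi2) w,
      herm (l1 - l) (hol phi1) (antihol phi1) = herm (l2 - l) (hol phi2) (antihol phi2) &
      (forall j mu, (mdeg mu < 2)%N -> phi1 0 j mu = 0) /\
      (forall j mu, (mdeg mu < 2)%N -> phi2 0 j mu = 0)].
Proof.
move=> hn K10 K20 J1 J2 b10 e1 e2 z w.
have G0 := horizontal_vanishing K10.
have [F1 [F10 JF1 GF1]] := formal_inverse G0 (horizontal_jac J1).
have L10 := mcomp_vanishing K10 F10; have L20 := mcomp_vanishing K20 F10.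
have JL1 : jacobian0 (fps_mcomp K1 F1) = normal_jac n k1 by rewrite jacobian0_comp // JF1 mul1mx.
have JL2 : jacobian0 (fps_mcomp K2 F1) = normal_jac n k2 by rewrite jacobian0_comp // JF1 mul1mx.
have p1 : quadric_along (@sgn R n k1 l l1) (fps_mcomp K1 F1) = pullback b1 F1 * pullback sigma F1.
  rewrite -(pullback_quadric_along _ _ F10) e1; exact: pullback_mul.
have p2 : quadric_along (@sgn R n k2 l l2) (fps_mcomp K2 F1) = pullback b2 F1 * pullback sigma F1.
  rewrite -(pullback_quadric_along _ _ F10) e2; exact: pullback_mul.
have hz1 : lsubmx (lsubmx (fps_mcomp K1 F1)) = lsubmx (fps_vars C (n + 1)).
  by rewrite -GF1 !lsub_mcomp /horizontal row_mxKl.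
have hw1 : rsubmx (fps_mcomp K1 F1) = rsubmx (fps_vars C (n + 1)).
  by rewrite -GF1 !rsub_mcomp /horizontal row_mxKr.
exists F1; move: (fps_mcomp K1 F1) (fps_mcomp K2 F1) L10 L20 JL1 JL2 p1 p2 hz1 hw1.
move=> L1 L2 L10 L20 JL1 JL2 p1 p2 hz1 hw1.
pose phi1 : 'rV[fps C (n + 1)]_k1 := rsubmx (lsubmx L1).
have L1E : L1 = row_mx (row_mx z phi1) w.
  by rewrite /z /w -hz1 -hw1 !hsubmxK.
pose f := lsubmx (lsubmx L2); pose phi := rsubmx (lsubmx L2); pose g := rsubmx L2.
have L2E : L2 = row_mx (row_mx f phi) g by rewrite !hsubmxK.
have pb10 : pullback b1 F1 0%MM != 0 by rewrite (pullback_coef0 _ F10).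
have [c cE] := fps_inv_exists pb10.
pose a := pullback b2 F1 * c.
have i2 : (2 * 'i : C) != 0 by rewrite mulf_neq0 ?pnatr_eq0 ?neq0Ci.
have key : split_quadric (2 * 'i) (fun j : 'I_n => sg R l j) (fun j : 'I_k2 => sg R (l2 - l) j) (g 0 0) f phi =
  a * split_quadric (2 * 'i) (fun j : 'I_n => sg R l j) (fun j : 'I_k1 => sg R (l1 - l) j) (w 0 0) z phi1.
  rewrite -(split_quadricE l l1) -(split_quadricE l l2) -L1E -L2E p1 p2; exact: unit_multiplier.
have [f_z f_w phi_U g_z g_w] := normal_entry JL2.
have [_ _ phi1_U _ _] := normal_entry JL1.
have zE : z = \row_(j < n) fps_X C (lshift 1 j) by apply/rowP => j; rewrite !mxE.
have wE : w 0 0 = fps_X C (rshift n ord0) by rewrite !mxE.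
rewrite zE wE in key.
have phi1_ord s m : (mdeg m < 2)%N -> phi1 0 s m = 0.
  by apply: coef_lt2_eq0 => [|i]; rewrite /phi1 phi_compE; [apply: L10|apply: phi1_U].
have phi_ord s m : (mdeg m < 2)%N -> phi 0 s m = 0.
  by apply: coef_lt2_eq0 => [|i]; rewrite /phi phi_compE; [apply: L20|apply: phi_U].
have gE : g 0 0 = L2 0 (rshift (n + k2) ord0) := g_compE L2.
have fE j : f 0 j = L2 0 (lshift 1 (lshift k2 j)) := f_compE L2 j.
have g00 : g 0 0 0%MM = 0 by rewrite gE; apply: L20.
have gz j : g 0 0 U_(lshift 1 j)%MM = 0 by rewrite gE.
have gw : g 0 0 U_(rshift n ord0)%MM = 1 by rewrite gE.
have f00 j : f 0 j 0%MM = 0 by rewrite fE; apply: L20.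
have fz i j : f 0 i U_(lshift 1 j)%MM = (i == j)%:R by rewrite fE.
have fw i : f 0 i U_(rshift n ord0)%MM = 0 by rewrite fE.
have [v [r [rr vE vg vf hphi]]] := core_rigidity i2 (fun j : 'I_n => sg_neq0 R l j) hn
  g00 gz gw f00 fz fw phi_ord phi1_ord key.
pose phi2 := v *: phi.
(* 1 - r g is the inverse of v because v g = w *)
have qa3 := @shift_aut R (n + k2) (@sgn R n k2 l l2) 0 r (@sgn_real R n k2 l l2) rr.
set A3' := block_mx _ _ _ _ in qa3; set v3 := col_mx _ _ in qa3.
have L3 : fps_mcomp (linfrac A3' v3) L2 = row_mx (row_mx z phi2) w.
  apply/esym/linfrac_comp_uniq => //.
  have -> : row_mx (row_mx z phi2) w = v *: L2.
    rewrite L2E !scale_row_mx; congr (row_mx (row_mx _ _) _).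
      by rewrite zE; apply/rowP => j; rewrite [RHS]mxE; exact: esym (vf j).
    apply/rowP => j; rewrite (ord1 j) [RHS]mxE.
    exact: etrans wE (esym vg).
  have A3E : A3' = 1%:M by rewrite /A3' oppr0 -scalar_mx_block.
  rewrite A3E map_mx1 mulmx1 scalerA.
  suff -> : (1 + (L2 *m map_mx (@fps_C C _) v3) 0 0) * v = 1 by rewrite scale1r.
  have -> : (L2 *m map_mx (@fps_C C _) v3) 0 0 = - fps_C r * g 0 0.
    rewrite L2E /v3 map_col_mx mul_row_col.
    have -> : ctmx (0 : 'rV[C]_(n + k2)) = 0 by rewrite /ctmx map_mx0 trmx0.
    rewrite mulmx0 scaler0 map_mx0 mulmx0 add0r map_scalar_mx mul_mx_scalar mxE.
    have -> : hf (diag_mx (\row_j (@sgn R n k2 l l2 j))) 0 0 = 0.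
      by rewrite /hf !mul0mx mxE.
    by rewrite mulr0 add0r /= fps_CN.
  rewrite mulrDl mul1r -mulrA [g 0 0 * v]mulrC vg {1}vE mulNr addrK.
  by [].
exists phi1, phi2, A3', v3; split => //.
- rewrite (herm_holE _ phi1) (herm_holE _ phi2); apply: etrans (esym hphi) _.
  apply: eq_bigr => s _; have -> : phi2 0 s = v * phi 0 s by exact: mxE.
  reflexivity.
- split=> s m m2; first exact: phi1_ord.
  have -> : phi2 0 s = v * phi 0 s by exact: mxE.
  have o : ordge (0 + 2) (v * phi 0 s).
    by apply: ordgeM => //; apply/ordgeE => m'; apply: phi_ord.
  by rewrite ((ordgeE _ _).1 o).
Qed.
End Assembly.

Theorem theorem5p3 (R : realType) (n l k1 k2 l1 l2 : nat)
    (rho : fps R[i] ((n + 1) + (n + 1)))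
    (H1 : 'rV[fps R[i] (n + 1)]_(n + k1 + 1))
    (H2 : 'rV[fps R[i] (n + 1)]_(n + k2 + 1))
    (hl : (2 * l <= n)%N)
    (hM : formal_hypersurface rho)
    (hLevi : levi_nondegenerate l rho)
    (hH1 : formal_embedding rho (hyperquadric_series R n k1 l l1) H1)
    (hT1 : CR_transversal rho (hyperquadric_series R n k1 l l1) H1)
    (hH2 : formal_embedding rho (hyperquadric_series R n k2 l l2) H2)
    (hT2 : CR_transversal rho (hyperquadric_series R n k2 l l2) H2)
    (hk : (k1 <= k2)%N)
    (hl1 : (l <= l1 < n - l)%N)
    (hl2 : (l <= l2 < n - l)%N)
    (hn : (k1 + k2 < n)%N) :
  exists (T1 : 'rV[fps R[i] (n + k1 + 1)]_(n + k1 + 1))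
         (T2 : 'rV[fps R[i] (n + k2 + 1)]_(n + k2 + 1))
         (F : 'rV[fps R[i] (n + 1)]_(n + 1))
         (phi1 : 'rV[fps R[i] (n + 1)]_k1)
         (phi2 : 'rV[fps R[i] (n + 1)]_k2),
    let z : 'rV[fps R[i] (n + 1)]_n := lsubmx (fps_vars R[i] (n + 1)) in
    let w : 'rV[fps R[i] (n + 1)]_1 := rsubmx (fps_vars R[i] (n + 1)) in
    [/\ Aut0 (hyperquadric R n k1 l l1) T1 /\ Aut0 (hyperquadric R n k2 l l2) T2,
        formal_coordinates F,
        fps_mcomp (fps_mcomp T1 H1) F = row_mx (row_mx z phi1) w /\
        fps_mcomp (fps_mcomp T2 H2) F = row_mx (row_mx z phi2) w,
        herm (l1 - l) (hol phi1) (antihol phi1) =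
        herm (l2 - l) (hol phi2) (antihol phi2) &
        (forall j mu, (mdeg mu < 2)%N -> phi1 0 j mu = 0) /\
        (forall j mu, (mdeg mu < 2)%N -> phi2 0 j mu = 0)].

Proof.
have [ln1 ll1] : (l <= l1)%N /\ (l + l1 < n)%N by case/andP: hl1 => ? ?; split; lia.
have [ln2 ll2] : (l <= l2)%N /\ (l + l2 < n)%N by case/andP: hl2 => ? ?; split; lia.
have ln : (l <= n)%N by lia.
have [_ r0 _] := hM.
have [F0 [A [u [[F00 JF0] _ A3 u0 hu]]]] := hLevi.
set sigma := _ - _ in hu.
have hs := levi_jet l A3; rewrite -/sigma in hs.
have [A1 [v1 [b1 [qa1 K10 J1 b10 e1]]]] := normalize_embedding ln1 ll1 r0 hH1 hT1 F00 u0 hu hs.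
have [A2 [v2 [b2 [qa2 K20 J2 b20 e2]]]] := normalize_embedding ln2 ll2 r0 hH2 hT2 F00 u0 hu hs.
have [H10 _ _] := hH1; have [H20 _ _] := hH2.
have [F1 [phi1 [phi2 [Ar [vr [[F10 JF1] qar [EL1 EL2] Eh Eo]]]]]] :=
  two_normalized_embeddings hn K10 K20 J1 J2 b10 e1 e2.
exists (linfrac A1 v1), (linfrac (A2 *m Ar) (v2 + A2 *m vr)), (fps_mcomp F0 F1), phi1, phi2.
move=> z w; have H1F := mcomp_vanishing H10 F00; have H2F := mcomp_vanishing H20 F00.
have FF := mcomp_vanishing F00 F10.
have E1 := etrans (change_coordinates (linfrac A1 v1) H10 F00 F10) EL1.
have E2 := etrans (change_coordinates_linfrac A2 v2 Ar vr H20 F00 F10) EL2.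
split; [| | |exact: Eh|exact: Eo].
- split; apply: linfrac_Aut.
  + by move=> Z; apply: hyperquadric_proj_form.
  + exact: qa1.
  + by move=> Z; apply: hyperquadric_proj_form.
  + exact: quad_aut_comp qa2 qar.
- split; first exact: FF.
  by rewrite (jacobian0_comp _ F10) JF1 mul1mx.
- split; [exact E1 | exact E2].
Qed.
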